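(* Let $\mathcal{K}\subset\mathbb{R}_{+}$ have an accumulation point and let $h=h(k)$ be analytic. Suppose that $f^{(1)},f^{(2)}\in L^{2}(\Omega)$ are two sources such that their radiated waves (the solutions $u_k^{(1)},u_k^{(2)}\in H^1(\Omega)$ of the Direct Problem at frequency $k$ with sources $f^{(1)}$ and $f^{(2)}$, respectively) coincide on the surface $\Gamma$ for all frequencies $k\in\mathcal{K}$, i.e. $\gamma u_k^{(1)}=\gamma u_k^{(2)}$ on $\Gamma$ for all $k\in\mathcal{K}$. Then $f^{(1)}=f^{(2)}$.
   Context: Setting. $\Omega\subset\mathbb{R}^3$ is a bounded open domain with Lipschitz boundary $\Gamma$. The coefficients $a,b$ are real valued with $a,b\in L^{\infty}(\Omega)$; there is a constant $a_0$ with $0<a_0\le a(x)$; $b>0$ and $b^{-1}\in L^{\infty}(\Omega)$; and the supports of $1-a$ and $1-b$ lie within $\Omega$. Frequencies are numbers $k>0$, and $h=h(k)$ is a known function of the frequency with $h(k)\neq0$. All function spaces consist of complex-valued functions; $\langle\cdot,\cdot\rangle_{L^2}$ denotes the sesquilinear $L^2$ inner product (linear in the first argument), and on $\Gamma$ also its extension to the duality pairing between $H^{-1/2}(\Gamma)$ and $H^{1/2}(\Gamma)$. $\gamma:H^1(\Omega)\to H^{1/2}(\Gamma)$ is the trace operator. For $k>0$, $\Lambda_k:H^{1/2}(\Gamma)\to H^{-1/2}(\Gamma)$ is the exterior Dirichlet-to-Neumann map: $\Lambda_k g=\partial_\nu v$ on $\Gamma$, where $v\in H^1_{\rm loc}(\mathbb{R}^3\setminus\overline{\Omega})$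 is the solution (its existence and uniqueness being taken as known) of $\Delta v+k^2v=0$ in $\mathbb{R}^3\setminus\overline{\Omega}$ with $v=g$ on $\Gamma$ satisfying the Sommerfeld radiation condition $\lim_{r\to\infty}r(\partial_r v-ikv)=0$, $r=|x|$; $\nu$ is the unit normal on $\Gamma$ pointing out of $\Omega$. Direct Problem at frequency $k>0$: given $f\in L^2(\Omega)$, find $u=u_k\in H^1(\Omega)$ with $$\langle a\nabla u,\nabla v\rangle_{L^2(\Omega)}-k^2\langle bu,v\rangle_{L^2(\Omega)}-\langle\Lambda_k\gamma u,\gamma v\rangle_{L^2(\Gamma)}=h(k)\langle f,v\rangle_{L^2(\Omega)}\quad\text{for all }v\in H^1(\Omega).$$ It is taken as known that for every $k>0$ this problem has a unique solution $u_k\in H^1(\Omega)$, depending continuously on $f\in L^2(\Omega)$. *)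

(* Defs.v *)
From HB Require Import structures.
From mathcomp Require Import all_boot all_order all_algebra.
From mathcomp Require Import all_classical all_reals all_analysis.
From mathcomp.real_closed Require Import complex.

Set Implicit Arguments.
Unset Strict Implicit.
Unset Printing Implicit Defensive.

Import Order.TTheory GRing.Theory Num.Theory.
Import numFieldNormedType.Exports.

Local Open Scope classical_set_scope.
Local Open Scope ring_scope.
Local Open Scope complex_scope.

Definition leb3 {R : realType} :=
  ((@lebesgue_measure R \x @lebesgue_measure R) \x @lebesgue_measure R)%E.

Definition leb2 {R : realType} := (@lebesgue_measure R \x @lebesgue_measure R)%E.

Definition coord {R : realType} (i : 'I_3) (x : R * R * R) : R :=
  if i == 0%N :> nat then x.1.1 else if i == 1%N :> nat then x.1.2 else x.2.

Definition basis3 (R : realType) (i : 'I_3) : R * R * R :=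
  (((i == 0%N :> nat)%:R, (i == 1%N :> nat)%:R), (i == 2%N :> nat)%:R).

Definition dot {R : realType} (x y : R * R * R) : R :=
  \sum_(i < 3) coord i x * coord i y.

(* The library norm of R * R * R is the sup norm. *)
Definition enorm {R : realType} (x : R * R * R) : R := Num.sqrt (dot x x).

Definition eball {R : realType} (r : R) : set (R * R * R) :=
  [set x | enorm x < r].

Definition pd {R : realType} (i : 'I_3) (f : R * R * R -> R) :
    R * R * R -> R :=
  fun x => 'D_(basis3 R i) f x.

Definition pds {R : realType} (s : seq 'I_3) (f : R * R * R -> R) :=
  foldr pd f s.

Definition classC {R : realType} (n : nat) (D : set (R * R * R))
    (f : R * R * R -> R) : Prop :=
  forall s : seq 'I_3, (size s <= n)%N -> forall x, D x ->
    {for x, continuous (pds s f)} /\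
    ((size s < n)%N -> forall i, derivable (pds s f) x (basis3 R i)).

(* Real-valued test functions: the elements of C_c^oo(D), as functions on the
   whole space. *)
Definition test_fun {R : realType} (D : set (R * R * R))
    (f : R * R * R -> R) : Prop :=
  [/\ forall n, classC n setT f,
      compact (closure [set x | f x != 0]) &
      closure [set x | f x != 0] `<=` D].

Definition ctest_fun {R : realType} (D : set (R * R * R))
    (f : R * R * R -> R[i]) : Prop :=
  test_fun D (fun x => complex.Re (f x)) /\
  test_fun D (fun x => complex.Im (f x)).

Definition cpd {R : realType} (i : 'I_3) (f : R * R * R -> R[i]) :
    R * R * R -> R[i] :=
  fun x => pd i (fun y => complex.Re (f y)) x +i*
    pd i (fun y => complex.Im (f y)) x.

Definition sqmod {R : realType} (z : R[i]) : R :=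
  complex.Re z ^+ 2 + complex.Im z ^+ 2.

Definition cint {R : realType} (D : set (R * R * R))
    (F : R * R * R -> R[i]) : R[i] :=
  Rintegral leb3 D (fun x => complex.Re (F x)) +i*
  Rintegral leb3 D (fun x => complex.Im (F x)).

Definition inner {R : realType} (D : set (R * R * R))
    (f g : R * R * R -> R[i]) : R[i] :=
  cint D (fun x => f x * conjc (g x)).

Definition ae_eq_on {R : realType} (D : set (R * R * R)) (T : Type)
    (f g : R * R * R -> T) : Prop :=
  {ae @leb3 R, forall x, D x -> f x = g x}.

Definition sqL2 {R : realType} (D : set (R * R * R))
    (f : R * R * R -> R[i]) : \bar R :=
  (\int[leb3]_(x in D) (sqmod (f x))%:E)%E.

(* Elements of L^2(D), H^1(D), L^2(Gamma) are represented by functions on the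
   whole space; only their values on the set matter, up to null sets. *)
Definition inL2 {R : realType} (D : set (R * R * R))
    (f : R * R * R -> R[i]) : Prop :=
  [/\ measurable_fun D (fun x => complex.Re (f x)),
      measurable_fun D (fun x => complex.Im (f x)) & (sqL2 D f < +oo)%E].

Definition inLoo {R : realType} (D : set (R * R * R))
    (a : R * R * R -> R) : Prop :=
  measurable_fun D a /\
  exists M : R, {ae @leb3 R, forall x, D x -> `|a x| <= M}.

(* The essential support, relative to the whole space, of a function given
   on [D]. *)
Definition esupp {R : realType} (D : set (R * R * R))
    (f : R * R * R -> R) : set (R * R * R) :=
  [set x | forall U, nbhs x U ->
    ~ {ae @leb3 R, forall y, D y -> U y -> f y = 0}].

(* Real test functions suffice, both sides being complex linear in them. *)
Definition weak_pd {R : realType} (D : set (R * R * R)) (i : 'I_3)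
    (u w : R * R * R -> R[i]) : Prop :=
  forall f : R * R * R -> R, test_fun D f ->
    cint D (fun x => u x * (pd i f x)%:C) = - cint D (fun x => w x * (f x)%:C).

(* An element of H^1(D) carries its (a.e. unique) weak gradient. *)
Record H1 {R : realType} (D : set (R * R * R)) := MkH1 {
  h1val :> R * R * R -> R[i];
  h1grad : 'I_3 -> R * R * R -> R[i];
  h1_L2 : inL2 D h1val;
  h1grad_L2 : forall i, inL2 D (h1grad i);
  h1_weak : forall i, weak_pd D i h1val (h1grad i)
}.

Definition sqH1 {R : realType} (D : set (R * R * R))
    (u : R * R * R -> R[i]) (G : 'I_3 -> R * R * R -> R[i]) : \bar R :=
  (sqL2 D u + \sum_(i < 3) sqL2 D (G i))%E.

Definition bdry {R : realType} (D : set (R * R * R)) : set (R * R * R) :=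
  closure D `\` interior D.

Definition disk {R : realType} (r : R) : set (R * R) :=
  [set y | y.1 ^+ 2 + y.2 ^+ 2 < r ^+ 2].

Definition frame_pt {R : realType} (o : R * R * R) (e : 'I_3 -> R * R * R)
    (y : R * R) (z : R) : R * R * R :=
  o + (y.1 *: e (inord 0%N) + y.2 *: e (inord 1%N) + z *: e (inord 2%N)).

(* A cylinder, in some orthonormal coordinates, in which [D] is the
   subgraph of a Lipschitz function. *)
Record lip_chart {R : realType} (D : set (R * R * R)) := MkChart {
  ch_org : R * R * R;
  ch_frame : 'I_3 -> R * R * R;
  ch_rad : R;
  ch_height : R;
  ch_fun : R * R -> R;
  ch_orthonormal : forall i j, dot (ch_frame i) (ch_frame j) = (i == j)%:R;
  ch_rad_gt0 : 0 < ch_rad;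
  ch_lipschitz : exists L : R, L.-lipschitz ch_fun;
  ch_bounded : forall y, disk ch_rad y -> `|ch_fun y| < ch_height;
  ch_subgraph : forall y z, disk ch_rad y -> `|z| < ch_height ->
    (D (frame_pt ch_org ch_frame y z) <-> z < ch_fun y)
}.

Definition ch_map {R : realType} (D : set (R * R * R)) (c : lip_chart D)
    (y : R * R) : R * R * R :=
  frame_pt (ch_org c) (ch_frame c) y (ch_fun c y).

Definition lipschitz_boundary {R : realType} (D : set (R * R * R)) : Prop :=
  forall x, bdry D x ->
    exists (c : lip_chart D) (y : R * R), disk (ch_rad c) y /\ ch_map c y = x.

Definition bounded_lipschitz_domain {R : realType}
    (Omega : set (R * R * R)) : Prop :=
  [/\ open Omega, connected Omega, bounded_set Omega &
      lipschitz_boundary Omega].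

(* [D] is a bounded Lipschitz domain and Gamma its boundary; elements of
   L^2(Gamma) are represented by functions on the whole space of which only
   the values on Gamma matter. The density sqrt(1 + |grad ch_fun|^2) of the
   surface measure in a chart lies between 1 and a constant, and Gamma is
   covered by finitely many charts: the space L^2(Gamma), its null sets and its
   convergent sequences are those obtained chart by chart, without the density.
   No integral over Gamma enters in any other way. *)
Definition sqL2_chart {R : realType} (D : set (R * R * R)) (c : lip_chart D)
    (g : R * R * R -> R[i]) : \bar R :=
  (\int[leb2]_(y in disk (ch_rad c)) (sqmod (g (ch_map c y)))%:E)%E.

Definition inL2_bdry {R : realType} (D : set (R * R * R))
    (g : R * R * R -> R[i]) : Prop :=
  forall c : lip_chart D,
    [/\ measurable_fun (disk (ch_rad c)) (fun y => complex.Re (g (ch_map c y))),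
        measurable_fun (disk (ch_rad c)) (fun y => complex.Im (g (ch_map c y))) &
        (sqL2_chart c g < +oo)%E].

Definition cvgL2_bdry {R : realType} (D : set (R * R * R))
    (gn : nat -> R * R * R -> R[i]) (g : R * R * R -> R[i]) : Prop :=
  forall c : lip_chart D,
    (fun n => sqL2_chart c (fun x => gn n x - g x)) @ \oo --> (0 : \bar R)%E.

(* The trace, as the closure of the restriction to the boundary Gamma of
   [Omega]: [g] is the trace on Gamma, taken from the side of the open set [D]
   (the domain [Omega] or its exterior), of the function [u] with weak gradient
   [G]. Convergence is in H^1_loc(closure D), which for bounded [D] is
   convergence in H^1(D). *)
Definition trace_from {R : realType} (Omega D : set (R * R * R))
    (u : R * R * R -> R[i]) (G : 'I_3 -> R * R * R -> R[i])
    (g : R * R * R -> R[i]) : Prop :=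
  inL2_bdry Omega g /\
  exists phi : nat -> R * R * R -> R[i],
    [/\ forall n, ctest_fun setT (phi n),
        forall r : R, (fun n => sqH1 (D `&` eball r)
            (fun x => phi n x - u x) (fun i x => cpd i (phi n) x - G i x))
          @ \oo --> (0 : \bar R)%E &
        cvgL2_bdry Omega phi g].

(* The graph of gamma : H^1(Omega) -> H^{1/2}(Gamma). *)
Definition is_trace {R : realType} (Omega : set (R * R * R)) (u : H1 Omega)
    (g : R * R * R -> R[i]) : Prop :=
  trace_from Omega Omega u (h1grad u) g.

(* H^{1/2}(Gamma) is the range of the trace, with the quotient norm;
   H^{-1/2}(Gamma) is its antidual, [T g] being the pairing <T, g>. *)
Definition inHhalf {R : realType} (Omega : set (R * R * R))
    (g : R * R * R -> R[i]) : Prop :=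
  exists u : H1 Omega, is_trace u g.

Definition inHmhalf {R : realType} (Omega : set (R * R * R))
    (T : (R * R * R -> R[i]) -> R[i]) : Prop :=
  (forall (c : R[i]) g1 g2, inHhalf Omega g1 -> inHhalf Omega g2 ->
     T (fun x => c * g1 x + g2 x) = conjc c * T g1 + T g2) /\
  exists C : R, forall (u : H1 Omega) g, is_trace u g ->
    ((sqmod (T g))%:E <= C%:E * sqH1 Omega u (h1grad u))%E.

Definition exterior {R : realType} (Omega : set (R * R * R)) :
    set (R * R * R) := ~` closure Omega.

(* Radiation condition, uniform in the direction, with
   d_r v = (x / |x|) . grad v. *)
Definition sommerfeld {R : realType} (k : R) (v : R * R * R -> R[i]) : Prop :=
  forall eps : R, 0 < eps -> exists r0 : R, 0 < r0 /\ forall x, r0 < enorm x ->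
    sqmod ((enorm x)%:C *
      (\sum_(i < 3) (coord i x / enorm x)%:C * cpd i v x - (0 +i* k) * v x))
    < eps ^+ 2.

(* The radiating solution with Dirichlet data [g], by its smooth
   representative; the third condition is H^1_loc up to the boundary. *)
Definition exterior_solution {R : realType} (Omega : set (R * R * R)) (k : R)
    (g v : R * R * R -> R[i]) : Prop :=
  let E := exterior Omega in
  [/\ classC 2 E (fun x => complex.Re (v x)) /\ classC 2 E (fun x => complex.Im (v x)),
      forall x, E x ->
        \sum_(i < 3) cpd i (cpd i v) x + (k ^+ 2)%:C * v x = 0,
      forall r : R, inL2 (E `&` eball r) v /\
        forall i, inL2 (E `&` eball r) (cpd i v),
      trace_from Omega E v (fun i => cpd i v) g &
      sommerfeld k v].

Definition exterior_wellposed {R : realType} (Omega : set (R * R * R))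
    (k : R) : Prop :=
  forall g, inHhalf Omega g ->
    (exists v, exterior_solution Omega k g v) /\
    (forall v v', exterior_solution Omega k g v ->
       exterior_solution Omega k g v' ->
       forall x, exterior Omega x -> v x = v' x).

(* The graph of Lambda_k. The normal derivative of [v], with the normal
   pointing out of [Omega] (hence into the exterior), is the element of
   H^{-1/2}(Gamma) given by Green's first identity in the exterior. *)
Definition is_DtN {R : realType} (Omega : set (R * R * R)) (k : R)
    (g : R * R * R -> R[i]) (T : (R * R * R -> R[i]) -> R[i]) : Prop :=
  inHmhalf Omega T /\
  exists v, exterior_solution Omega k g v /\
    forall w, ctest_fun setT w ->
      T w = - (\sum_(i < 3) inner (exterior Omega) (cpd i v) (cpd i w)
               - (k ^+ 2)%:C * inner (exterior Omega) v w).

Definition admissible_coeffs {R : realType} (Omega : set (R * R * R))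
    (a b : R * R * R -> R) : Prop :=
  [/\ inLoo Omega a /\ inLoo Omega b,
      exists a0 : R, 0 < a0 /\ {ae @leb3 R, forall x, Omega x -> a0 <= a x},
      {ae @leb3 R, forall x, Omega x -> 0 < b x} /\
        inLoo Omega (fun x => (b x)^-1) &
      esupp Omega (fun x => 1 - a x) `<=` Omega /\
        esupp Omega (fun x => 1 - b x) `<=` Omega].

Definition direct_solution {R : realType} (Omega : set (R * R * R))
    (a b : R * R * R -> R) (h : R -> R[i]) (k : R) (f : R * R * R -> R[i])
    (u : H1 Omega) : Prop :=
  exists g T, is_trace u g /\ is_DtN Omega k g T /\
    forall (v : H1 Omega) psi, is_trace v psi ->
      \sum_(i < 3) inner Omega (fun x => (a x)%:C * h1grad u i x) (h1grad v i)
      - (k ^+ 2)%:C * inner Omega (fun x => (b x)%:C * u x) v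
      - T psi
      = h k * inner Omega f v.

Definition direct_wellposed {R : realType} (Omega : set (R * R * R))
    (a b : R * R * R -> R) (h : R -> R[i]) (k : R) : Prop :=
  [/\ forall f, inL2 Omega f -> exists u : H1 Omega,
        direct_solution a b h k f u,
      forall f (u u' : H1 Omega), inL2 Omega f ->
        direct_solution a b h k f u -> direct_solution a b h k f u' ->
        ae_eq_on Omega u u' &
      exists C : R, forall f (u : H1 Omega), inL2 Omega f ->
        direct_solution a b h k f u ->
        (sqH1 Omega u (h1grad u) <= C%:E * sqL2 Omega f)%E].

Definition power_series_at {R : realType} (f : R -> R) (k0 : R) : Prop :=
  exists (c : nat -> R) (r : R), 0 < r /\ forall k, `|k - k0| < r ->
    series (fun n => c n * (k - k0) ^+ n) @ \oo --> f k.

Definition analytic_on_pos {R : realType} (h : R -> R[i]) : Prop :=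
  forall k0 : R, 0 < k0 ->
    power_series_at (fun k => complex.Re (h k)) k0 /\
    power_series_at (fun k => complex.Im (h k)) k0.

(* Main.v *)
(* For k in K the difference W of the two fields, divided by h(k), has zero trace
   and the exterior parts cancel, so a(W,v) - k^2 <bW,v> = <f1 - f2,v> for all
   v in H^1. Let A be the operator X |-> F given by a(X,v) = <bF,v> for all v
   in H^1, on X of zero trace. It is symmetric for Re <b.,.>, and A - mu is bounded
   below for every real mu: by well-posedness of the direct problem (with zero
   exterior field) when mu = k^2 > 0, by coercivity and Poincare's inequality
   when mu <= 0. At an accumulation point m of the k^2, divided differences of
   the solutions of (A - mu) W = f' := (f1 - f2)/b yield X_0 = f', X_1, X_2, ...
   with (A - m) X_(j+1) = X_j up to vanishing errors. Unless some X_j vanishes,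
   the ratios |X_(j+1)|/|X_j| increase to a limit r, by symmetry and
   Cauchy-Schwarz, and (A - m)^2 - r^-2 tends to 0 along X_j/|X_j|, which the
   lower bounds of A - m - 1/r and A - m + 1/r forbid. So f' = 0, or some X of zero
   norm satisfies A X = f' + mu X; then f1 - f2 is orthogonal to H^1. *)

(* Only symmetry of [A] is at hand: a field of zero trace tested against all of H^1 has both Cauchy
   data zero, so [A] is a minimal operator, and the proof never makes it self-adjoint or expands in
   eigenfunctions. The substitute is power iteration. Along the orbit, the inverse [S] of [A - m]
   acts as a bounded symmetric operator, the ratios are those of the power method for [S], and
   [S^2 - r^2] tends to 0 on the normalised iterates; so [r] or [-r] is an approximate eigenvalue of
   [S], and [m + 1/r] or [m - 1/r] one of [A]. Nothing is known about where these two numbers lie.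
   This is why a lower bound is required at every real [mu], including [mu <= 0], which is no
   squared frequency and calls for Poincare's inequality. That inequality carries the geometric half
   of the development. A zero trace is a limit of restrictions of test functions in charts, so the
   estimate is proved for smooth functions with a boundary term measured chart by chart, and only
   then passed to the limit. Functions are not identified almost everywhere; hence a semidefinite
   form, and a separate case of [X] with zero norm. *)
From HB Require Import structures.
Require Import Defs.
From mathcomp Require Import all_boot all_order all_algebra.
From mathcomp Require Import all_classical all_reals all_analysis.
From mathcomp Require Import measurable_realfun ring lra.
From mathcomp.real_closed Require Import complex.
Set Implicit Arguments.
Unset Strict Implicit.
Unset Printing Implicit Defensive.
Import Order.TTheory GRing.Theory Num.Theory.
Import numFieldNormedType.Exports.
Local Open Scope classical_set_scope.
Local Open Scope ring_scope.

(** * Symmetric operators bounded below at every real number: power iteration *)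

Section symmetric_operator.
Variables (R : realType) (K : pzRingType) (E : lmodType K).
Variable (iota : {rmorphism R -> K}).
Variables (L : E -> Prop) (ip : E -> E -> R) (G : E -> E -> Prop).

Local Notation "c *** x" := (iota c *: x) (at level 40, left associativity).

Hypothesis L_lin : forall c x y, L x -> L y -> L (x + c *** y).
Hypothesis ipC : forall x y, ip x y = ip y x.
Hypothesis ip_lin : forall c x y z, L x -> L y -> L z ->
  ip (x + c *** y) z = ip x z + c * ip y z.
Hypothesis ip_ge0 : forall x, L x -> 0 <= ip x x.
Hypothesis GL : forall x f, G x f -> L x /\ L f.
Hypothesis G_lin : forall c x y f g, G x f -> G y g ->
  G (x + c *** y) (f + c *** g).
Hypothesis G_sym : forall x f y g, G x f -> G y g -> ip f y = ip x g.
Hypothesis G_reg : forall mu, exists C, forall x f, G x f ->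
  ip x x <= C * ip (f + (- mu) *** x) (f + (- mu) *** x).

Let n x := Num.sqrt (ip x x).

Lemma ip_linr c x y z : L x -> L y -> L z ->
  ip z (x + c *** y) = ip z x + c * ip z y.
Proof. by move=> *; rewrite ipC ip_lin// [ip x z]ipC [ip y z]ipC. Qed.

Lemma ip_sqr_lin c x y : L x -> L y ->
  ip (x + c *** y) (x + c *** y) = ip x x + 2 * c * ip x y + c ^+ 2 * ip y y.
Proof.
move=> Lx Ly; rewrite ip_lin ?ip_linr//; last exact: L_lin.
by rewrite [ip y x]ipC; ring.
Qed.

(** The form is only semidefinite, so [ip y y = 0] does not make [y] zero. In that case the
    trinomial [P] is affine in [c] and nonnegative everywhere, which forces [ip x y = 0]. *)
Lemma ip_CS2 x y : L x -> L y -> ip x y ^+ 2 <= ip x x * ip y y.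
Proof.
move=> Lx Ly; have Hx := ip_ge0 Lx; have Hy := ip_ge0 Ly.
have P c : 0 <= ip x x + 2 * c * ip x y + c ^+ 2 * ip y y.
  by rewrite -ip_sqr_lin//; apply: ip_ge0; exact: L_lin.
move: Hy; rewrite le_eqVlt => /predU1P[y0|y0].
  rewrite -y0 mulr0 -[leRHS](expr0n _ 2) /=.
  have [->//|xy0] := eqVneq (ip x y) 0.
  (* At this [c] the affine function takes the value [-1]. *)
  have := P (- (ip x x + 1) / (2 * ip x y)); rewrite -y0 mulr0 addr0.
  rewrite (_ : 2 * _ * _ = - (ip x x + 1)); last by field.
  lra.
(* The minimiser of the trinomial. *)
have := P (- ip x y / ip y y); rewrite (_ : _ + _ + _ =
  (ip x x * ip y y - ip x y ^+ 2) / ip y y); last by field; rewrite gt_eqF.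
by rewrite pmulr_lge0 ?invr_gt0// subr_ge0.
Qed.

Lemma ip_CS x y : L x -> L y -> `|ip x y| <= n x * n y.
Proof.
move=> Lx Ly; rewrite -sqrtrM ?ip_ge0// -sqrtr_sqr.
by apply: ler_wsqrtr; exact: ip_CS2.
Qed.

Lemma n_sqr x : L x -> n x ^+ 2 = ip x x.
Proof. by move=> Lx; rewrite sqr_sqrtr// ip_ge0. Qed.

Lemma n_lin c x y : L x -> L y -> n (x + c *** y) <= n x + `|c| * n y.
Proof.
move=> Lx Ly.
have h : 0 <= n x + `|c| * n y by rewrite addr_ge0// ?mulr_ge0// sqrtr_ge0.
rewrite -(ger0_norm h) -sqrtr_sqr; apply: ler_wsqrtr.
rewrite ip_sqr_lin// -!n_sqr// sqrrD exprMn real_normK ?num_real// lerD2r.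
rewrite lerD2l -mulr_natr.
have H := ip_CS Lx Ly; have := ler_norm (c * ip x y); rewrite normrM => H1.
have := ler_wpM2l (normr_ge0 c) H; lra.
Qed.

Lemma n_reg mu : exists c, 0 < c /\ forall x f, G x f ->
  n x <= c * n (f + (- mu) *** x).
Proof.
have [C HC] := G_reg mu; exists (Num.sqrt (`|C| + 1)).
split; first by rewrite sqrtr_gt0; have := normr_ge0 C; lra.
move=> x f Gxf; have [Lx Lf] := GL Gxf; rewrite -sqrtrM; last first.
  by have := normr_ge0 C; lra.
apply: ler_wsqrtr; apply: le_trans (HC _ _ Gxf) _; apply: ler_wpM2r.
  by apply: ip_ge0; exact: L_lin.
by have := ler_norm C; lra.
Qed.

(** Serves [no_regular_orbit], where [A - m + 1/r] and then [A - m - 1/r] are applied to [X j.+2];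
    with the coefficients met there, [m] disappears from [p] and [q]. *)
Lemma combine_terms (a b c d f p q : R) (x y z : E) :
  p = a + b + d -> q = b * c + d * f ->
  x + a *** y + b *** (y + c *** z) + d *** (y + f *** z) = x + p *** y + q *** z.
Proof.
move=> -> ->; rewrite !scalerDr !scalerA -!rmorphM !rmorphD !scalerDl -!addrA.
by congr (_ + (_ + (_ + _))); rewrite addrCA.
Qed.

(** Newton's divided differences of the solutions [W i] of [(A - mu i) W i = f]. They replace
    derivatives in the spectral parameter and use the solutions only at the given points. *)
Lemma divided_differences (mu : nat -> R) (f : E) :
  injective mu -> (forall j, exists x, G x (f + mu j *** x)) ->
  exists X : nat -> E, X 0 = f /\
    forall j, G (X j.+1) (X j + mu j *** X j.+1).
Proof.
move=> imu /choice[W HW].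
(* [Y j i] is the divided difference of [W] at the nodes [mu 0], ..., [mu (j-1)] and [mu i]; the
   diagonal gives the orbit. *)
pose Y := fix Y (j i : nat) {struct j} : E := if j is j'.+1 then
  (mu i - mu j')^-1 *** (Y j' i + (-1) *** Y j' j') else W i.
pose X j := if j is j'.+1 then Y j' j' else f.
(* The graph is not assumed nonempty or closed under scaling alone; subtracting a pair from itself
   supplies the origin. *)
have G0 : G 0 0.
  have := G_lin (-1) (HW 0%N) (HW 0%N).
  by rewrite rmorphN1 !scaleN1r !subrr.
exists X; split=> // j; rewrite /=.
(* The induction needs all [i] above the diagonal. In the difference of the equations for [Y j i]
   and [Y j j] the common source [X j] cancels, and after division [Y j j], which is [X j.+1],
   becomes the new source. *)
suff H i : (j <= i)%N -> G (Y j i) (X j + mu i *** Y j i) by exact: H.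
elim: j i => [|j IH] i ji //=.
have nij : mu i - mu j != 0.
  by rewrite subr_eq0 (inj_eq imu); rewrite neq_ltn ji orbT.
have := G_lin (mu i - mu j)^-1 G0 (G_lin (-1) (IH i (ltnW ji)) (IH j (leqnn j))).
rewrite !add0r; set A := Y j i; set B := Y j j.
congr G.
rewrite rmorphN1 !scaleN1r opprD addrACA subrr add0r !scalerBr !scalerA -!rmorphM/=.
rewrite addrCA [mu i * _]mulrC; congr (_ + _); rewrite -!scaleNr -!rmorphN -[X in _ = X + _]scale1r.
rewrite -(rmorph1 iota) -scalerDl -rmorphD/=; congr (iota _ *: _); by field.
Qed.

(* With B = A - m, the ratios |X_(j+1)|/|X_j| increase, up to the summable
   errors e_j, to a limit r, and then (B^2 - r^-2) X_(j+2) = o(|X_(j+2)|),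
   against the lower bounds of A - m - 1/r and A - m + 1/r. *)
Lemma no_regular_orbit (m C : R) (e : nat -> R) (X : nat -> E) :
  (forall j, G (X j.+1) (X j + (m + e j) *** X j.+1)) ->
  (forall j, L (X j)) ->
  (forall j, 0 < n (X j)) ->
  (forall j, `|e j.+1| <= `|e j| / 3) ->
  e @ \oo --> 0 ->
  (forall j, n (X j.+1) <= C * n (X j)) ->
  False.
Proof.
move=> HG LX Npos e3 e0 HC.
have C0 : 0 < C.
  by rewrite -(pmulr_lgt0 _ (Npos 0%N)); exact: lt_le_trans (Npos 1%N) (HC _).
pose r j := n (X j.+1) / n (X j).
have r0 j : 0 < r j by rewrite divr_gt0.
have rC j : r j <= C by rewrite ler_pdivrMr.
(* Symmetry on two consecutive pairs of the orbit; the terms in [m] cancel and only the difference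
   of the errors remains. *)
have S j : ip (X j) (X j.+2) =
    ip (X j.+1) (X j.+1) - (e j - e j.+1) * ip (X j.+1) (X j.+2).
  have := G_sym (HG j) (HG j.+1).
  by rewrite ip_lin// ip_linr//; lra.
(* Log-convexity of the norms, up to an error. The decay by a factor 3 is exactly what bounds
   [|e j - e j.+1|] by the telescoping quantity [2 * (|e j| - |e j.+1|)]. *)
have rstep j : r j <= r j.+1 * (1 + 2 * C * (`|e j| - `|e j.+1|)).
  have d : `|e j - e j.+1| <= 2 * (`|e j| - `|e j.+1|).
    have := ler_normB (e j) (e j.+1); have := e3 j.
    have := normr_ge0 (e j); lra.
  have h1 : n (X j.+1) ^+ 2 <= n (X j) * n (X j.+2) +
      2 * (`|e j| - `|e j.+1|) * (n (X j.+1) * n (X j.+2)).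
    rewrite n_sqr//.
    have -> : ip (X j.+1) (X j.+1) = ip (X j) (X j.+2) +
      (e j - e j.+1) * ip (X j.+1) (X j.+2) by rewrite S; ring.
    apply: lerD; first exact: le_trans (ler_norm _) (ip_CS _ _).
    apply: le_trans (ler_norm _) _; rewrite normrM; apply: ler_pM => //.
    exact: ip_CS.
  have a0 := Npos j; have a1 := Npos j.+1; have a2 := Npos j.+2.
  have h2 : n (X j.+1) ^+ 2 <= n (X j) * n (X j.+2) +
      2 * (`|e j| - `|e j.+1|) * (C * n (X j) * n (X j.+2)).
    apply: le_trans h1 _; rewrite lerD2l; apply: ler_wpM2l.
      by rewrite mulr_ge0// subr_ge0; apply: le_trans (e3 j) _;
         have := normr_ge0 (e j); lra.
    by apply: ler_wpM2r; [exact: ltW|exact: HC].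
  rewrite /r ler_pdivrMr// -(ler_pM2r a1) -expr2; apply: le_trans h2 _.
  rewrite le_eqVlt; apply/orP; left; apply/eqP; field.
  by rewrite gt_eqF.
(* By [1 + t <= exp t] the error factor is a quotient of consecutive exponentials, so this weight
   makes the ratios monotone without moving their limit. *)
pose y j := r j * expR (- (2 * C * `|e j|)).
have ymono : nondecreasing_seq y.
  apply/nondecreasing_seqP => j; rewrite /y.
  apply: le_trans (ler_wpM2r (expR_ge0 _) (rstep j)) _.
  rewrite -[_ * _ * expR _]mulrA; apply: ler_wpM2l; first exact: ltW.
  have := expR_ge1Dx (2 * C * (`|e j| - `|e j.+1|)) => h.
  apply: le_trans (ler_wpM2r (expR_ge0 _) h) _.
  by rewrite -expRD ler_expR; lra.
have ybd j : y j <= C.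
  rewrite /y; apply: le_trans (_ : r j * 1 <= _); last by rewrite mulr1.
  apply: ler_wpM2l; first exact: ltW.
  by rewrite -expR0 ler_expR oppr_le0 !mulr_ge0// ltW.
have ycv : cvgn y.
  apply: nondecreasing_is_cvgn => //; exists C => _ [j _ <-]; exact: ybd.
have aeps : (fun j => `|e j|) @ \oo --> (0 : R).
  by rewrite -(@normr0 R R); apply: cvg_norm.
set ell := limn y in ycv.
have ell0 : 0 < ell.
  apply: lt_le_trans (_ : y 0%N <= _); first by rewrite mulr_gt0// expR_gt0.
  exact: nondecreasing_cvgn_le.
have rcv : r @ \oo --> ell.
  have -> : r = fun j => y j * expR (2 * C * `|e j|).
    apply/funext => j; rewrite /y -mulrA -expRD addrC subrr expR0; lra.
  rewrite -[ell]mulr1; apply: cvgM => //.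
  have a0 : (fun j => 2 * C * `|e j|) @ \oo --> (0 : R).
    by rewrite -[0](mulr0 (2 * C)); apply: cvgM => //; exact: cvg_cst.
  have := continuous_cvg _ (@continuous_expR R 0) a0.
  by rewrite expR0; apply; exact: eventually_filter.
have riv : (fun j => (r j)^-1) @ \oo --> ell^-1.
  by apply: cvgV => //; rewrite gt_eqF.
pose d := ell^-1.
have [c1 [c10 H1]] := n_reg (m - d).
have [c2 [c20 H2]] := n_reg (m + d).
pose p j := e j + e j.+1.
pose q j := e j.+1 ^+ 2 - d ^+ 2.
(* A bound for the squared norm of [X j + p j X j.+1 + q j X j.+2] over that of [X j.+2]. The cross
   product of the outer vectors is replaced through [S], which produces the decisive third term, of
   negative sign in the limit, and the coefficient [4 * |q j * e j.+1|]. *)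
pose T j := ((r j)^-1 * (r j.+1)^-1) ^+ 2 + q j ^+ 2 + 2 * q j * (r j.+1)^-1 ^+ 2
  + p j ^+ 2 * (r j.+1)^-1 ^+ 2 + 2 * `|p j| * ((r j)^-1 * (r j.+1)^-1 ^+ 2)
  + 4 * `|q j * e j.+1| * (r j.+1)^-1.
have main j : 1 <= (c1 * c2) ^+ 2 * T j.
  (* The vector on the left is [(A - (m - d)) X j.+2], so the lower bound at [m - d] applies to
     [X j.+2] and the one at [m + d] to this vector. *)
  have GZ : G (X j.+1 + (e j.+1 + d) *** X j.+2)
      (X j + (m + e j) *** X j.+1 + (e j.+1 + d) *** (X j.+1 + (m + e j.+1) *** X j.+2)).
    exact: G_lin.
  have a0 := Npos j; have a1 := Npos j.+1; have a2 := Npos j.+2.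
  set x := X j in GZ a0; set x1 := X j.+1 in GZ a0 a1.
  set x2 := X j.+2 in GZ a0 a1 a2.
  have Lx : L x by exact: LX. have Lx1 : L x1 by exact: LX. have Lx2 : L x2 by exact: LX.
  have K1 := H1 _ _ (HG j.+1).
  rewrite -/x1 -/x2 -addrA -scalerDl -rmorphD /= in K1.
  rewrite (_ : m + e j.+1 + - (m - d) = e j.+1 + d) in K1; last by ring.
  have K2 := H2 _ _ GZ.
  rewrite (_ : _ + _ *** (x1 + (e j.+1 + d) *** x2) =
     (x + p j *** x1) + q j *** x2) in K2; last first.
    by apply: combine_terms; rewrite /p /q; ring.
  have K3 : n x2 <= (c1 * c2) * n (x + p j *** x1 + q j *** x2).
    apply: le_trans K1 _; rewrite -mulrA; apply: ler_wpM2l => //; exact: ltW.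
  have L3 : L (x + p j *** x1) by exact: L_lin.
  have L4 : L (x + p j *** x1 + q j *** x2) by exact: L_lin.
  have K4 : n x2 ^+ 2 <= (c1 * c2) ^+ 2 * ip (x + p j *** x1 + q j *** x2) (x + p j *** x1 + q j *** x2).
    rewrite -n_sqr// -exprMn; apply: lerXn2r => //; rewrite nnegrE.
      exact: ltW.
    by apply: mulr_ge0; [apply: mulr_ge0; exact: ltW|exact: sqrtr_ge0].
  have K5 : ip (x + p j *** x1 + q j *** x2) (x + p j *** x1 + q j *** x2) <= T j * n x2 ^+ 2.
    rewrite ip_sqr_lin// ip_sqr_lin// ip_lin// S -/x1 -/x2.
    have t1 := ip_CS Lx Lx1; have t2 := ip_CS Lx1 Lx2.
    have t3 : 2 * p j * ip x x1 <= 2 * `|p j| * (n x * n x1).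
      have := ler_norm (p j * ip x x1); rewrite normrM.
      have := ler_wpM2l (normr_ge0 (p j)) t1; lra.
    have t4 : 4 * (q j * e j.+1) * ip x1 x2 <= 4 * `|q j * e j.+1| * (n x1 * n x2).
      have := ler_norm ((q j * e j.+1) * ip x1 x2); rewrite normrM.
      have := ler_wpM2l (normr_ge0 (q j * e j.+1)) t2; lra.
    rewrite -!n_sqr//.
    rewrite (_ : T j * n x2 ^+ 2 = n x ^+ 2 + q j ^+ 2 * n x2 ^+ 2 + 2 * q j * n x1 ^+ 2
       + p j ^+ 2 * n x1 ^+ 2 + 2 * `|p j| * (n x * n x1) + 4 * `|q j * e j.+1| * (n x1 * n x2)).
      by rewrite /p in t3 t4 *; nra.
    rewrite /T /r -/x -/x1 -/x2; field.
    by rewrite !gt_eqF.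
  rewrite -(ler_pM2r (exprn_gt0 2 a2)) mul1r; apply: le_trans K4 _.
  by rewrite -[leRHS]mulrA; apply: ler_wpM2l => //; exact: sqr_ge0.
have cS (u : nat -> R) (l : R) : u @ \oo --> l -> (fun j => u j.+1) @ \oo --> l.
  by rewrite -(@cvg_shiftS R u).
have e1 := cS _ _ e0; have r1 := cS _ _ riv.
have pc : p @ \oo --> (0 : R) by rewrite -[0]addr0; exact: cvgD.
have sq (u : nat -> R) (l : R) : u @ \oo --> l -> (fun j => u j ^+ 2) @ \oo --> l ^+ 2.
  by move=> ul; rewrite expr2; under eq_fun do rewrite expr2; exact: cvgM.
have qc : q @ \oo --> - d ^+ 2.
  rewrite -[- d ^+ 2]add0r; apply: cvgD; last exact: cvg_cst.
  by have := sq _ _ e1; rewrite expr0n.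
have Tc : T @ \oo --> (d * d) ^+ 2 + (- d ^+ 2) ^+ 2 + 2 * (- d ^+ 2) * d ^+ 2
   + 0 ^+ 2 * d ^+ 2 + 2 * `|0 : R| * (d * d ^+ 2) + 4 * `|- d ^+ 2 * 0| * d.
  have cc (x : R) : (fun=> x) @ \oo --> x by exact: cvg_cst.
  have cM (u v : nat -> R) (l k : R) : u @ \oo --> l -> v @ \oo --> k ->
    (fun j => u j * v j) @ \oo --> l * k by move=> *; exact: cvgM.
  have cD (u v : nat -> R) (l k : R) : u @ \oo --> l -> v @ \oo --> k ->
    (fun j => u j + v j) @ \oo --> l + k by move=> *; exact: cvgD.
  have ca (u : nat -> R) (l : R) : u @ \oo --> l ->
    (fun j => `|u j|) @ \oo --> `|l| by move=> *; exact: cvg_norm.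
  have t1 := sq _ _ (cM _ _ _ _ riv r1); have t2 := sq _ _ qc.
  have t3 := cM _ _ _ _ (cM _ _ _ _ (cc 2) qc) (sq _ _ r1).
  have t4 := cM _ _ _ _ (sq _ _ pc) (sq _ _ r1).
  have t5 := cM _ _ _ _ (cM _ _ _ _ (cc 2) (ca _ _ pc)) (cM _ _ _ _ riv (sq _ _ r1)).
  have t6 := cM _ _ _ _ (cM _ _ _ _ (cc 4) (ca _ _ (cM _ _ _ _ qc e1))) r1.
  exact: cD _ _ _ _ (cD _ _ _ _ (cD _ _ _ _ (cD _ _ _ _ (cD _ _ _ _ t1 t2) t3) t4) t5) t6.
(* The first three terms tend to [d^4 + d^4 - 2 d^4]; each of the others contains a factor tending
   to 0. *)
have Tc0 : T @ \oo --> (0 : R).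
  move: Tc; rewrite normr0 !mulr0 normr0 expr0n/=.
  by rewrite (_ : _ + _ = 0)//; ring.
have : (fun j => (c1 * c2) ^+ 2 * T j) @ \oo --> (0 : R).
  by rewrite -[0](mulr0 ((c1 * c2) ^+ 2)); apply: cvgM => //; exact: cvg_cst.
move=> /cvgrPdist_lt /(_ 1 ltr01) [N _ /(_ N (leqnn N))] /=.
rewrite sub0r normrN => h; have := main N; have := ler_norm ((c1 * c2) ^+ 2 * T N).
lra.
Qed.

(** The moduli decrease strictly, whence injectivity. The factor 3 feeds the telescoping in
    [no_regular_orbit], and the bound [d] the growth estimate of the orbit. *)
Lemma rapid_subsequence (M : set R) (m d : R) :
  limit_point M m -> 0 < d -> exists e : nat -> R,
    [/\ injective e, forall j, M (m + e j), forall j, `|e j| <= d,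
      forall j, `|e j.+1| <= `|e j| / 3 & e @ \oo --> 0].
Proof.
move=> lp d0.
(* Positivity of [t] sits inside the existential so that [choice] returns a total function, on which
   the recursion can run. *)
have P (t : R) : exists s, 0 < t -> [/\ M (m + s), s != 0 & `|s| <= t].
  have [t0|t0] := ltP 0 t; last by exists 0.
  have [|x [xm Mx xb]] := lp (ball m t); first exact: nbhsx_ballx.
  exists (x - m) => _; split; first by rewrite addrC subrK.
  - by rewrite subr_eq0.
  - by move: xb; rewrite /ball /= distrC => /ltW.
have [s Hs] := choice P.
pose e := fix e (j : nat) {struct j} : R := if j is j'.+1 then s (`|e j'| / 3) else s d.
have epos j : 0 < `|e j|.
  elim: j => [|j IH] /=; rewrite normr_gt0.
    by have [] := Hs d d0.
  by have [] := Hs (`|e j| / 3); first lra.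
have H j : [/\ M (m + e j), e j != 0 & `|e j| <= if j is j'.+1 then `|e j'| / 3 else d].
  by case: j => [|j] /=; apply: Hs => //; have := epos j; lra.
clearbody e.
have e3 j : `|e j.+1| <= `|e j| / 3 by have [] := H j.+1.
have dec j k : (j < k)%N -> `|e k| < `|e j|.
  elim: k => // k IH; rewrite ltnS leq_eqVlt => /predU1P[->|/IH h].
    by have := e3 k; have := epos k; lra.
  by have := e3 k; have := epos k; lra.
have ebd j : `|e j| <= d * 3^-1 ^+ j.
  elim: j => [|j IH]; first by rewrite expr0 mulr1; have [] := H 0%N.
  by rewrite exprSr; apply: le_trans (e3 j) _; lra.
exists e; split => //.
- move=> j k ejk; case: (ltngtP j k) => // /dec h.
  + by have := h; rewrite -ejk ltxx.
  + by have := h; rewrite ejk ltxx.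
- by move=> j; have [] := H j.
- case=> [|j]; first by have [] := H 0%N.
  by apply: le_trans (ltW (dec 0%N j.+1 _)) _ => //; have [] := H 0%N.
- have g0 : (fun j => d * 3^-1 ^+ j) @ \oo --> (0 : R).
    have h3 : `|3^-1 : R| < 1 by rewrite ger0_norm ?invr_ge0// invf_lt1// ltr1n.
    exact: cvg_geometric h3.
  apply/norm_cvg0P; apply: (squeeze_cvgr _ (cvg_cst 0) g0).
  by apply: nearW => j; rewrite normr_ge0 ebd.
Qed.

(** Only the first two terms of the orbit need to be tested for zero norm: by symmetry and
    Cauchy-Schwarz, a null [X j.+2] would make [X j.+1] null. *)
Lemma regular_symmetric_range (M : set R) (m : R) (f : E) :
  limit_point M m -> L f -> (forall mu, M mu -> exists x, G x (f + mu *** x)) ->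
  ip f f = 0 \/ exists mu x, G x (f + mu *** x) /\ ip x x = 0.
Proof.
move=> Mm Lf HM; have [c [c0 Hc]] := n_reg m.
(* With [|e j| <= 1 / (2 c)] the perturbation costs at most half of the norm of [X j.+1], which can
   be absorbed; this gives the growth constant [2 * c]. *)
have d0 : 0 < (2 * c)^-1 by rewrite invr_gt0; lra.
have [e [ie Me eb e3 e0]] := rapid_subsequence Mm d0.
have [||X [X0 HX]] := @divided_differences (fun j => m + e j) f.
- by move=> i j /addrI /ie.
- by move=> j; exact: HM.
have LX j : L (X j) by case: j => [|j]; [rewrite X0|have [] := GL (HX j)].
have [|f0] := eqVneq (ip f f) 0; first by left.
have [x10|x10] := eqVneq (ip (X 1) (X 1)) 0.
  by right; exists (m + e 0%N), (X 1%N); split=> //; rewrite -X0.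
exfalso; have Npos j : 0 < n (X j).
  rewrite lt_neqAle sqrtr_ge0 andbT eq_sym.
  elim: j => [|[_|j IH]]; rewrite ?X0.
  - by apply: contra_neq f0 => h; rewrite -n_sqr// h expr0n.
  - by apply: contra_neq x10 => h; rewrite -n_sqr// h expr0n.
  - apply: contra_neq IH => h.
    have := G_sym (HX j) (HX j.+1).
    rewrite ip_lin// ip_linr//.
    have := ip_CS (LX j) (LX j.+2); have := ip_CS (LX j.+1) (LX j.+2).
    rewrite h !mulr0 !normr_le0 => /eqP -> /eqP ->.
    rewrite !mulr0 !addr0 => /esym h1.
    by rewrite /n h1 sqrtr0.
apply: (@no_regular_orbit m (2 * c) e X) => // j.
have := Hc _ _ (HX j).
rewrite -addrA -scalerDl -rmorphD/= [m + _]addrC addrK.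
move=> h; have h2 := n_lin (e j) (LX j) (LX j.+1).
have h3 := ler_wpM2l (ltW c0) h2.
have h4 := ler_wpM2r (sqrtr_ge0 (ip (X j.+1) (X j.+1))) (ler_wpM2l (ltW c0) (eb j)).
rewrite (_ : c * (2 * c)^-1 = 2^-1) in h4; last by field; rewrite gt_eqF.
by rewrite /n in h h3 h4 *; lra.
Qed.

End symmetric_operator.

(** * Lebesgue measure on plane and space, and Borel measurability of open sets *)

HB.instance Definition _ (R : realType) := Measure.copy (@leb2 R)
  (@lebesgue_measure R \x @lebesgue_measure R)%E.
HB.instance Definition _ (R : realType) : isSigmaFinite _ _ _ (@leb2 R) :=
  lebesgue_integral_fubini.measure_function_Measure_isSigmaFinite__to__measure_function_isSigmaFinite
    (@lebesgue_measure R) (@lebesgue_measure R).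
HB.instance Definition _ (R : realType) : isSFinite _ _ _ (@leb2 R) :=
  lebesgue_integral_fubini.measure_function_Measure_isSigmaFinite__to__measure_function_isSFinite
    (@lebesgue_measure R) (@lebesgue_measure R).
HB.instance Definition _ (R : realType) := Measure.copy (@leb3 R)
  (@leb2 R \x @lebesgue_measure R)%E.
HB.instance Definition _ (R : realType) : isSigmaFinite _ _ _ (@leb3 R) :=
  lebesgue_integral_fubini.measure_function_Measure_isSigmaFinite__to__measure_function_isSigmaFinite
    (@leb2 R) (@lebesgue_measure R).
HB.instance Definition _ (R : realType) : isSFinite _ _ _ (@leb3 R) :=
  lebesgue_integral_fubini.measure_function_Measure_isSigmaFinite__to__measure_function_isSFinite
    (@leb2 R) (@lebesgue_measure R).

(* The measures live on the Borel structure of [measurableTypeR R], whose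
   display differs from the canonical one of [R]. *)
Notation T2 R := (measurableTypeR R * measurableTypeR R)%type.
Notation T3 R := (measurableTypeR R * measurableTypeR R * measurableTypeR R)%type.

(** The link between the product topology and the product sigma-algebra: an open set is a countable
    union of measurable basic sets. Keeping the neighbourhood systems abstract lets the property
    pass to products through [filter_prod]. *)
Definition countable_base (T : Type) (M : set (set T)) (N : T -> set_system T) :=
  exists B : nat -> set T, (forall i, M (B i)) /\
    forall x U, N x U -> exists i, B i x /\ B i `<=` U.

Section open_sets.
Context {R : realType}.

Lemma countable_base_R : countable_base (@measurable _ (measurableTypeR R)) (@nbhs R R).
Proof.
pose I (q : nat) : set R := if @unpickle (rat * rat)%type q is Some p
  then [set` `]ratr p.1, ratr p.2[] else set0.
exists I; split=> [q|x U].
  by rewrite /I; case: unpickle => // p; exact: measurable_itv.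
move=> /nbhs_ballP[e /= e0 eU].
have [p1 hp1] := @rat_in_itvoo R (x - e) x ltac:(lra).
have [p2 hp2] := @rat_in_itvoo R x (x + e) ltac:(lra).
move: hp1 hp2; rewrite !in_itv/= => /andP[h1 h2] /andP[h3 h4].
exists (pickle (p1, p2)); rewrite /I pickleK /= in_itv /= h2 h3; split => // y.
rewrite /= in_itv/= => /andP[y1 y2]; apply: eU; rewrite /ball/= ltr_norml.
by apply/andP; split; lra.
Qed.

Lemma countable_base_prod d1 d2 (X1 : measurableType d1) (X2 : measurableType d2)
  (N1 : X1 -> set_system X1) (N2 : X2 -> set_system X2) :
  countable_base measurable N1 -> countable_base measurable N2 ->
  countable_base (@measurable _ (X1 * X2)%type)
    (fun p => filter_prod (N1 p.1) (N2 p.2)).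
Proof.
move=> [B1 [mB1 H1]] [B2 [mB2 H2]].
pose I (q : nat) : set (X1 * X2) := if @unpickle (nat * nat)%type q is Some p
  then B1 p.1 `*` B2 p.2 else set0.
exists I; split=> [q|[x y] U [[P Q] /= [/H1[i [ix iP]] /H2[j [jy jQ]]] PQU]].
  by rewrite /I; case: unpickle => // p; exact: measurableX.
exists (pickle (i, j)); rewrite /I pickleK /=; split => // -[a b] [/= /iP ? /jQ ?].
by apply: PQU.
Qed.

Lemma countable_base_R2 : countable_base (@measurable _ (T2 R)) (@nbhs (R * R)%type (R * R)%type).
Proof. exact: (countable_base_prod countable_base_R countable_base_R). Qed.

Lemma countable_base_R3 : countable_base (@measurable _ (T3 R))
  (@nbhs (R * R * R)%type (R * R * R)%type).
Proof. exact: (countable_base_prod countable_base_R2 countable_base_R). Qed.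

Lemma countable_base_open d (T : measurableType d) (N : T -> set_system T) (U : set T) :
  countable_base measurable N -> (forall x, U x -> N x U) -> measurable U.
Proof.
move=> [B [mB H]] oU.
have -> : U = \bigcup_(i in [set i | B i `<=` U]) B i.
  apply/seteqP; split=> [x Ux|x [i /= iU /iU//]].
  by have [i [ix iU]] := H x U (oU _ Ux); exists i.
by apply: bigcup_measurable => i _; exact: mB.
Qed.

Lemma open_measurable2 (U : set (R * R)) : open U -> measurable (U : set (T2 R)).
Proof.
move=> oU; apply: (countable_base_open countable_base_R2) => x Ux.
exact: open_nbhs_nbhs.
Qed.

Lemma open_measurable3 (U : set (R * R * R)) : open U -> measurable (U : set (T3 R)).
Proof.
move=> oU; apply: (countable_base_open countable_base_R3) => x Ux.
exact: open_nbhs_nbhs.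
Qed.

Lemma continuous_measurable2 (f : R * R -> R) : continuous f ->
  measurable_fun [set: T2 R] f.
Proof.
move=> /continuousP cf; apply: (measurability _ (RGenOpens.measurableE R)).
move=> _ [_ [a [b ->] <-]]; rewrite setTI; apply: open_measurable2.
exact/cf/interval_open.
Qed.

Lemma continuous_measurable3 (f : R * R * R -> R) : continuous f ->
  measurable_fun [set: T3 R] f.
Proof.
move=> /continuousP cf; apply: (measurability _ (RGenOpens.measurableE R)).
move=> _ [_ [a [b ->] <-]]; rewrite setTI; apply: open_measurable3.
exact/cf/interval_open.
Qed.

End open_sets.

(** * Translation invariance of the measures *)

Section translation.
Context {R : realType}.
Local Open Scope ereal_scope.

Lemma measurable_shift1 (a : R) :
  measurable_fun [set: measurableTypeR R] ((fun x => x + a)%R : measurableTypeR R -> measurableTypeR R).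
Proof. by apply: (@measurable_funD _ R _ _ id (cst a)) => //; exact: measurable_cst. Qed.

Lemma leb1_shift (a : R) (A : set (measurableTypeR R)) : measurable A ->
  lebesgue_measure ((fun x => x + a)%R @^-1` A) = lebesgue_measure A.
Proof.
move=> mA; apply/esym.
pose f := fun x : measurableTypeR R => (x + a)%R : measurableTypeR R.
pose mf := isMeasurableFun.Build _ _ _ _ f (measurable_shift1 a).
pose F : {mfun measurableTypeR R >-> measurableTypeR R} := HB.pack f mf.
apply: (@lebesgue_measure_unique R (pushforward lebesgue_measure F)) => // X.
move=> [[x y] _ <-] /=; rewrite /pushforward /=.
rewrite (_ : f @^-1` _ = [set` `](x - a)%R, (y - a)%R]]); last first.
  by apply/seteqP; split=> z /=; rewrite /f !in_itv/= => /andP[? ?]; apply/andP; split; lra.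
rewrite !lebesgue_measure_itv/= !lte_fin; congr (if _ then _ else _).
  by apply/idP/idP; lra.
rewrite -!EFinB; congr EFin; ring.
Qed.

(** The pushforward agrees with the product measure on rectangles, and the product measure is
    determined by them. *)
Lemma prod_shift d1 d2 (X1 : measurableType d1) (X2 : measurableType d2)
  (m1 : {sigma_finite_measure set X1 -> \bar R})
  (m2 : {sigma_finite_measure set X2 -> \bar R})
  (f1 : X1 -> X1) (f2 : X2 -> X2) :
  measurable_fun setT f1 -> measurable_fun setT f2 ->
  (forall A, measurable A -> m1 (f1 @^-1` A) = m1 A) ->
  (forall A, measurable A -> m2 (f2 @^-1` A) = m2 A) ->
  forall A, measurable A ->
    (m1 \x m2) ((fun p => (f1 p.1, f2 p.2)) @^-1` A) = (m1 \x m2) A.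
Proof.
move=> mf1 mf2 H1 H2 A mA.
pose f (p : X1 * X2) := (f1 p.1, f2 p.2).
have mf : measurable_fun setT f.
  by apply: measurable_fun_pair; apply: measurableT_comp.
pose mfx := isMeasurableFun.Build _ _ _ _ f mf.
pose F : {mfun (X1 * X2)%type >-> (X1 * X2)%type} := HB.pack f mfx.
apply/esym/(@product_measure_unique _ _ _ _ _ m1 m2 (pushforward (m1 \x m2) F)) => //.
move=> X Y mX mY; rewrite /= /pushforward /=.
rewrite (_ : f @^-1` (X `*` Y) = (f1 @^-1` X) `*` (f2 @^-1` Y))//.
have M1 : measurable (f1 @^-1` X) by rewrite -[X in measurable X]setTI; exact: mf1.
have M2 : measurable (f2 @^-1` Y) by rewrite -[X in measurable X]setTI; exact: mf2.
transitivity (m1 (f1 @^-1` X) * m2 (f2 @^-1` Y)); first exact: product_measure1E.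
by rewrite (H1 _ mX) (H2 _ mY).
Qed.

Lemma leb2_shift (v : T2 R) (A : set (T2 R)) : measurable A ->
  leb2 ((fun x => x + v)%R @^-1` A) = leb2 A.
Proof.
exact: (@prod_shift _ _ _ _ (@lebesgue_measure R) (@lebesgue_measure R) _ _
  (measurable_shift1 v.1) (measurable_shift1 v.2) (@leb1_shift v.1) (@leb1_shift v.2)).
Qed.

Lemma measurable_shift2 (v : T2 R) :
  measurable_fun [set: T2 R] ((fun x => x + v)%R : T2 R -> T2 R).
Proof. by apply: measurable_fun_pair; apply: (measurableT_comp (measurable_shift1 _)). Qed.

Lemma measurable_shift3 (v : T3 R) :
  measurable_fun [set: T3 R] ((fun x => x + v)%R : T3 R -> T3 R).
Proof.
by apply: measurable_fun_pair; [apply: (measurableT_comp (measurable_shift2 _))|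
  apply: (measurableT_comp (measurable_shift1 _))].
Qed.

Lemma leb3_shift (v : T3 R) (A : set (T3 R)) : measurable A ->
  leb3 ((fun x => x + v)%R @^-1` A) = leb3 A.
Proof.
exact: (@prod_shift _ _ _ _ (@leb2 R) (@lebesgue_measure R) _ _
  (measurable_shift2 v.1) (measurable_shift1 v.2) (@leb2_shift v.1) (@leb1_shift v.2)).
Qed.

Lemma ge0_integral_preserving d (T : measurableType d) (m : {measure set T -> \bar R})
  (phi : T -> T) (f : T -> \bar R) : measurable_fun setT phi ->
  (forall A, measurable A -> m (phi @^-1` A) = m A) ->
  measurable_fun setT f -> (forall x, 0 <= f x) ->
  \int[m]_x f (phi x) = \int[m]_x f x.
Proof.
move=> mphi pm mf f0.
pose mfx := isMeasurableFun.Build _ _ _ _ phi mphi.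
pose F : {mfun T >-> T} := HB.pack phi mfx.
have := @ge0_integral_pushforward _ _ T T R phi mphi m setT f measurableT mf (fun _ _ => f0 _).
rewrite preimage_setT => <-.
by apply: (@eq_measure_integral _ _ _ _ m (pushforward m F)) => A mA _; exact: pm.
Qed.

Lemma ge0_integral_shift3 (v : T3 R) (f : T3 R -> \bar R) :
  measurable_fun setT f -> (forall x, 0 <= f x) ->
  \int[leb3]_x f (x + v)%R = \int[leb3]_x f x.
Proof.
exact: (ge0_integral_preserving (measurable_shift3 v) (@leb3_shift v)).
Qed.

End translation.

(** * Coordinates and the Euclidean norm *)

Section coordinates.
Context {R : realType}.
Implicit Types (x y e : R * R * R).

Lemma coord3_continuous (i : 'I_3) : continuous (@Defs.coord R i).
Proof.
have -> : @Defs.coord R i = if i == 0%N :> nat then fun x => x.1.1 else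
    if i == 1%N :> nat then fun x => x.1.2 else fun x => x.2.
  by apply/funext => x; rewrite /Defs.coord; case: ifP => // _; case: ifP.
case: ifP => _; last case: ifP => _.
- by move=> x; apply: (@cvg_comp _ _ _ fst fst _ (nbhs x.1)); exact: cvg_fst.
- by move=> x; apply: (@cvg_comp _ _ _ fst snd _ (nbhs x.1)); [exact: cvg_fst|exact: cvg_snd].
- by move=> x; exact: cvg_snd.
Qed.

Lemma dotE x y : dot x y = x.1.1 * y.1.1 + x.1.2 * y.1.2 + x.2 * y.2.
Proof. by rewrite /dot !big_ord_recr big_ord0 /= add0r. Qed.

Lemma dot_continuous e : continuous (fun x => dot x e).
Proof.
move=> x; apply: (cvg_big (@add_continuous R)) => i _.
by apply: cvgM; [exact: coord3_continuous|exact: cvg_cst].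
Qed.

Lemma enorm_continuous : continuous (@enorm R).
Proof.
move=> x; apply: (@continuous_comp _ _ _ (fun x => dot x x) Num.sqrt);
  last exact: sqrt_continuous.
by apply: (cvg_big (@add_continuous R)) => i _; apply: cvgM; exact: coord3_continuous.
Qed.

Lemma eball_open (r : R) : open (eball r).
Proof.
have /continuousP/(_ [set` `]-oo, r[]) := @enorm_continuous.
rewrite (_ : _ @^-1` _ = eball r); first by apply; exact: interval_open.
by apply/seteqP; split => x /=; rewrite in_itv.
Qed.

Lemma enormN x : enorm (- x) = enorm x.
Proof. by rewrite /enorm !dotE; congr Num.sqrt => /=; ring. Qed.

End coordinates.

(** * Invariance of the measure under linear isometries *)

Section isometry.
Context {R : realType}.
Local Open Scope ereal_scope.

Lemma measurable_add3 :
  measurable_fun [set: (T3 R * T3 R)%type] ((fun p => p.1 + p.2)%R : _ -> T3 R).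
Proof.
have p1 : measurable_fun [set: (T3 R * T3 R)%type] (fun p => p.1) by exact: measurable_fst.
have p2 : measurable_fun [set: (T3 R * T3 R)%type] (fun p => p.2) by exact: measurable_snd.
have add1 : measurable_fun [set: (measurableTypeR R * measurableTypeR R)%type]
    ((fun p => p.1 + p.2)%R : _ -> measurableTypeR R).
  have f1 : measurable_fun [set: T2 R] (fun p => p.1 : R) by exact: measurable_fst.
  have f2 : measurable_fun [set: T2 R] (fun p => p.2 : R) by exact: measurable_snd.
  exact: (measurable_funD f1 f2).
have K (f g : (T3 R * T3 R)%type -> measurableTypeR R) : measurable_fun setT f ->
    measurable_fun setT g -> measurable_fun setT (fun p => f p + g p : measurableTypeR R)%R.
  by move=> mf mg; exact: (measurableT_comp add1 (measurable_fun_pair mf mg)).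
apply: measurable_fun_pair; first apply: measurable_fun_pair.
- apply: K; [exact: (measurableT_comp measurable_fst (measurableT_comp measurable_fst p1))|].
  exact: (measurableT_comp measurable_fst (measurableT_comp measurable_fst p2)).
- apply: K; [exact: (measurableT_comp measurable_snd (measurableT_comp measurable_fst p1))|].
  exact: (measurableT_comp measurable_snd (measurableT_comp measurable_fst p2)).
- apply: K; [exact: (measurableT_comp measurable_snd p1)|].
  exact: (measurableT_comp measurable_snd p2).
Qed.

Lemma leb3_box (a b : R) (i : interval R) : (a <= b)%R -> (i = `]a, b[) \/ (i = `[a, b]) ->
  leb3 (([set` i] `*` [set` i]) `*` [set` i]) = ((b - a) ^+ 3)%:E.
Proof.
move=> ab H.
have l : lebesgue_measure ([set` i] : set (measurableTypeR R)) = (b - a)%:E.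
  case: H => ->; rewrite lebesgue_measure_itv/= lte_fin; case: ltP => [_|ba];
    rewrite ?EFinB//; (rewrite (_ : b = a); last lra); by rewrite subee.
have mi : measurable ([set` i] : set (measurableTypeR R)) by exact: measurable_itv.
rewrite (_ : leb3 _ = @leb2 R ([set` i] `*` [set` i]) * lebesgue_measure ([set` i] : set (measurableTypeR R))).
  rewrite (_ : leb2 _ = lebesgue_measure ([set` i] : set (measurableTypeR R)) * lebesgue_measure ([set` i] : set (measurableTypeR R))).
    by rewrite l -!EFinM; congr EFin; ring.
  exact: product_measure1E.
by apply: product_measure1E => //; exact: measurableX.
Qed.

Lemma measurable_eball (r : R) : measurable (eball r : set (T3 R)).
Proof. by apply: open_measurable3; exact: eball_open. Qed.

Lemma leb3_eball1_gt0 : 0 < @leb3 R (eball 1).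
Proof.
pose i : interval R := (`](- 2^-1)%R, (2^-1)%R[)%O.
apply: (@lt_le_trans _ _ (leb3 (([set` i] `*` [set` i]) `*` [set` i]))).
  rewrite (@leb3_box (- 2^-1)%R 2^-1%R); [|lra|by left].
  by rewrite lte_fin exprn_gt0//; lra.
apply: le_measure; rewrite ?inE.
- by do 2 (apply: measurableX; last exact: measurable_itv); exact: measurable_itv.
- exact: measurable_eball.
- move=> -[[x y] z] [[]] /=; rewrite !in_itv/= => /andP[? ?] /andP[? ?] /andP[? ?].
  rewrite /eball /= /enorm dotE /= -sqrtr1 ltr_sqrt//.
  by nra.
Qed.

Lemma leb3_eball_fin (r : R) : (0 <= r)%R -> @leb3 R (eball r) < +oo.
Proof.
move=> r0; pose i : interval R := (`[(- r)%R, r])%O.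
apply: (@le_lt_trans _ _ (leb3 (([set` i] `*` [set` i]) `*` [set` i]))).
  apply: le_measure; rewrite ?inE.
  - exact: measurable_eball.
  - by do 2 (apply: measurableX; last exact: measurable_itv); exact: measurable_itv.
  move=> -[[x y] z]; rewrite /eball /= /enorm dotE /= => h.
  have {h} : (x * x + y * y + z * z < r ^+ 2)%R.
    rewrite -[X in (X < _)%R]sqr_sqrtr; last by nra.
    by rewrite ltrXn2r// ?nnegrE ?sqrtr_ge0.
  move=> h; rewrite /i !in_itv/=.
  by split; [split|]; rewrite /=; apply/andP; split; nra.
by rewrite (@leb3_box (- r)%R r) ?ltry//; [lra|by right].
Qed.

(** No determinants: the pairs [(x, z)] with [x] in the unit ball [Q] and [x + L z] in [A] are
    measured in two ways. Translation invariance and Tonelli give [|Q| |L^-1 A|] on one side and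
    [|A| |Q|] on the other; the Euclidean ball is chosen because [L] preserves it. *)
Lemma leb3_isometry (L L' : T3 R -> T3 R) (A : set (T3 R)) :
  (forall x y, L (x + y) = L x + L y)%R -> (forall x, L (- x) = - L x)%R ->
  cancel L' L -> (forall x, enorm (L x) = enorm x) ->
  measurable_fun setT L -> measurable A ->
  leb3 (L @^-1` A) = leb3 A.
Proof.
move=> LD LN L'K Lnorm mL mA; pose Q := eball 1 : set (T3 R).
have mQ : measurable Q by exact: measurable_eball.
have mLA : measurable (L @^-1` A) by rewrite -[X in measurable X]setTI; exact: mL.
have madd (f g : (T3 R * T3 R)%type -> T3 R) : measurable_fun setT f ->
    measurable_fun setT g -> measurable_fun setT (fun p => f p + g p : T3 R)%R.
  by move=> mf mg; exact: (measurableT_comp measurable_add3 (measurable_fun_pair mf mg)).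
have p1 : measurable_fun [set: (T3 R * T3 R)%type] (fun p => p.1) by exact: measurable_fst.
have p2 : measurable_fun [set: (T3 R * T3 R)%type] (fun p => p.2) by exact: measurable_snd.
have mLp : measurable_fun [set: (T3 R * T3 R)%type] (fun p => L p.2) by exact: measurableT_comp.
have mo : measurable_fun [set: T3 R] ((fun x => - x)%R : T3 R -> T3 R).
  have o1 : measurable_fun [set: measurableTypeR R] ((fun x => - x)%R : measurableTypeR R -> measurableTypeR R).
    exact: oppr_measurable.
  have o2 : measurable_fun [set: T2 R] ((fun x => - x)%R : T2 R -> T2 R).
    by apply: measurable_fun_pair; apply: (measurableT_comp o1).
  by apply: measurable_fun_pair; [apply: (measurableT_comp o2)|apply: (measurableT_comp o1)].
pose S := (fun p : T3 R * T3 R => p.1) @^-1` Q `&` (fun p => p.1 + L p.2 : T3 R)%R @^-1` A.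
pose S' := (fun p => p.1 - L p.2 : T3 R)%R @^-1` Q `&` (fun p : T3 R * T3 R => p.1) @^-1` A.
have mS : measurable S.
  apply: measurableI; rewrite -[X in measurable X]setTI; first exact: p1.
  by apply: (madd _ _ p1 mLp).
have mS' : measurable S'.
  apply: measurableI; rewrite -[X in measurable X]setTI; last exact: p1.
  by apply: (madd _ _ p1 (measurableT_comp mo mLp)).
have ind B : measurable B -> measurable_fun [set: (T3 R * T3 R)%type] (fun p => (\1_B p)%:E : \bar R).
  by move=> mB; apply/measurable_EFinP; exact: measurable_indic.
have Q0 : leb3 Q \is a fin_num.
  by rewrite ge0_fin_numE ?measure_ge0// leb3_eball_fin.
have ft B : measurable B -> \int[@leb3 R]_x \int[@leb3 R]_z (\1_B (x, z))%:E =
    \int[@leb3 R]_z \int[@leb3 R]_x (\1_B (x, z))%:E.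
  move=> mB; apply: (@fubini_tonelli _ _ _ _ _ (@leb3 R) (@leb3 R) (fun p => (\1_B p)%:E)).
    exact: ind.
  by move=> p; rewrite lee_fin.
(* For fixed [x] the section is a translate, by [- L' x], of the preimage of [A]. *)
have E1 : \int[@leb3 R]_x \int[@leb3 R]_z (\1_S (x, z))%:E = leb3 Q * leb3 (L @^-1` A).
  transitivity (\int[@leb3 R]_x ((\1_Q x)%:E * leb3 (L @^-1` A))).
    apply: eq_integral => x _.
    transitivity (\int[@leb3 R]_z ((\1_Q x)%:E * (\1_(L @^-1` A) (z + L' x)%R)%:E)).
      apply: eq_integral => z _; rewrite -EFinM; congr EFin.
      rewrite !indicE /S in_setI; rewrite -natrM mulnb; congr (_%:R); congr nat_of_bool.
      congr (_ && _); apply/idP/idP; rewrite !inE /= LD L'K addrC; by [].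
    rewrite ge0_integralZl//; last first.
      by apply/measurable_EFinP/measurableT_comp; [exact: measurable_indic|exact: measurable_shift3].
    congr (_ * _).
    rewrite (@ge0_integral_shift3 _ (L' x) (fun z => (\1_(L @^-1` A) z)%:E))//; last first.
      by apply/measurable_EFinP; exact: measurable_indic.
    by rewrite integral_indic// setIT.
  rewrite ge0_integralZr//; last first.
    by apply/measurable_EFinP; exact: measurable_indic.
  by rewrite integral_indic// setIT.
(* For fixed [x] in [A] the section is the unit ball about [L' x], since [x - L z] and [z - L' x]
   have the same norm. *)
have E2 : \int[@leb3 R]_x \int[@leb3 R]_z (\1_S' (x, z))%:E = leb3 A * leb3 Q.
  transitivity (\int[@leb3 R]_x ((\1_A x)%:E * leb3 Q)).
    apply: eq_integral => x _.
    transitivity (\int[@leb3 R]_z ((\1_A x)%:E * (\1_Q (z - L' x)%R)%:E)).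
      apply: eq_integral => z _; rewrite -EFinM; congr EFin.
      rewrite !indicE /S' in_setI; rewrite -natrM mulnb; congr (_%:R); congr nat_of_bool.
      rewrite andbC; congr (_ && _).
      have en : (enorm (x - L z) = enorm (z - L' x))%R.
        by rewrite -(Lnorm (z - L' x)%R) LD LN L'K -[LHS]enormN opprB.
      by apply/idP/idP; rewrite !inE /preimage/= /Q /eball /= en.
    rewrite ge0_integralZl//; last first.
      by apply/measurable_EFinP/measurableT_comp; [exact: measurable_indic|exact: measurable_shift3].
    congr (_ * _).
    rewrite (@ge0_integral_shift3 _ (- L' x)%R (fun z => (\1_Q z)%:E))//; last first.
      by apply/measurable_EFinP; exact: measurable_indic.
    by rewrite integral_indic// setIT.
  rewrite ge0_integralZr//; last first.
    by apply/measurable_EFinP; exact: measurable_indic.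
  by rewrite integral_indic// setIT.
(* For fixed [z], translating [x] by [- L z] turns one set into the other. *)
have E3 : \int[@leb3 R]_z \int[@leb3 R]_x (\1_S (x, z))%:E =
          \int[@leb3 R]_z \int[@leb3 R]_x (\1_S' (x, z))%:E.
  apply: eq_integral => z _.
  rewrite -(@ge0_integral_shift3 _ (- L z)%R (fun x => (\1_S (x, z))%:E))//; last first.
    apply/measurable_EFinP.
    apply: (measurableT_comp (@measurable_indic _ _ R _ S mS)).
    by apply: measurable_fun_pair => //; exact: measurable_cst.
  apply: eq_integral => x _; congr EFin; rewrite !indicE /S /S' !in_setI; congr (_%:R).
  congr nat_of_bool; congr (_ && _); apply/idP/idP; rewrite !inE /preimage/= subrK; by [].
have := E1; rewrite ft// E3 -ft// E2 muleC -(fineK Q0).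
have q0 : fine (leb3 Q) != 0%R by rewrite gt_eqF// fine_gt0// leb3_eball1_gt0 ltey_eq Q0.
move=> /(congr1 (fun t => (fine (leb3 Q))^-1%:E * t)).
by rewrite !muleA -EFinM mulVf// !mul1e.
Qed.

End isometry.

(** * Derivatives of C^1 functions along arbitrary directions *)

Section directional_derivatives.
Context {R : realType}.

Lemma is_derive_line (V : normedModType R) (f : V -> R) (v y : V) (s : R) :
  (forall x, derivable f x v) ->
  is_derive s 1 (fun t : R => f (t *: v + y)) ('D_v f (s *: v + y)).
Proof.
move=> df.
have E : (fun h : R => h^-1 *: (((fun t : R => f (t *: v + y)) \o shift s) (h *: 1) - f (s *: v + y)))
  = (fun h : R => h^-1 *: ((f \o shift (s *: v + y)) (h *: v) - f (s *: v + y))).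
  apply/funext => h /=; congr (_ *: (f _ - _)).
  by rewrite scalerDl -addrA; congr (_ *: _ + _); rewrite /GRing.scale/= mulr1.
apply: DeriveDef; first by rewrite /derivable E; exact: df.
by rewrite /derive E.
Qed.

Lemma MVT_line (V : normedModType R) (f : V -> R) (v y : V) (h : R) :
  (forall x, derivable f x v) ->
  exists2 c : R, `|c| <= `|h| & f (h *: v + y) - f y = 'D_v f (c *: v + y) * h.
Proof.
move=> df; pose g (t : R) := f (t *: v + y).
have dg (s : R) : is_derive s 1 g ('D_v f (s *: v + y)) by exact: is_derive_line.
have cg (a b : R) : {within `[a, b], continuous g}.
  apply: continuous_subspaceT => s; apply: differentiable_continuous.
  by apply/derivable1_diffP; exact: (@ex_derive _ _ _ _ _ _ _ (dg s)).
have g0 : g 0 = f y by rewrite /g scale0r add0r.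
have [h0|h0] := leP 0 h.
  have [c + E] := MVT_segment h0 (fun x _ => dg x) (cg 0 h).
  rewrite in_itv/= => /andP[c0 ch]; exists c; first by rewrite !ger0_norm.
  by rewrite -g0 E subr0.
have [c + E] := MVT_segment (ltW h0) (fun x _ => dg x) (cg h 0).
rewrite in_itv/= => /andP[c0 ch]; exists c.
  by rewrite (ler0_norm ch) (ltr0_norm h0) lerN2.
by rewrite -g0 -[LHS]opprB E sub0r mulrN opprK.
Qed.

(** The increment is split at [h *: u + x]. The mean value theorem turns the second piece into a
    [v]-derivative at a point tending to [x], so continuity is needed in the direction [v] alone. *)
Lemma is_deriveD_dir (V : normedModType R) (f : V -> R) (u v : V) (x : V) :
  (forall x, derivable f x u) -> (forall x, derivable f x v) ->
  continuous ('D_v f) ->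
  is_derive x (u + v) f ('D_u f x + 'D_v f x).
Proof.
move=> du dv cv.
suff H : (h^-1 *: ((f \o shift x) (h *: (u + v)) - f x) @[h --> 0^']) -->
    'D_u f x + 'D_v f x.
  apply: DeriveDef; first by apply/cvg_ex; exists ('D_u f x + 'D_v f x).
  exact: cvg_lim.
have E : (fun h : R => h^-1 *: ((f \o shift x) (h *: (u + v)) - f x)) =
  (fun h => h^-1 *: ((f \o shift x) (h *: u) - f x) +
            h^-1 *: (f (h *: v + (h *: u + x)) - f (h *: u + x))).
  apply/funext => h /=; rewrite -scalerDr; congr (_ *: _).
  rewrite [RHS]addrC subrKA scalerDr; congr (f _ - _).
  by rewrite addrA [h *: v + _]addrC.
rewrite E; apply: cvgD; first exact: (du x).
apply/cvgrPdist_lt => e e0.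
have /cvgrPdist_lt /(_ e e0) := cv x.
rewrite near_map => /nbhs_ballP[d /= d0 Hd].
have k0 : 0 < `|u| + `|v| + 1.
  by have := normr_ge0 u; have := normr_ge0 v; lra.
near=> h.
have hn0 : h != 0 by near: h; exact: nbhs_dnbhs_neq.
have [c ch ->] := @MVT_line V f v (h *: u + x) h dv.
rewrite /GRing.scale/= mulrCA mulVf// mulr1; apply: Hd.
rewrite -ball_normE /=.
have -> : x - (c *: v + (h *: u + x)) = - (c *: v + h *: u).
  by rewrite addrA opprD [LHS]addrC subrK.
rewrite normrN; apply: le_lt_trans (ler_normD _ _) _; rewrite !normrZ.
have hb : `|h| < d / (`|u| + `|v| + 1).
  near: h; apply: dnbhs0_lt; exact: divr_gt0.
rewrite ltr_pdivlMr// in hb.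
have := ler_wpM2r (normr_ge0 v) ch; have := normr_ge0 h; lra.
Unshelve. all: by end_near. Qed.

Lemma is_deriveZ_dir (V : normedModType R) (f : V -> R) (v : V) (c : R) (x : V) :
  (forall x, derivable f x v) -> is_derive x (c *: v) f (c * 'D_v f x).
Proof.
move=> dv.
have cZ : continuous (fun t : R => t * c) by move=> t; apply: cvgM => //; exact: cvg_cst.
have H : is_derive (0 : R) 1 (fun t : R => f ((t * c) *: v + x)) (c * 'D_v f x).
  have D1 : is_derive (0 : R) 1 (fun t : R => t * c) c.
    have := @is_deriveM R R id (cst c) 0 1 1 0 (is_derive_id _ _) (is_derive_cst _ _ _).
    by move=> hd; apply: (is_derive_eq hd); rewrite /= scaler0 add0r /GRing.scale/= mulr1.
  have D2 := is_derive_line x (0 * c) dv.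
  have := @is_derive1_comp R (fun t : R => f (t *: v + x)) (fun t : R => t * c) 0 _ _ D2 D1.
  by move=> hd; apply: (is_derive_eq hd); rewrite mul0r scale0r add0r /GRing.scale/= mulrC.
have E : (fun h : R => h^-1 *: ((f \o shift x) (h *: (c *: v)) - f x)) =
  (fun h : R => h^-1 *: (((fun t : R => f ((t * c) *: v + x)) \o shift 0) (h *: 1) - f ((0 * c) *: v + x))).
  apply/funext => h /=; rewrite mul0r scale0r add0r addr0 scalerA.
  by congr (_ *: (f (_ *: _ + _) - _)); rewrite /GRing.scale/= mulr1.
apply: DeriveDef; first by rewrite /derivable E; exact: (@ex_derive _ _ _ _ _ _ _ H).
by rewrite /derive E; exact: (@derive_val _ _ _ _ _ _ _ H).
Qed.

Definition grad_dot (f : R * R * R -> R) (e x : R * R * R) : R :=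
  \sum_(i < 3) Defs.coord i e * pd i f x.

Definition C1 (f : R * R * R -> R) := classC 1 setT f.

Section C1_functions.
Variables (f : R * R * R -> R).
Hypothesis Cf : C1 f.

Lemma C1_continuous : continuous f.
Proof. by move=> x; have [] := Cf (s := [::]) isT (I : setT x). Qed.

Lemma C1_derivable i x : derivable f x (basis3 R i).
Proof. by have [_] := Cf (s := [::]) isT (I : setT x); apply. Qed.

Lemma C1_pd_continuous i : continuous (pd i f).
Proof. by move=> x; have [] := Cf (s := [:: i]) isT (I : setT x). Qed.

Lemma grad_dot_continuous e : continuous (grad_dot f e).
Proof.
move=> x; apply: (cvg_big (@add_continuous R)) => i _.
by apply: cvgM; [exact: cvg_cst|exact: C1_pd_continuous].
Qed.

Lemma basis3_decomp (e : R * R * R) : e = Defs.coord ord0 e *: basis3 R ord0 +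
  Defs.coord (lift ord0 ord0) e *: basis3 R (lift ord0 ord0) +
  Defs.coord ord_max e *: basis3 R ord_max.
Proof.
case: e => [[a b] c]; rewrite /Defs.coord /basis3 /=.
congr (_, _, _).
- by change (a = a * 1 + b * 0 + c * 0); ring.
- by change (b = a * 0 + b * 1 + c * 0); ring.
- by change (c = a * 0 + b * 0 + c * 1); ring.
Qed.

Lemma sum3 (F : 'I_3 -> R) :
  \sum_(i < 3) F i = F ord0 + F (lift ord0 ord0) + F ord_max.
Proof.
rewrite big_ord_recr big_ord_recl big_ord_recr big_ord0 /=.
by congr (F _ + _ + _); [exact: val_inj|rewrite add0r; congr (F _); exact: val_inj].
Qed.

(** [C1] speaks of the three coordinate directions only, while charts use rotated frames; the
    components of [e] are added one after another. *)
Lemma is_derive_grad_dot (e x : R * R * R) : is_derive x e f (grad_dot f e x).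
Proof.
set c := fun i => Defs.coord i e; set b := basis3 R.
have d1 i y : is_derive y (c i *: b i) f (c i * pd i f y).
  by apply: is_deriveZ_dir => z; exact: C1_derivable.
have ex i y : derivable f y (c i *: b i) by exact: (@ex_derive _ _ _ _ _ _ _ (d1 i y)).
have va i y : 'D_(c i *: b i) f y = c i * pd i f y.
  exact: (@derive_val _ _ _ _ _ _ _ (d1 i y)).
have co i : continuous ('D_(c i *: b i) f).
  by rewrite (funext (va i)) => y; apply: cvgM; [exact: cvg_cst|exact: C1_pd_continuous].
pose i1 : 'I_3 := lift ord0 ord0.
have d2 y := @is_deriveD_dir _ f _ (c i1 *: b i1) y (ex ord0) (ex i1) (co i1).
have ex2 y : derivable f y (c ord0 *: b ord0 + c i1 *: b i1).
  exact: (@ex_derive _ _ _ _ _ _ _ (d2 y)).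
have := @is_deriveD_dir _ f _ (c ord_max *: b ord_max) x ex2 (ex ord_max) (co ord_max).
rewrite -basis3_decomp => hd; apply: (is_derive_eq hd).
by rewrite (@derive_val _ _ _ _ _ _ _ (d2 x)) !va /grad_dot sum3.
Qed.

Lemma is_derive_C1_line (e y : R * R * R) (s : R) :
  is_derive s 1 (fun t : R => f (t *: e + y)) (grad_dot f e (s *: e + y)).
Proof.
have H x := is_derive_grad_dot e x.
have ex x : derivable f x e by exact: (@ex_derive _ _ _ _ _ _ _ (H x)).
by have := is_derive_line y s ex; rewrite (@derive_val _ _ _ _ _ _ _ (H _)).
Qed.

End C1_functions.

Definition sqgrad (f : R * R * R -> R) x := \sum_(i < 3) pd i f x ^+ 2.

Lemma grad_dot_sqgrad f e x : dot e e = 1 -> grad_dot f e x ^+ 2 <= sqgrad f x.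
Proof.
rewrite dotE /grad_dot /sqgrad !sum3 /Defs.coord /= => h.
set a := e.1.1 in h *; set b := e.1.2 in h *; set c := e.2 in h *.
set p := pd _ _ _; set q := pd _ _ _; set r := pd _ _ _.
rewrite -[leRHS]mul1r -h.
(* Lagrange's identity for the Cauchy-Schwarz defect. *)
have := sqr_ge0 (a * q - b * p); have := sqr_ge0 (a * r - c * p).
have := sqr_ge0 (b * r - c * q); nra.
Qed.

End directional_derivatives.

(** * Poincare and trace inequalities on an interval *)

Section one_dimensional_inequalities.
Context {R : realType}.
Local Notation mu := (@lebesgue_measure R).

Lemma continuous_itv_integrable (g : R -> R) a b : continuous g ->
  mu.-integrable `[a, b] (EFin \o g).
Proof.
move=> cg; apply: continuous_compact_integrable; first exact: segment_compact.
exact: continuous_subspaceT.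
Qed.

(** Each inequality of this section comes from a pointwise bound [p <= F' + q], where the cross term
    of [F'] is completed to a square. *)
Lemma FTC_le (F f p q : R -> R) (a b : R) : a <= b ->
  (forall x : R, is_derive x 1 F (f x)) ->
  continuous f -> continuous p -> continuous q ->
  {in `[a, b], forall x, p x <= f x + q x} ->
  (\int[mu]_(x in `[a, b]) (p x)%:E <=
    (F b - F a)%:E + \int[mu]_(x in `[a, b]) (q x)%:E)%E.
Proof.
move=> ab dF cf cp cq H.
have cF : continuous F.
  move=> x; apply: differentiable_continuous; apply/derivable1_diffP.
  exact: (@ex_derive _ _ _ _ _ _ _ (dF x)).
move: ab; rewrite le_eqVlt => /predU1P[->|ab].
  by rewrite subrr add0e set_itv1 !integral_set1.
have E : (\int[mu]_(x in `[a, b]) (f x)%:E = (F b - F a)%:E)%E.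
  rewrite (@continuous_FTC2 R f F a b) ?EFinB//.
  - exact: continuous_subspaceT.
  - split; first by move=> x _; exact: (@ex_derive _ _ _ _ _ _ _ (dF x)).
      by apply: cvg_at_right_filter; exact: cF.
    by apply: cvg_at_left_filter; exact: cF.
  - move=> x _; rewrite derive1E; exact: (@derive_val _ _ _ _ _ _ _ (dF x)).
rewrite -E -integralD_EFin//; [|exact: continuous_itv_integrable..].
apply: le_integral => //; first exact: continuous_itv_integrable.
  by apply: continuous_itv_integrable => x; apply: cvgD; [exact: cf|exact: cq].
by move=> x; rewrite inE /= lee_fin => xab; exact: H.
Qed.

Variables (u u' : R -> R).
Hypothesis du : forall x : R, is_derive x 1 u (u' x).
Hypothesis cu' : continuous u'.

Let cu : continuous u.
Proof.
move=> x; apply: differentiable_continuous; apply/derivable1_diffP.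
exact: (@ex_derive _ _ _ _ _ _ _ (du x)).
Qed.

(** The common multiplier: [c = - a] kills the boundary term at the left end, [c = 1] gives it
    weight 1 at the origin. *)
Let dF (c x : R) : is_derive x 1 (fun x => (x + c) * u x ^+ 2)
  (u x ^+ 2 + 2 * (x + c) * (u x * u' x)).
Proof.
have D1 : is_derive x 1 (fun x : R => x + c) 1.
  by have := @is_deriveD R R R id (cst c) x 1 1 0 (is_derive_id _ _) (is_derive_cst _ _ _);
     rewrite addr0.
have D2 : is_derive x 1 (fun x => u x ^+ 2) (2 * (u x * u' x)).
  have hd := is_deriveM (du x) (du x); apply: (is_derive_eq hd).
  by rewrite /GRing.scale/=; ring.
have := is_deriveM D1 D2 => hd; apply: (is_derive_eq hd).
by rewrite /GRing.scale/=; ring.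
Qed.

Let c2 : continuous (fun x => u x ^+ 2).
Proof. by move=> x; apply: cvgM; exact: cu. Qed.

Let c2' : continuous (fun x => u' x ^+ 2).
Proof. by move=> x; apply: cvgM; exact: cu'. Qed.

Let cuu : continuous (fun x => u x * u' x).
Proof. by move=> x; apply: cvgM; [exact: cu|exact: cu']. Qed.

Let cf c : continuous (fun x => u x ^+ 2 + 2 * (x + c) * (u x * u' x)).
Proof.
move=> x; apply: cvgD; first exact: c2.
apply: cvgM; last exact: cuu.
by apply: cvgM; [exact: cvg_cst|apply: cvgD => //; exact: cvg_cst].
Qed.

Let cZ (k : R) (f : R -> R) : continuous f -> continuous (fun x => k * f x).
Proof. by move=> cg x; apply: cvgM; [exact: cvg_cst|exact: cg]. Qed.

(** The completed square is half of [(u + 2 (x - a) u')^2], which leaves half of [u^2] on the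
    left. *)
Lemma poincare_itv a b : a <= b ->
  (\int[mu]_(x in `[a, b]) (2^-1 * u x ^+ 2)%:E <=
   ((b - a) * u b ^+ 2)%:E + \int[mu]_(x in `[a, b]) (2 * (b - a) ^+ 2 * u' x ^+ 2)%:E)%E.
Proof.
move=> ab; have := FTC_le ab (dF (- a)) (@cf (- a)) (@cZ 2^-1 _ c2) (@cZ (2 * (b - a) ^+ 2) _ c2').
rewrite subrr mul0r subr0; apply => x; rewrite in_itv /= => /andP[ax xb].
have : (x - a) ^+ 2 * u' x ^+ 2 <= (b - a) ^+ 2 * u' x ^+ 2.
  by apply: ler_wpM2r; [exact: sqr_ge0|rewrite ler_sqr ?nnegrE; lra].
have := sqr_ge0 (u x + 2 * (x - a) * u' x); rewrite !expr2; lra.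
Qed.

(** The same multiplier read in the opposite direction, with the square [(u - (x - a) u')^2]. *)
Lemma trace_itv a b : a <= b ->
  (((b - a) * u b ^+ 2)%:E <=
   \int[mu]_(x in `[a, b]) (2 * u x ^+ 2 + (b - a) ^+ 2 * u' x ^+ 2)%:E)%E.
Proof.
move=> ab.
have dNF x := is_deriveN (dF (- a) x).
have cNf : continuous (fun x => - (u x ^+ 2 + 2 * (x - a) * (u x * u' x))).
  by move=> x; apply: cvgN; exact: cf.
have cq : continuous (fun x => 2 * u x ^+ 2 + (b - a) ^+ 2 * u' x ^+ 2).
  by move=> x; apply: cvgD; [exact: (@cZ _ _ c2)|exact: (@cZ _ _ c2')].
have := FTC_le ab dNF cNf (@cst_continuous _ _ 0) cq.
rewrite integral0_eq // => h.
have {h} : (0 <= (- ((b - a) * u b ^+ 2))%:E +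
    \int[mu]_(x in `[a, b]) (2 * u x ^+ 2 + (b - a) ^+ 2 * u' x ^+ 2)%:E)%E.
  apply: (le_trans (h _)); last first.
    rewrite leeD2r// lee_fin; change (- ((b - a) * u b ^+ 2) - - ((a - a) * u a ^+ 2)
      <= - ((b - a) * u b ^+ 2)); lra.
  move=> x; rewrite in_itv /= => /andP[ax xb].
  have : (x - a) ^+ 2 * u' x ^+ 2 <= (b - a) ^+ 2 * u' x ^+ 2.
    by apply: ler_wpM2r; [exact: sqr_ge0|rewrite ler_sqr ?nnegrE; lra].
  have := sqr_ge0 (u x - (x - a) * u' x); rewrite !expr2; lra.
by rewrite EFinN addeC sube_ge0.
Qed.

(** Here the square is [(u + (x + 1) u')^2]; [t <= 1] bounds the weight [x + 1] by 2, hence the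
    constants 2 and 4. *)
Lemma step_itv t : 0 <= t <= 1 ->
  ((u 0 ^+ 2)%:E <= (2 * u t ^+ 2)%:E + \int[mu]_(x in `[0%R, t]) (4 * u' x ^+ 2)%:E)%E.
Proof.
move=> /andP[t0 t1].
have := FTC_le t0 (dF 1) (@cf 1) (@cst_continuous _ _ 0) (@cZ 4 _ c2').
rewrite /= integral0_eq // add0r mul1r => h.
have {h} : (0 <= ((t + 1) * u t ^+ 2 - u 0 ^+ 2)%:E + \int[mu]_(x in `[0%R, t]) (4 * u' x ^+ 2)%:E)%E.
  apply: h => x; rewrite in_itv /= => /andP[x0 xt].
  have : (x + 1) ^+ 2 * u' x ^+ 2 <= 4 * u' x ^+ 2.
    by apply: ler_wpM2r; [exact: sqr_ge0|rewrite expr2; nra].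
  have := sqr_ge0 (u x + (x + 1) * u' x); rewrite !expr2; lra.
move=> h; rewrite -sube_ge0// addeAC -EFinB; apply: (le_trans h).
rewrite leeD2r// lee_fin; apply: lerB => //.
by apply: ler_wpM2r; [exact: sqr_ge0|lra].
Qed.

End one_dimensional_inequalities.

(** * Orthonormal frames and the change of variables they induce *)

Section frames.
Context {R : realType}.
Implicit Types (x y z : R * R * R).

Lemma dotDl x y z : dot (x + y) z = dot x z + dot y z.
Proof. by rewrite !dotE /=; ring. Qed.

Lemma dotZl a x z : dot (a *: x) z = a * dot x z.
Proof.
rewrite !dotE; case: x => [[x1 x2] x3].
change (a * x1 * z.1.1 + a * x2 * z.1.2 + a * x3 * z.2 =
  a * (x1 * z.1.1 + x2 * z.1.2 + x3 * z.2)); ring.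
Qed.

Lemma coordD i x y : Defs.coord i (x + y) = Defs.coord i x + Defs.coord i y.
Proof. by rewrite /Defs.coord; case: ifP => // _; case: ifP. Qed.

Lemma coordZ i a x : Defs.coord i (a *: x) = a * Defs.coord i x.
Proof. by case: x => [[x1 x2] x3]; rewrite /Defs.coord; case: ifP => // _; case: ifP. Qed.

Lemma coord_inj x y : (forall i : 'I_3, Defs.coord i x = Defs.coord i y) -> x = y.
Proof.
case: x y => [[x1 x2] x3] [[y1 y2] y3] H.
by have := H ord0; have := H (lift ord0 ord0); have := H ord_max;
  rewrite /Defs.coord /= => -> -> ->.
Qed.

Lemma dot_sub_continuous (a v : R * R * R) : continuous (fun x => dot (x - a) v).
Proof.
move=> x; apply: (@continuous_comp _ _ _ (fun x => x - a) (fun w => dot w v)).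
  by apply: cvgB => //; exact: cvg_cst.
exact: dot_continuous.
Qed.

Lemma inord3E : [/\ @inord 2 0 = ord0, @inord 2 1 = lift ord0 ord0 & @inord 2 2 = ord_max].
Proof. by split; apply: val_inj; rewrite /= inordK. Qed.

Variables (o : R * R * R) (e : 'I_3 -> R * R * R).
Hypothesis orth : forall i j, dot (e i) (e j) = (i == j)%:R.

(** For a square matrix, orthonormal rows imply orthonormal columns. *)
Lemma orthonormal_dual j k :
  \sum_(i < 3) Defs.coord j (e i) * Defs.coord k (e i) = (j == k)%:R.
Proof.
pose M : 'M[R]_3 := \matrix_(i, j) Defs.coord j (e i).
have MM : M *m M^T = 1%:M.
  apply/matrixP => i i'; rewrite !mxE -orth /dot.
  by apply: eq_bigr => l _; rewrite !mxE.
have := mulmx1C MM => /matrixP/(_ j k); rewrite !mxE => <-.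
by apply: eq_bigr => l _; rewrite !mxE.
Qed.

Definition fr (p : T3 R) : T3 R := frame_pt o e p.1 p.2.

Definition frinv (x : T3 R) : T3 R :=
  ((dot (x - o) (e (inord 0)), dot (x - o) (e (inord 1))), dot (x - o) (e (inord 2))).

Lemma frK p : frinv (fr p) = p.
Proof.
have [i0 i1 i2] := inord3E.
have E i : dot (fr p - o) (e i) = p.1.1 * (ord0 == i)%:R +
    p.1.2 * (lift ord0 ord0 == i)%:R + p.2 * (ord_max == i)%:R.
  rewrite /fr /frame_pt i0 i1 i2; rewrite (addrC o) addrK.
  by rewrite !dotDl !dotZl !orth.
rewrite /frinv !E i0 i1 i2 /= !mulr0 !mulr1 !addr0 !add0r.
by clear E; case: p => [[]].
Qed.

Lemma frinvK x : fr (frinv x) = x.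
Proof.
have [i0 i1 i2] := inord3E.
rewrite /fr /frame_pt /frinv /= i0 i1 i2.
suff H w : dot w (e ord0) *: e ord0 + dot w (e (lift ord0 ord0)) *: e (lift ord0 ord0) +
   dot w (e ord_max) *: e ord_max = w by rewrite H addrC subrK.
apply: coord_inj => k; rewrite !coordD !coordZ.
rewrite -(sum3 (fun i => dot w (e i) * Defs.coord k (e i))).
transitivity (\sum_(j < 3) Defs.coord j w *
    \sum_(i < 3) Defs.coord j (e i) * Defs.coord k (e i)).
  under eq_bigr do rewrite /dot big_distrl /=.
  rewrite exchange_big /=; apply: eq_bigr => j _; rewrite big_distrr /=.
  by apply: eq_bigr => i _; rewrite mulrA.
rewrite (bigD1 k)//= orthonormal_dual eqxx mulr1 big1 ?addr0// => j /negbTE jk.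
by rewrite orthonormal_dual jk mulr0.
Qed.

Lemma measurable_affine_comp (a b c d : R) : measurable_fun [set: T3 R]
  ((fun p => d + (p.1.1 * a + p.1.2 * b + p.2 * c)) : T3 R -> R).
Proof.
have p11 : measurable_fun [set: T3 R] (fun p => p.1.1 : R).
  exact: (measurableT_comp measurable_fst measurable_fst).
have p12 : measurable_fun [set: T3 R] (fun p => p.1.2 : R).
  exact: (measurableT_comp measurable_snd measurable_fst).
have p2 : measurable_fun [set: T3 R] (fun p => p.2 : R) by exact: measurable_snd.
have mc (t : R) : measurable_fun [set: T3 R] (cst t) by exact: measurable_cst.
exact: (measurable_funD (mc d) (measurable_funD (measurable_funD
  (measurable_funM p11 (mc a)) (measurable_funM p12 (mc b))) (measurable_funM p2 (mc c)))).
Qed.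

Lemma measurable_fr : measurable_fun [set: T3 R] fr.
Proof.
apply: measurable_fun_pair; first apply: measurable_fun_pair.
- exact: (measurable_affine_comp (e (inord 0)).1.1 (e (inord 1)).1.1 (e (inord 2)).1.1 o.1.1).
- exact: (measurable_affine_comp (e (inord 0)).1.2 (e (inord 1)).1.2 (e (inord 2)).1.2 o.1.2).
- exact: (measurable_affine_comp (e (inord 0)).2 (e (inord 1)).2 (e (inord 2)).2 o.2).
Qed.

End frames.

Section frame_integral.
Context {R : realType}.
Variables (o : R * R * R) (e : 'I_3 -> R * R * R).
Hypothesis orth : forall i j, dot (e i) (e j) = (i == j)%:R.
Local Open Scope ereal_scope.

(** A frame map is a translation after the linear isometry [fr 0 e]. *)
Lemma leb3_fr (A : set (T3 R)) : measurable A -> leb3 (fr o e @^-1` A) = leb3 A.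
Proof.
move=> mA.
have frE p : fr o e p = (fr 0 e p + o)%R by rewrite /fr /frame_pt add0r addrC.
have -> : fr o e @^-1` A = fr 0%R e @^-1` ((fun x : T3 R => x + o)%R @^-1` A).
  by apply/seteqP; split => p /=; rewrite frE.
have mA' : measurable ((fun x : T3 R => x + o)%R @^-1` A).
  by rewrite -[X in measurable X]setTI; exact: (measurable_shift3 o).
have frD x y : (fr 0 e (x + y) = fr 0 e x + fr 0 e y)%R.
  rewrite /fr /frame_pt !add0r /= !scalerDl; apply/esym; rewrite addrACA; congr (_ + _)%R.
  by rewrite addrACA.
have frN x : (fr 0 e (- x) = - fr 0 e x)%R.
  by rewrite /fr /frame_pt !add0r /= !scaleNr !opprD.
have frn x : enorm (fr 0%R e x) = enorm (x : R * R * R).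
  rewrite /enorm; congr Num.sqrt.
  have dotC (u v : R * R * R) : dot u v = dot v u.
    by apply: eq_bigr => i _; rewrite mulrC.
  have [i0 i1 i2] := @inord3E.
  have E i : dot (fr 0%R e x) (e i) = (x.1.1 * (ord0 == i)%:R +
      x.1.2 * (lift ord0 ord0 == i)%:R + x.2 * (ord_max == i)%:R)%R.
    by rewrite /fr /frame_pt add0r i0 i1 i2 !dotDl !dotZl !orth.
  rewrite {1}/fr /frame_pt add0r i0 i1 i2 !dotDl !dotZl; rewrite ![dot (e _) _]dotC !E/=.
  by rewrite dotE !mulr0 !mulr1 !addr0 !add0r.
rewrite (leb3_isometry frD frN (@frinvK R 0%R e orth) frn (measurable_fr 0%R e) mA').
exact: leb3_shift.
Qed.

Lemma ge0_integral_fr (f : T3 R -> \bar R) : measurable_fun setT f -> (forall x, 0 <= f x) ->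
  \int[leb3]_p f (fr o e p) = \int[leb3]_x f x.
Proof. exact: (ge0_integral_preserving (measurable_fr o e) leb3_fr). Qed.

End frame_integral.

(** * Fibrewise inequalities in a boundary chart *)

Section charts.
Context {R : realType}.

Lemma lipschitz_continuous2 (L : R) (f : R * R -> R) : L.-lipschitz f -> continuous f.
Proof.
move=> Lf x; apply/cvgrPdist_lt => eps e0.
have k0 : 0 < `|L| + 1 by have := normr_ge0 L; lra.
near=> y.
have := Lf (x, y) (conj I I) => /=; move=> H; apply: le_lt_trans H _.
have yx : `|x - y| < eps / (`|L| + 1).
  by near: y; apply: cvgr_dist_lt; [exact: cvg_id|exact: divr_gt0].
rewrite ltr_pdivlMr// in yx.
apply: le_lt_trans yx; rewrite mulrC; apply: ler_wpM2l => //.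
by have := ler_norm L; lra.
Unshelve. all: by end_near. Qed.

Lemma open_lt3 (f : R * R * R -> R) (k : R) : continuous f -> open [set x | f x < k].
Proof.
move=> /continuousP/(_ [set` `]-oo, k[]).
rewrite (_ : _ @^-1` _ = [set x | f x < k]); first by apply; exact: interval_open.
by apply/seteqP; split => x /=; rewrite in_itv.
Qed.

Variables (D : set (R * R * R)) (oD : open D) (c : lip_chart D).
Let o := ch_org c.
Let e := ch_frame c.
Let r := ch_rad c.
Let h := ch_height c.
Let g := ch_fun c.
Let orth := ch_orthonormal c.
Local Notation mu := (@lebesgue_measure R).

Definition cyl : set (R * R * R) :=
  [set x | disk r (frinv o e x).1 /\ `|(frinv o e x).2| < h].

Lemma cyl_open : open cyl.
Proof.
have cd i := @dot_sub_continuous R o (e i).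
have -> : cyl = [set x | dot (x - o) (e (inord 0)) * dot (x - o) (e (inord 0)) +
    dot (x - o) (e (inord 1)) * dot (x - o) (e (inord 1)) < r ^+ 2] `&`
    [set x | `|dot (x - o) (e (inord 2))| < h] by [].
apply: openI; apply: open_lt3 => x.
  by apply: cvgD; apply: cvgM; exact: cd.
by apply: cvg_norm; exact: cd.
Qed.

Lemma ch_height_gt0 y : disk r y -> 0 < h.
Proof. by move=> /ch_bounded; apply: le_lt_trans. Qed.

Lemma ch_mapE y : ch_map c y = fr o e (y, g y). Proof. by []. Qed.

Lemma ch_map_cyl y : disk r y -> cyl (ch_map c y).
Proof. by move=> dy; rewrite /cyl /mkset ch_mapE (frK _ orth); split => //; exact: ch_bounded. Qed.

Lemma ch_fun_continuous : continuous g.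
Proof. by have [L] := ch_lipschitz c; exact: lipschitz_continuous2. Qed.

Lemma measurable_disk : measurable (disk r : set (T2 R)).
Proof.
apply: open_measurable2.
pose f (y : R * R) := y.1 * y.1 + y.2 * y.2.
have /continuousP/(_ [set` `]-oo, (r ^+ 2)[]) : continuous f.
  by move=> y; apply: cvgD; apply: cvgM; (exact: cvg_fst || exact: cvg_snd).
rewrite (_ : _ @^-1` _ = disk r); first by apply; exact: interval_open.
by apply/seteqP; split => x /=; rewrite in_itv.
Qed.

Lemma measurable_ch_map (f : R * R * R -> R) : continuous f ->
  measurable_fun [set: T2 R] (fun y : T2 R => f (ch_map c y)).
Proof.
move=> cf.
have mg : measurable_fun [set: T2 R] (fun y : T2 R => (y, g y) : T3 R).
  apply: measurable_fun_pair; first exact: measurable_id.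
  exact: (continuous_measurable2 ch_fun_continuous).
have m1 := measurableT_comp (measurable_fr o e) mg.
exact: (measurableT_comp (continuous_measurable3 cf) m1).
Qed.

Let Dcyl : set (T3 R) := D `&` cyl.

Let mDcyl : measurable Dcyl.
Proof. by apply: open_measurable3; apply: openI => //; exact: cyl_open. Qed.

(** Within the cylinder the domain is a union of vertical segments that end on the boundary graph;
    one-dimensional inequalities are applied on these. *)
Let in_region y z : Dcyl (fr o e (y, z)) <-> disk r y /\ z \in `](- h), (g y)[.
Proof.
rewrite /Dcyl /cyl /setI /mkset (frK _ orth) in_itv; split.
  move=> [Dz [/= dy zh]]; split => //; have := zh; rewrite ltr_norml => /andP[-> _] /=.
  exact/(ch_subgraph (l := c) dy zh).
move=> [dy /andP[/= z1 z2]]; have := ch_bounded (l := c) dy; rewrite ltr_norml -/g => /andP[g1 g2].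
have zh : `|z| < h by rewrite ltr_norml z1; apply: lt_trans g2.
by split; last by []; apply/(ch_subgraph (l := c) dy zh).
Qed.

Local Open Scope ereal_scope.

Lemma measurable_region (G : T3 R -> \bar R) : measurable_fun setT G -> (forall x, 0 <= G x) ->
  measurable_fun (disk r : set (T2 R)) (fun y => \int[mu]_(z in `](- h)%R, (g y)[) G (fr o e (y, z))) /\
  \int[leb3]_(x in Dcyl) G x =
  \int[leb2]_(y in disk r) \int[mu]_(z in `](- h)%R, (g y)[) G (fr o e (y, z)).
Proof.
move=> mG G0; pose H : T3 R -> \bar R := (G \_ Dcyl) \o fr o e.
have mGr : measurable_fun setT (G \_ Dcyl).
  have mGD : measurable_fun Dcyl G by apply: measurable_funTS.
  by have [K _] := measurable_restrictT G mDcyl; apply: K.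
have Gr0 x : 0 <= (G \_ Dcyl) x by rewrite patchE; case: ifP.
have mH : measurable_fun setT H by apply: measurableT_comp => //; exact: measurable_fr.
have H0 x : 0 <= H x by exact: Gr0.
have E : fubini_F mu H = ((fun y => \int[mu]_(z in `](- h)%R, (g y)[) G (fr o e (y, z)))
    \_ (disk r : set (T2 R))).
  apply/funext => y; rewrite /fubini_F patchE.
  case: ifPn => [|] yd.
    rewrite inE in yd; rewrite [RHS]integral_mkcond; apply: eq_integral => z _.
    rewrite /H /= !patchE; congr (if _ then _ else _).
    apply/idP/idP; rewrite !inE => K; first by have [] := (in_region y z).1 K.
    exact/(in_region y z).2.
  apply: integral0_eq => z _; rewrite /H /= patchE; case: ifPn => // K.
  by move: yd; rewrite inE in K; have [/mem_set ->] := (in_region y z).1 K.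
pose F : T2 R -> \bar R := fun y => \int[mu]_(z in `](- h)%R, (g y)[) G (fr o e (y, z)).
have mE : measurable_fun setT (F \_ (disk r : set (T2 R))).
  by rewrite -[F \_ _]E; exact: measurable_fun_fubini_tonelli_F.
split; first by have [_ K] := measurable_restrictT F measurable_disk; exact: (K mE).
rewrite integral_mkcond -(ge0_integral_fr o orth mGr Gr0).
rewrite [RHS]integral_mkcond -E.
exact: (@fubini_tonelli1 _ _ _ _ _ (@leb2 R) mu H mH H0).
Qed.

Variable phi : R * R * R -> R.
Hypothesis Cphi : C1 phi.

Let u y z := phi (fr o e (y, z)).
Let u' y z := grad_dot phi (e (inord 2)) (fr o e (y, z)).

Let frline y z : fr o e (y, z) = (z *: e (inord 2) + fr o e (y, 0))%R.
Proof. by rewrite /fr /frame_pt /= scale0r addr0 [RHS]addrC addrA. Qed.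

Let du y (z : R) : is_derive z 1%R (u y) (u' y z).
Proof.
rewrite /u' frline; have := @is_derive_C1_line R phi Cphi (e (inord 2)) (fr o e (y, 0%R)) z.
by under eq_fun do rewrite -frline.
Qed.

Let frz_continuous y : continuous (fun z : R => fr o e (y, z) : R * R * R).
Proof.
under eq_fun do rewrite frline.
by move=> z; apply: cvgD; [apply: cvgZl => //|exact: cvg_cst].
Qed.

Let cu y : continuous (u y).
Proof.
move=> z; apply: (@continuous_comp _ _ _ (fun z : R => fr o e (y, z) : R * R * R) phi).
  exact: frz_continuous.
exact: C1_continuous.
Qed.

Let cu' y : continuous (u' y).
Proof.
move=> z; apply: (@continuous_comp _ _ _ (fun z : R => fr o e (y, z) : R * R * R)
  (grad_dot phi (e (inord 2)))); first exact: frz_continuous.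
exact: grad_dot_continuous.
Qed.

Let u'_le y z : (u' y z ^+ 2 <= sqgrad phi (fr o e (y, z)))%R.
Proof. by apply: grad_dot_sqgrad; rewrite orth eqxx. Qed.

Lemma sqgrad_continuous : continuous (sqgrad phi).
Proof.
move=> x; apply: (cvg_big (@add_continuous R)) => i _.
by apply: cvgM; exact: C1_pd_continuous.
Qed.

Let itvE (f : R -> R) a b : continuous f ->
  \int[mu]_(z in `[a, b]) (f z)%:E = \int[mu]_(z in `]a, b[) (f z)%:E.
Proof.
move=> cf; apply: (integral_itv_bndoo true false).
by apply/measurable_EFinP; apply: measurable_funTS; exact: continuous_measurable_fun.
Qed.

Let len y : disk r y -> (0 <= g y - - h <= 2 * h)%R.
Proof.
by move=> /(ch_bounded (l := c)); rewrite ltr_norml -/h -/g => /andP[? ?]; apply/andP; split; lra.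
Qed.

Let A (G : T3 R -> \bar R) y := \int[mu]_(z in `](- h)%R, (g y)[) G (fr o e (y, z)).

Let mitv (y : R * R) : measurable (`](- h)%R, (g y)[ : set (measurableTypeR R)).
Proof. exact: measurable_itv. Qed.

Let mcomp (f : R * R * R -> R) y (B : set (measurableTypeR R)) : continuous f -> measurable_fun B
  (fun z : measurableTypeR R => (f (fr o e (y, z)))%:E).
Proof.
move=> cf; apply/measurable_EFinP; apply: measurable_funTS.
apply: continuous_measurable_fun => z.
apply: (@continuous_comp _ _ _ (fun z : R => fr o e (y, z) : R * R * R) f);
  [exact: frz_continuous|exact: cf].
Qed.

Let sqphi_continuous : continuous (fun x => phi x ^+ 2)%R.
Proof. by move=> x; apply: cvgM; exact: C1_continuous. Qed.

Let sqgrad_ge0 x : (0 <= sqgrad phi x)%R.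
Proof. by apply: sumr_ge0 => i _; exact: sqr_ge0. Qed.

(** A fibre has length at most [2 * h]. Clearing the factor one half of [poincare_itv] gives
    [2 * 2h = 4h] and [2 * 2 * (2h)^2 = 16 h^2]. *)
Let slice_poincare y : disk r y ->
  A (fun x => (phi x ^+ 2)%:E) y <= (4 * h * phi (ch_map c y) ^+ 2)%:E +
    (16 * h ^+ 2)%:E * A (fun x => (sqgrad phi x)%:E) y.
Proof.
move=> dy; have /andP[l0 l1] := len dy.
have ab : (- h <= g y)%R by lra.
have := poincare_itv (du y) (@cu' y) ab.
rewrite !itvE; last 2 first.
- by move=> z; apply: cvgM; [exact: cvg_cst|apply: cvgM; exact: cu'].
- by move=> z; apply: cvgM; [exact: cvg_cst|apply: cvgM; exact: cu].
under eq_integral do rewrite EFinM.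
rewrite ge0_integralZl_EFin//; last 2 first.
- by move=> z _; rewrite lee_fin sqr_ge0.
- exact: (@mcomp _ y _ sqphi_continuous).
move=> H.
have H2 : \int[mu]_(z in `](- h)%R, (g y)[) (2 * (g y - - h) ^+ 2 * u' y z ^+ 2)%:E <=
    (8 * h ^+ 2)%:E * A (fun x => (sqgrad phi x)%:E) y.
  rewrite -ge0_integralZl_EFin//; last 3 first.
  - by move=> z _; rewrite lee_fin.
  - exact: (@mcomp _ y _ sqgrad_continuous).
  - by rewrite mulr_ge0// ?sqr_ge0.
  apply: ge0_le_integral => //.
  - by move=> z _; rewrite lee_fin; apply: mulr_ge0; [apply: mulr_ge0 => //; exact: sqr_ge0|exact: sqr_ge0].
  - apply/measurable_EFinP; apply: measurable_funTS; apply: continuous_measurable_fun => z.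
    by apply: cvgM; [exact: cvg_cst|apply: cvgM; exact: cu'].
  - by apply: emeasurable_funM; [exact: measurable_cst|exact: (@mcomp _ y _ sqgrad_continuous)].
  move=> z _; rewrite -EFinM lee_fin; apply: ler_pM => //.
  - by rewrite mulr_ge0// ?sqr_ge0.
  - exact: sqr_ge0.
  - by rewrite (_ : 8 * h ^+ 2 = 2 * (2 * h) ^+ 2)%R; [|ring]; rewrite ler_pM2l// ler_sqr ?nnegrE//; lra.
have H3 := le_trans H (leeD2l _ H2).
have := lee_wpmul2l (x := 2%:E) _ H3; rewrite muleA -EFinM mulfV// mul1e lee_fin => /(_ (ler0n R 2)).
move=> /le_trans; apply.
rewrite ge0_muleDr ?lee_fin//; last 2 first.
- by rewrite mulr_ge0// ?sqr_ge0.
- apply: mule_ge0; first by rewrite lee_fin mulr_ge0 ?sqr_ge0.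
  by apply: integral_ge0 => z _; rewrite lee_fin.
rewrite muleA -!EFinM; apply: leeD.
  rewrite lee_fin mulrA; apply: ler_wpM2r; [exact: sqr_ge0|lra].
by rewrite (_ : 2 * (8 * h ^+ 2) = 16 * h ^+ 2)%R//; ring.
Qed.

Let slice_trace y : disk r y ->
  ((g y + h) * phi (ch_map c y) ^+ 2)%:E <=
  A (fun x => (2 * phi x ^+ 2 + (2 * h) ^+ 2 * sqgrad phi x)%:E) y.
Proof.
move=> dy; have /andP[l0 l1] := len dy.
have ab : (- h <= g y)%R by lra.
have := trace_itv (du y) (@cu' y) ab.
have cc : continuous (fun z => 2 * u y z ^+ 2 + (g y - - h) ^+ 2 * u' y z ^+ 2)%R.
  move=> z; apply: cvgD; apply: cvgM; (try exact: cvg_cst); apply: cvgM; (exact: cu || exact: cu').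
have cG : continuous (fun x => 2 * phi x ^+ 2 + (2 * h) ^+ 2 * sqgrad phi x)%R.
  move=> x; apply: cvgD; apply: cvgM; (try exact: cvg_cst).
    exact: sqphi_continuous.
  exact: sqgrad_continuous.
rewrite itvE// opprK => /le_trans; apply.
apply: ge0_le_integral => //.
- by move=> z _; rewrite lee_fin addr_ge0// mulr_ge0// ?sqr_ge0.
- by apply/measurable_EFinP; apply: measurable_funTS; rewrite opprK in cc; exact: continuous_measurable_fun.
- exact: (@mcomp _ y _ cG).
move=> z _; rewrite lee_fin lerD2l; apply: ler_pM => //; [exact: sqr_ge0|exact: sqr_ge0|].
by rewrite ler_sqr ?nnegrE; lra.
Qed.

Let mEcont (f : R * R * R -> R) (B : set (T3 R)) : continuous f ->
  measurable_fun B (fun x => (f x)%:E).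
Proof.
by move=> cf; apply/measurable_EFinP; apply: measurable_funTS; exact: continuous_measurable3.
Qed.

Lemma chart_poincare :
  \int[leb3]_(x in (D `&` cyl : set (T3 R))) (phi x ^+ 2)%:E <=
    (4 * h)%:E * \int[leb2]_(y in disk r) (phi (ch_map c y) ^+ 2)%:E +
    (16 * h ^+ 2)%:E * \int[leb3]_(x in (D `&` cyl : set (T3 R))) (sqgrad phi x)%:E.
Proof.
have md := measurable_disk.
have [h0|hn] := leP 0%R h; last first.
  rewrite -/Dcyl (_ : Dcyl = set0) ?integral_set0 ?mule0 ?adde0; last first.
    by apply/seteqP; split => // x [_ [/ch_height_gt0 h0 _]]; rewrite ltNge ltW in h0.
  rewrite integral0_eq ?mule0// => y dy.
  by have := ch_height_gt0 dy; rewrite ltNge ltW.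
have [m1 ->] := measurable_region (@mEcont _ setT sqphi_continuous) (fun x => sqr_ge0 (phi x)).
have [m2 ->] := measurable_region (@mEcont _ setT sqgrad_continuous) sqgrad_ge0.
have m3 : measurable_fun (disk r : set (T2 R)) (fun y : T2 R => (phi (ch_map c y) ^+ 2)%:E).
  apply/measurable_EFinP; apply: measurable_funTS.
  exact: (@measurable_ch_map _ sqphi_continuous).
have A0 y : disk r y -> 0 <= A (fun x => (sqgrad phi x)%:E) y.
  by move=> _; apply: integral_ge0 => z _; rewrite lee_fin.
rewrite -ge0_integralZl_EFin//; last 2 first.
- by move=> y _; rewrite lee_fin sqr_ge0.
- lra.
rewrite -ge0_integralZl_EFin//; last by rewrite mulr_ge0// ?sqr_ge0.
rewrite -ge0_integralD//; last 4 first.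
- by move=> y _; rewrite -EFinM lee_fin; apply: mulr_ge0; [exact: mulr_ge0|exact: sqr_ge0].
- by apply: emeasurable_funM => //; exact: measurable_cst.
- by move=> y dy; rewrite mule_ge0 ?A0// lee_fin mulr_ge0// ?sqr_ge0.
- by apply: emeasurable_funM => //; exact: measurable_cst.
apply: ge0_le_integral => //.
- by move=> y _; apply: integral_ge0 => z _; rewrite lee_fin sqr_ge0.
- apply: emeasurable_funD; (apply: emeasurable_funM => //; exact: measurable_cst).
Qed.

(** The weight [g y + h] is the length of the fibre. It is positive on the disk but has no uniform
    lower bound there, so it stays in the estimate; positivity is enough to detect vanishing
    boundary values. *)
Lemma chart_trace :
  \int[leb2]_(y in disk r) ((g y + h) * phi (ch_map c y) ^+ 2)%:E <=
  \int[leb3]_(x in (D `&` cyl : set (T3 R))) (2 * phi x ^+ 2 + (2 * h) ^+ 2 * sqgrad phi x)%:E.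
Proof.
have md := measurable_disk.
have cG : continuous (fun x => 2 * phi x ^+ 2 + (2 * h) ^+ 2 * sqgrad phi x)%R.
  move=> x; apply: cvgD; apply: cvgM; (try exact: cvg_cst).
    exact: sqphi_continuous.
  exact: sqgrad_continuous.
have G0 x : (0 <= 2 * phi x ^+ 2 + (2 * h) ^+ 2 * sqgrad phi x)%R.
  by rewrite addr_ge0// mulr_ge0// ?sqr_ge0.
have [m1 ->] := measurable_region (@mEcont _ setT cG) G0.
apply: ge0_le_integral => //.
- move=> y dy; rewrite lee_fin; apply: mulr_ge0; last exact: sqr_ge0.
  by have := len dy; rewrite opprK => /andP[].
- apply/measurable_EFinP.
  have m3 : measurable_fun (disk r : set (T2 R)) (fun y : T2 R => g y + h)%R.
    apply: measurable_funTS; apply: (continuous_measurable2 (f := fun y => g y + h)%R) => y.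
    by apply: cvgD; [exact: ch_fun_continuous|exact: cvg_cst].
  have m4 : measurable_fun (disk r : set (T2 R)) (fun y : T2 R => phi (ch_map c y) ^+ 2)%R.
    by apply: measurable_funTS; exact: (@measurable_ch_map _ sqphi_continuous).
  exact: (measurable_funM m3 m4).
Qed.

End charts.

(** * Tonelli on rectangles and integration along segments *)

Lemma measurable_patch d (T : measurableType d) (R : realType) (A : set T) (f : T -> \bar R) :
  measurable A -> measurable_fun setT f -> measurable_fun setT (f \_ A).
Proof.
move=> mA mf; have mfA : measurable_fun A f by apply: measurable_funTS.
by have [H _] := measurable_restrictT f mA; apply: H.
Qed.

Section tonelli.
Context {R : realType} d1 d2 (X1 : measurableType d1) (X2 : measurableType d2).
Variables (m1 : {sigma_finite_measure set X1 -> \bar R}).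
Variables (m2 : {sigma_finite_measure set X2 -> \bar R}).
Local Open Scope ereal_scope.

Lemma tonelli_set (A : set X1) (B : set X2) (F : X1 * X2 -> \bar R) :
  measurable A -> measurable B -> measurable_fun setT F -> (forall p, 0 <= F p) ->
  measurable_fun A (fun x => \int[m2]_(y in B) F (x, y)) /\
  \int[m1]_(x in A) \int[m2]_(y in B) F (x, y) =
  \int[m2]_(y in B) \int[m1]_(x in A) F (x, y).
Proof.
move=> mA mB mF F0; pose H := F \_ (A `*` B).
have mAB : measurable (A `*` B) by exact: measurableX.
have mH : measurable_fun setT H by exact: measurable_patch.
have H0 x : 0 <= H x by rewrite /H patchE; case: ifP.
have E1 : fubini_F m2 H = ((fun x => \int[m2]_(y in B) F (x, y)) \_ A).
  apply/funext => x; rewrite /fubini_F patchE; case: ifPn => xA.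
    rewrite [RHS]integral_mkcond; apply: eq_integral => y _; rewrite /H !patchE.
    by rewrite in_setX /= xA.
  by apply: integral0_eq => y _; rewrite /H patchE in_setX /= (negbTE xA).
have E2 : fubini_G m1 H = ((fun y => \int[m1]_(x in A) F (x, y)) \_ B).
  apply/funext => y; rewrite /fubini_G patchE; case: ifPn => yB.
    rewrite [RHS]integral_mkcond; apply: eq_integral => x _; rewrite /H !patchE.
    by rewrite in_setX /= yB andbT.
  by apply: integral0_eq => x _; rewrite /H patchE in_setX /= (negbTE yB) andbF.
pose K := fun x => \int[m2]_(y in B) F (x, y).
split.
  have mE : measurable_fun setT (K \_ A).
    by rewrite -[K \_ _]E1; exact: measurable_fun_fubini_tonelli_F.
  by have [_ KA] := measurable_restrictT K mA; exact: (KA mE).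
rewrite [LHS]integral_mkcond [RHS]integral_mkcond -E1 -E2.
exact (@fubini_tonelli _ _ _ _ _ m1 m2 H mH H0).
Qed.

End tonelli.

Lemma ge0_integralU_le d (T : measurableType d) (R : realType)
    (m : {measure set T -> \bar R}) (A B : set T) (f : T -> \bar R) :
  measurable A -> measurable B -> measurable_fun setT f -> (forall x, 0 <= f x)%E ->
  (\int[m]_(x in A `|` B) f x <= \int[m]_(x in A) f x + \int[m]_(x in B) f x)%E.
Proof.
move=> mA mB mf f0.
have mr (S : set T) : measurable S -> measurable_fun setT (f \_ S).
  by move=> mS; exact: measurable_patch.
have r0 (S : set T) x : (0 <= (f \_ S) x)%E by rewrite patchE; case: ifP.
rewrite (@integral_mkcond _ _ _ m A) (@integral_mkcond _ _ _ m B) (@integral_mkcond _ _ _ m (A `|` B)).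
rewrite -ge0_integralD//; [|exact: mr..].
apply: ge0_le_integral => //.
- by apply: mr; exact: measurableU.
- by apply: emeasurable_funD; exact: mr.
move=> x _; rewrite !patchE in_setU.
by case: (x \in A); case: (x \in B) => //=; rewrite ?adde0 ?add0e// leeDl.
Qed.

Section shifts.
Context {R : realType}.
Local Notation mu := (@lebesgue_measure R).
Local Open Scope ereal_scope.

Lemma measurable_shift_line (v : R * R * R) :
  measurable_fun [set: (T3 R * measurableTypeR R)%type]
    ((fun p => p.1 + (p.2 : R) *: v)%R : _ -> T3 R).
Proof.
have p2 : measurable_fun [set: (T3 R * measurableTypeR R)%type] (fun p => p.2 : R).
  exact: measurable_snd.
have mZ (a : R) : measurable_fun [set: (T3 R * measurableTypeR R)%type]
    ((fun p => p.2 * a)%R : _ -> R).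
  by apply: measurable_funM => //; exact: measurable_cst.
have mv : measurable_fun [set: (T3 R * measurableTypeR R)%type]
    ((fun p => (p.2 : R) *: v)%R : _ -> T3 R).
  apply: measurable_fun_pair; first apply: measurable_fun_pair.
  - exact: (mZ v.1.1).
  - exact: (mZ v.1.2).
  - exact: (mZ v.2).
have p1 : measurable_fun [set: (T3 R * measurableTypeR R)%type] (fun p => p.1) by exact: measurable_fst.
exact: (measurableT_comp measurable_add3 (measurable_fun_pair p1 mv)).
Qed.

(* Integrating a nonnegative function over the translates of [A] along a
   segment that stays in [B]. *)
Lemma integral_sweep (A B : set (T3 R)) (v : T3 R) (t : R) (F : T3 R -> \bar R) :
  measurable A -> measurable B -> measurable_fun setT F -> (forall x, 0 <= F x) ->
  (0 <= t)%R -> (forall x s, A x -> (0 <= s <= t)%R -> B (x + s *: v)%R) ->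
  measurable_fun A (fun x => \int[mu]_(s in `[0%R, t]) F (x + (s : R) *: v)%R) /\
  \int[leb3]_(x in A) \int[mu]_(s in `[0%R, t]) F (x + (s : R) *: v)%R <=
  t%:E * \int[leb3]_(x in B) F x.
Proof.
move=> mA mB mF F0 t0 AB.
have mI : measurable (`[0%R, t] : set (measurableTypeR R)) by exact: measurable_itv.
have mF2 : measurable_fun [set: (T3 R * measurableTypeR R)%type]
    (fun p => F (p.1 + (p.2 : R) *: v)%R).
  exact: (measurableT_comp mF (measurable_shift_line v)).
have [m1 ->] := tonelli_set (@leb3 R) mu mA mI mF2 (fun p => F0 _).
split => //.
have K (s : R) : (0 <= s <= t)%R -> \int[leb3]_(x in A) F (x + s *: v)%R <= \int[leb3]_(x in B) F x.
  move=> s0t; rewrite integral_mkcond [leRHS]integral_mkcond.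
  have mFB : measurable_fun setT (F \_ B) by exact: measurable_patch.
  have FB0 x : 0 <= (F \_ B) x by rewrite patchE; case: ifP.
  rewrite -(ge0_integral_shift3 (s *: v)%R mFB FB0).
  apply: ge0_le_integral => //.
  - by move=> x _; rewrite patchE; case: ifP.
  - apply: measurable_patch => //.
    exact: (measurableT_comp mF (measurable_shift3 (s *: v)%R)).
  - exact: (measurableT_comp mFB (measurable_shift3 (s *: v)%R)).
  move=> x _; rewrite !patchE; case: ifPn => [xA|_]; last by case: ifP.
  by rewrite inE in xA; rewrite mem_set//; exact: AB.
have lt : mu (`[0%R, t] : set (measurableTypeR R)) = t%:E.
  rewrite lebesgue_measure_itv/= lte_fin sube0.
  by move: t0; rewrite le_eqVlt => /predU1P[<-|->//]; rewrite ltxx.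
have -> : t%:E * \int[leb3]_(x in B) F x = \int[mu]_(s in `[0%R, t]) (\int[leb3]_(x in B) F x).
  by rewrite -lt muleC; apply/esym; exact: integral_cst.
apply: ge0_le_integral => //.
- by move=> s _; apply: integral_ge0.
- have mF3 : measurable_fun [set: (measurableTypeR R * T3 R)%type]
      (fun p => F (p.2 + (p.1 : R) *: v)%R).
    have := measurableT_comp mF2 (measurable_fun_pair measurable_snd measurable_fst :
      measurable_fun [set: (measurableTypeR R * T3 R)%type] (fun p => (p.2, p.1))).
    by [].
  by have [] := tonelli_set mu (@leb3 R) mI mA mF3 (fun p => F0 _).
Qed.

End shifts.

(** * Poincare's inequality with boundary terms for C^1 functions on a Lipschitz domain *)

Section smooth_poincare.
Context {R : realType}.
Local Notation mu := (@lebesgue_measure R).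
Variable Omega : set (R * R * R).
Hypothesis oO : open Omega.
Hypothesis bO : bounded_set Omega.
Hypothesis lO : lipschitz_boundary Omega.

Lemma bounded_coords : exists M : R, 0 < M /\ forall x, Omega x ->
  [/\ `|x.1.1| <= M, `|x.1.2| <= M & `|x.2| <= M].
Proof.
move: bO => [M [_ HM]].
exists (`|M| + 1); split; first by have := normr_ge0 M; lra.
move=> x Ox; have H : `|x| <= `|M| + 1.
  by apply: HM => //; have := ler_norm M; lra.
have n1 (p : R * R * R) : `|p.1| <= `|p| by rewrite [leRHS]/Num.Def.normr/= le_max lexx.
have n2 (p : R * R * R) : `|p.2| <= `|p| by rewrite [leRHS]/Num.Def.normr/= le_max lexx orbT.
have n3 (p : R * R) : `|p.1| <= `|p| by rewrite [leRHS]/Num.Def.normr/= le_max lexx.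
have n4 (p : R * R) : `|p.2| <= `|p| by rewrite [leRHS]/Num.Def.normr/= le_max lexx orbT.
split; [apply: le_trans (n3 x.1) _|apply: le_trans (n4 x.1) _|exact: le_trans (n2 x) H];
  exact: le_trans (n1 x) H.
Qed.

Lemma compact_closure_bounded : compact (closure Omega).
Proof.
have [M [M0 HM]] := bounded_coords.
pose I : set R := [set` `[(- M), M]].
have cI : compact I by exact: segment_compact.
have cB : compact ((I `*` I) `*` I) by apply: compact_setX => //; exact: compact_setX.
have clB : closed ((I `*` I) `*` I).
  apply: compact_closed => //; exact: norm_hausdorff.
apply: (subclosed_compact _ cB); first exact: closed_closure.
have /closure_id -> := clB; apply: closure_subset => x /HM[].
by rewrite !ler_norml => ? ? ?; split; [split|]; rewrite /I /= in_itv.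
Qed.

(** A property stable under finite unions, made for a compactness argument: the constant and the
    charts may depend on [A], but not on [phi], and the energy on the right is already that of the
    whole domain. *)
Definition chart_controlled (A : set (R * R * R)) := open A /\
  exists (C : R) (cs : seq (lip_chart Omega)), 0 <= C /\ forall phi, C1 phi ->
   (\int[leb3]_(x in (Omega `&` A : set (T3 R))) (phi x ^+ 2)%:E <=
    C%:E * (\sum_(c <- cs) \int[leb2]_(y in disk (ch_rad c)) (phi (ch_map c y) ^+ 2)%:E +
            \int[leb3]_(x in (Omega : set (T3 R))) (sqgrad phi x)%:E))%E.

Let mEcont (f : R * R * R -> R) (B : set (T3 R)) : continuous f ->
  measurable_fun B (fun x => (f x)%:E).
Proof.
by move=> cf; apply/measurable_EFinP; apply: measurable_funTS; exact: continuous_measurable3.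
Qed.

Let sqr_continuous (phi : R * R * R -> R) : C1 phi -> continuous (fun x => phi x ^+ 2).
Proof. by move=> Cp x; apply: cvgM; exact: C1_continuous. Qed.

Let sqgrad_ge0 (phi : R * R * R -> R) x : 0 <= sqgrad phi x.
Proof. by apply: sumr_ge0 => i _; exact: sqr_ge0. Qed.

Let bsum_ge0 (cs : seq (lip_chart Omega)) (phi : R * R * R -> R) :
  (0 <= \sum_(c <- cs) \int[leb2]_(y in disk (ch_rad c)) (phi (ch_map c y) ^+ 2)%:E)%E.
Proof.
by apply: sume_ge0 => c _; apply: integral_ge0 => y _; rewrite lee_fin sqr_ge0.
Qed.

Let gint_ge0 (phi : R * R * R -> R) (B : set (T3 R)) :
  (0 <= \int[leb3]_(x in B) (sqgrad phi x)%:E)%E.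
Proof. by apply: integral_ge0 => y _; rewrite lee_fin; exact: sqgrad_ge0. Qed.

Lemma chart_controlled0 : chart_controlled set0.
Proof.
split; first exact: open0.
by exists 0, [::]; split => // phi _; rewrite setI0 integral_set0 mul0e.
Qed.

Lemma chart_controlled_cyl (c : lip_chart Omega) : chart_controlled (cyl c).
Proof.
split; first exact: cyl_open.
have [hp|hn] := leP 0 (ch_height c); last first.
  exists 0, [::]; split => // phi _; rewrite (_ : _ `&` _ = set0) ?integral_set0 ?mul0e//.
  by apply/seteqP; split => // x [_ [/ch_height_gt0 h0 _]]; rewrite ltNge ltW in h0.
exists (4 * ch_height c + 16 * ch_height c ^+ 2), [:: c].
have h2 := sqr_ge0 (ch_height c).
split; first by lra.
move=> phi Cp; apply: (le_trans (chart_poincare oO c Cp)).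
have S0 : (0 <= \int[leb2]_(y in disk (ch_rad c)) (phi (ch_map c y) ^+ 2)%:E)%E.
  by apply: integral_ge0 => y _; rewrite lee_fin sqr_ge0.
rewrite big_seq1 (ge0_muleDr _ S0 (gint_ge0 phi Omega)).
apply: leeD; apply: lee_pmul.
- by rewrite lee_fin; lra.
- by apply: integral_ge0 => y _; rewrite lee_fin sqr_ge0.
- by rewrite lee_fin; lra.
- exact: lexx.
- by rewrite lee_fin; lra.
- exact: gint_ge0.
- by rewrite lee_fin; lra.
apply: ge0_subset_integral.
- by apply: open_measurable3; apply: openI => //; exact: cyl_open.
- exact: open_measurable3.
- exact: (@mEcont _ _ (@sqgrad_continuous R phi Cp)).
- by move=> x _; rewrite lee_fin; exact: sqgrad_ge0.
- by move=> x [].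
Qed.

Lemma chart_controlledU A B : chart_controlled A -> chart_controlled B ->
  chart_controlled (A `|` B).
Proof.
move=> [oA [C1' [cs1 [C10 H1]]]] [oB [C2 [cs2 [C20 H2]]]].
split; first exact: openU.
exists (C1' + C2), (cs1 ++ cs2); split; first by lra.
move=> phi Cp; rewrite setIUr big_cat /=.
have mO (S : set (R * R * R)) : open S -> measurable (Omega `&` S : set (T3 R)).
  by move=> oS; apply: open_measurable3; exact: openI.
have p0 (x : T3 R) : (0 <= (phi x ^+ 2)%:E)%E by rewrite lee_fin sqr_ge0.
have mp := @mEcont _ setT (@sqr_continuous _ Cp).
apply: (le_trans (ge0_integralU_le (@leb3 R) (mO _ oA) (mO _ oB) mp p0)).
have S1 := bsum_ge0 cs1 phi; have S2 := bsum_ge0 cs2 phi; have G0 := gint_ge0 phi Omega.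
rewrite EFinD ge0_muleDl; [|by rewrite lee_fin..].
apply: leeD; [apply: le_trans (H1 phi Cp) _|apply: le_trans (H2 phi Cp) _];
  apply: lee_wpmul2l; rewrite ?lee_fin//; apply: leeD2r.
- exact: leeDl.
- exact: leeDr.
Qed.

Lemma boundary_cover : exists2 U : set (R * R * R), chart_controlled U & bdry Omega `<=` U.
Proof.
have cG : compact (bdry Omega).
  apply: (subclosed_compact _ compact_closure_bounded); last by move=> x [].
  rewrite /bdry setDE; apply: closedI; first exact: closed_closure.
  by apply: open_closedC; exact: open_interior.
(* Compactness of the boundary is used as a near-covering property along the filter of all
   sufficiently large controlled sets. Each boundary point lies in the cylinder of a chart, hence in
   every controlled set containing that cylinder. *)
pose F : set_system (set (R * R * R)) := fun S => exists2 U, chart_controlled U &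
  forall V, chart_controlled V -> U `<=` V -> S V.
have FF : Filter F.
  split.
  - by exists set0 => //; exact: chart_controlled0.
  - move=> S S' [U cU HU] [U' cU' HU']; exists (U `|` U'); first exact: chart_controlledU.
    by move=> V cV UV; split; [apply: HU|apply: HU'] => // x Ux; apply: UV; [left|right].
  - by move=> S S' SS' [U cU HU]; exists U => // V cV UV; apply: SS'; exact: HU.
have := (compact_near_coveringP (bdry Omega)).1 cG _ F (fun V x => chart_controlled V -> V x) FF.
move=> /(_ _)[x bx|U cU HU]; last first.
  by exists U => // x bx; exact: (HU U cU (@subset_refl _ U) x bx cU).
have [c [y [dy <-]]] := lO bx.
exists (cyl c, [set V | cyl c `<=` V]) => /=.
  split.
    by apply: open_nbhs_nbhs; split; [exact: cyl_open|exact: ch_map_cyl].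
  by exists (cyl c) => //; exact: chart_controlled_cyl.
by move=> [x' V] /= [cx' cV] _; exact: cV.
Qed.

Let b0 := basis3 R ord0.

Let shiftE (x : R * R * R) (s : R) : x + s *: b0 = ((x.1.1 + s, x.1.2), x.2).
Proof.
case: x => [[x1 x2] x3]; congr (_, _, _).
- by change (x1 + s * 1 = x1 + s); ring.
- by change (x2 + s * 0 = x2); ring.
- by change (x3 + s * 0 = x3); ring.
Qed.

(** The cap [t <= 1] is the one that [step_itv] asks for. *)
Lemma uniform_step (K : set (R * R * R)) : compact K -> K `<=` Omega ->
  exists2 t : R, 0 < t <= 1 & forall x s, K x -> 0 <= s <= t -> Omega (x + s *: b0).
Proof.
move=> cK KO; have := (compact_near_coveringP K).1 cK R (nbhs (0 : R)).
move=> /(_ (fun s x => Omega (x + s *: b0))) /(_ _) [|].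
  move=> x Kx.
  have cv : (fun p : R * R * R * R => p.1 + p.2 *: b0) @ (x, 0 : R) --> x + (0 : R) *: b0.
    apply: (@cvgD _ _ _ (nbhs (x, 0 : R))); first exact: cvg_fst.
    by apply: cvgZl; exact: cvg_snd.
  have Ox : nbhs (x + (0 : R) *: b0) Omega.
    by rewrite scale0r addr0; apply: open_nbhs_nbhs; split => //; exact: KO.
  exact: (cv _ Ox).
move=> d /= d0 Hd; exists (Num.min (d / 2) 1).
  by rewrite lt_min ltr01 ge_min lexx orbT andbT; lra.
move=> x s Kx; rewrite le_min => /andP[s0 /andP[sd _]]; apply: Hd => //=.
by rewrite sub0r normrN ger0_norm//; lra.
Qed.

(** Near the boundary the charts give the bound. A point away from it can be pushed by [t] in the
    first coordinate direction without leaving [Omega], and finitely many pushes exhaust the bounded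
    domain; a point that comes close to the boundary on the way is taken over by the charts. *)
Lemma smooth_poincare : exists (C : R) (cs : seq (lip_chart Omega)), 0 <= C /\
  forall phi, C1 phi ->
   (\int[leb3]_(x in (Omega : set (T3 R))) (phi x ^+ 2)%:E <=
    C%:E * (\sum_(c <- cs) \int[leb2]_(y in disk (ch_rad c)) (phi (ch_map c y) ^+ 2)%:E +
            \int[leb3]_(x in (Omega : set (T3 R))) (sqgrad phi x)%:E))%E.
Proof.
have [U [oU [C [cs [C0 HC]]]] bU] := boundary_cover.
have mO : measurable (Omega : set (T3 R)) by exact: open_measurable3.
have mU : measurable (U : set (T3 R)) by exact: open_measurable3.
have cK : compact (closure Omega `\` U).
  apply: (subclosed_compact _ compact_closure_bounded); last by move=> x [].
  by rewrite setDE; apply: closedI; [exact: closed_closure|exact: open_closedC].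
have KO : closure Omega `\` U `<=` Omega.
  move=> x [clx nUx]; apply: contrapT => nOx; apply: nUx; apply: bU.
  by split => // /interior_subset.
have [t /andP[t0 t1] Ht] := uniform_step cK KO.
have [M [M0 HM]] := bounded_coords.
(* The exponent is a number of steps of length [t] that exceeds the width [2 * M]; each step doubles
   the bound and adds [C + 4]. *)
exists ((2 ^+ (Num.truncn (2 * M / t)).+1) * (C + 4)), cs.
split; first by rewrite mulr_ge0 ?exprn_ge0//; lra.
move=> phi Cp.
set S := (\sum_(c <- cs) _ + _)%E.
(* The slab at distance less than [j * t] from the far side; a push by [t] sends [E j.+1] into
   [E j]. *)
pose E j : set (T3 R) := [set x | M - j%:R * t < x.1.1].
pose a j := (\int[leb3]_(x in (Omega `&` E j)) (phi x ^+ 2)%:E)%E.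
have mE j : measurable (E j).
  apply: open_measurable3; have -> : E j = [set x : R * R * R | - x.1.1 < - (M - j%:R * t)].
    by apply/seteqP; split => x; rewrite /E /= ltrN2.
  apply: (@open_lt3 R (fun x => - x.1.1)) => x; apply: cvgN.
  by have := @coord3_continuous R ord0 x; rewrite /Defs.coord /=; apply.
have S0 : (0 <= S)%E by apply: adde_ge0; [exact: bsum_ge0|exact: gint_ge0].
(* [C] accounts for the part in [U], and 4 for the gradient along the pushes, where [t <= 1] absorbs
   the length of the sweep. *)
have step j : (a j.+1 <= 2%:E * a j + (C + 4)%:E * S)%E.
  pose A : set (T3 R) := (Omega `&` E j.+1) `\` U.
  have mA : measurable A by apply: measurableD => //; exact: measurableI.
  have AO x s : A x -> 0 <= s <= t -> Omega (x + s *: b0).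
    by move=> [[Ox _] nUx] st; apply: Ht => //; split => //; exact: subset_closure.
  have sub : (a j.+1 <= \int[leb3]_(x in (Omega `&` U : set (T3 R))) (phi x ^+ 2)%:E +
      \int[leb3]_(x in A) (phi x ^+ 2)%:E)%E.
    have p0 (x : T3 R) : (0 <= (phi x ^+ 2)%:E)%E by rewrite lee_fin sqr_ge0.
    have mp := @mEcont _ setT (@sqr_continuous _ Cp).
    apply: le_trans (ge0_integralU_le (@leb3 R) (measurableI _ _ mO mU) mA mp p0).
    apply: ge0_subset_integral.
    - exact: measurableI.
    - by apply: measurableU => //; exact: measurableI.
    - exact: (@mEcont _ _ (@sqr_continuous _ Cp)).
    - by move=> x _; rewrite lee_fin sqr_ge0.
    - move=> x [Ox Ex]; have [Ux|nUx] := pselect (U x); first by left.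
      by right.
  have cg4 : continuous (fun x => 4 * sqgrad phi x).
    by move=> x; apply: cvgM; [exact: cvg_cst|exact: sqgrad_continuous].
  have [msw sweep] := @integral_sweep R A Omega b0 t (fun x => (4 * sqgrad phi x)%:E) mA mO
    (@mEcont _ setT cg4) (fun x => mulr_ge0 (ler0n _ 4) (sqgrad_ge0 phi x)) (ltW t0) AO.
  have mph : measurable_fun setT (fun x : T3 R => (phi (x + t *: b0) ^+ 2)%:E).
    exact: (measurableT_comp (@mEcont _ setT (@sqr_continuous _ Cp)) (measurable_shift3 (t *: b0))).
  have ptw x : A x -> ((phi x ^+ 2)%:E <= (2%:E * (phi (x + t *: b0) ^+ 2)%:E) +
      \int[mu]_(s in `[0%R, t]) (4 * sqgrad phi (x + s *: b0))%:E)%E.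
    move=> Ax.
    have dl := is_derive_C1_line Cp b0 x.
    have cl : continuous (fun s : R => grad_dot phi b0 (s *: b0 + x)).
      move=> s; apply: (@continuous_comp _ _ _ (fun s : R => s *: b0 + x) (grad_dot phi b0)).
        by apply: cvgD; [exact: cvgZl|exact: cvg_cst].
      exact: grad_dot_continuous.
    have t01 : 0 <= t <= 1 by rewrite ltW.
    have := step_itv dl cl t01; rewrite scale0r add0r => H.
    apply: le_trans H _; rewrite EFinM [t *: b0 + x]addrC; apply: leeD => //.
    apply: ge0_le_integral => //.
    - by move=> s _; rewrite lee_fin mulr_ge0 ?sqr_ge0.
    - apply/measurable_EFinP; apply: measurable_funTS; apply: continuous_measurable_fun => s.
      by apply: cvgM; [exact: cvg_cst|apply: cvgM; exact: cl].
    - apply/measurable_EFinP; apply: measurable_funTS; apply: continuous_measurable_fun => s.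
      apply: cvgM; first exact: cvg_cst.
      apply: (@continuous_comp _ _ _ (fun s : R => x + s *: b0) (sqgrad phi)).
        by apply: cvgD; [exact: cvg_cst|exact: cvgZl].
      exact: sqgrad_continuous.
    - move=> s _; rewrite lee_fin [s *: b0 + x]addrC; apply: ler_wpM2l => //.
      apply: grad_dot_sqgrad; rewrite dotE /b0 /basis3 /=.
      by rewrite !mulr0 !addr0 mulr1.
  have intA : (\int[leb3]_(x in A) (phi x ^+ 2)%:E <=
      2%:E * a j + 4%:E * \int[leb3]_(x in (Omega : set (T3 R))) (sqgrad phi x)%:E)%E.
    apply: (@le_trans _ _ (\int[leb3]_(x in A) (2%:E * (phi (x + t *: b0) ^+ 2)%:E +
      \int[mu]_(s in `[0%R, t]) (4 * sqgrad phi (x + s *: b0))%:E))%E).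
      apply: ge0_le_integral => //.
      - by move=> x _; rewrite lee_fin sqr_ge0.
      - exact: (@mEcont _ _ (@sqr_continuous _ Cp)).
      - apply: emeasurable_funD => //; apply: emeasurable_funM; first exact: measurable_cst.
        exact: measurable_funTS.
    rewrite ge0_integralD//; last 3 first.
    - by move=> x _; rewrite -EFinM lee_fin mulr_ge0 ?sqr_ge0.
    - apply: emeasurable_funM; first exact: measurable_cst.
      exact: measurable_funTS.
    - move=> x _; apply: integral_ge0 => s _; rewrite lee_fin; apply: mulr_ge0 => //.
    apply: leeD.
      rewrite ge0_integralZl//; last 2 first.
      - exact: measurable_funTS.
      - by move=> x _; rewrite lee_fin sqr_ge0.
      apply: lee_wpmul2l => //; rewrite /a integral_mkcond [leRHS]integral_mkcond.
      have mOE : measurable (Omega `&` E j : set (T3 R)) by exact: measurableI.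
      have mR := measurable_patch mOE (@mEcont _ setT (@sqr_continuous _ Cp)).
      have R0 x : (0 <= ((fun x : T3 R => (phi x ^+ 2)%:E) \_ (Omega `&` E j)) x)%E.
        by rewrite patchE; case: ifP => // _; rewrite lee_fin sqr_ge0.
      rewrite -(ge0_integral_shift3 (t *: b0) mR R0).
      apply: ge0_le_integral => //.
      - by move=> x _; rewrite patchE; case: ifP => // _; rewrite lee_fin sqr_ge0.
      - exact: measurable_patch.
      - exact: (measurableT_comp mR (measurable_shift3 (t *: b0))).
      move=> x _; rewrite patchE; case: ifPn => // xA; rewrite inE in xA.
      rewrite patchE mem_set//; split; first by apply: AO => //; rewrite lexx ltW.
      have E1 : (x + t *: b0).1.1 = x.1.1 + t by rewrite shiftE.
      by have [[_ Ex] _] := xA; move: Ex; rewrite /E /mkset E1 -natr1; lra.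
    apply: le_trans sweep _.
    under eq_integral do rewrite EFinM.
    rewrite ge0_integralZl_EFin//; last 2 first.
    - by move=> x _; rewrite lee_fin; exact: sqgrad_ge0.
    - exact: (@mEcont _ _ (@sqgrad_continuous R phi Cp)).
    rewrite muleA; apply: lee_wpmul2r; first exact: gint_ge0.
    by rewrite -EFinM lee_fin; lra.
  have CE : ((C + 4)%:E * S = C%:E * S + 4%:E * S)%E.
    by rewrite EFinD (ge0_muleDl S) ?lee_fin.
  apply: (le_trans sub); rewrite CE (addeCA (2%:E * a j)%E (C%:E * S)%E); apply: leeD.
    exact: (HC phi Cp).
  apply: (le_trans intA); apply: leeD2l; apply: lee_wpmul2l => //.
  by rewrite /S; apply: leeDr; exact: bsum_ge0.
(* The recursion starts from nothing: no point of [Omega] has first coordinate above [M]. *)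
have a0 : a 0%N = 0%E.
  rewrite /a (_ : _ `&` _ = set0) ?integral_set0//; apply/seteqP; split => // x [/HM[+ _ _]].
  by rewrite /E /= mul0r subr0 ler_norml => /andP[_]; rewrite leNgt => /negP.
have aj j : (a j <= ((2 ^+ j - 1) * (C + 4))%:E * S)%E.
  elim: j => [|j IH]; first by rewrite a0 expr0 subrr mul0r mul0e.
  have p1 : 0 <= (2 ^+ j - 1 : R) by rewrite subr_ge0 exprn_ege1// ler1n.
  have c4 : 0 <= C + 4 by lra.
  apply: le_trans (step j) _; apply: (@le_trans _ _ (2%:E * (((2 ^+ j - 1) * (C + 4))%:E * S) + (C + 4)%:E * S)%E).
    by apply: leeD2r; apply: lee_wpmul2l.
  rewrite muleA -EFinM -ge0_muleDl ?lee_fin//; last by rewrite !mulr_ge0.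
  by rewrite -EFinD le_eqVlt; apply/orP; left; apply/eqP; congr (_%:E * _)%E; rewrite exprS; ring.
set N := (Num.truncn (2 * M / t)).+1 in aj *.
have NM : 2 * M < N%:R * t by rewrite -ltr_pdivrMr//; exact: truncnS_gt.
have -> : Omega = Omega `&` E N.
  apply/seteqP; split => [x Ox|x []//]; split => //.
  have [+ _ _] := HM x Ox; rewrite /E /= ler_norml => /andP[+ _]; lra.
apply: le_trans (aj N) _; rewrite -/S; apply: lee_wpmul2r => //.
by rewrite lee_fin; apply: ler_wpM2r; lra.
Qed.

End smooth_poincare.

(** * Null sets, complex arithmetic by parts, square integrals and limits *)

Section almost_everywhere.
Context {R : realType} d (T : measurableType d).
Variable m : {measure set T -> \bar R}.

Lemma ae_imp (P Q : T -> Prop) : (forall x, P x -> Q x) -> {ae m, forall x, P x} ->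
  {ae m, forall x, Q x}.
Proof. by move=> PQ; apply: negligibleS => x /= nQ /PQ. Qed.

Lemma ae_imp2 (P P' Q : T -> Prop) : (forall x, P x -> P' x -> Q x) ->
  {ae m, forall x, P x} -> {ae m, forall x, P' x} -> {ae m, forall x, Q x}.
Proof.
move=> PQ HP HP'; apply: negligibleS (negligibleU HP HP') => x /= nQ.
by have [Px|] := pselect (P x); [right => P'x; apply: nQ; exact: PQ|left].
Qed.

End almost_everywhere.

Section complex_parts.
Context {R : realType}.
Implicit Types (z w : R[i]).
Local Open Scope complex_scope.

Lemma cReD z w : complex.Re (z + w) = complex.Re z + complex.Re w.
Proof. by case: z w => [? ?] [? ?]. Qed.
Lemma cImD z w : complex.Im (z + w) = complex.Im z + complex.Im w.
Proof. by case: z w => [? ?] [? ?]. Qed.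
Lemma cReN z : complex.Re (- z) = - complex.Re z.
Proof. by case: z. Qed.
Lemma cImN z : complex.Im (- z) = - complex.Im z.
Proof. by case: z. Qed.
Lemma cReM z w : complex.Re (z * w) = complex.Re z * complex.Re w - complex.Im z * complex.Im w.
Proof. by case: z w => [? ?] [? ?]. Qed.
Lemma cImM z w : complex.Im (z * w) = complex.Re z * complex.Im w + complex.Im z * complex.Re w.
Proof. by case: z w => [? ?] [? ?]. Qed.
Lemma cReJ z : complex.Re (conjc z) = complex.Re z.
Proof. by case: z. Qed.
Lemma cImJ z : complex.Im (conjc z) = - complex.Im z.
Proof. by case: z. Qed.
Lemma c_ext z w : complex.Re z = complex.Re w -> complex.Im z = complex.Im w -> z = w.
Proof. by case: z w => [? ?] [? ?] /= -> ->. Qed.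

Definition cpartE := (cReD, cImD, cReN, cImN, cReM, cImM, cReJ, cImJ).

Lemma sqmod_ge0 z : 0 <= sqmod z.
Proof. by rewrite /sqmod addr_ge0 ?sqr_ge0. Qed.

Lemma sqmodM z w : sqmod (z * w) = sqmod z * sqmod w.
Proof. by rewrite /sqmod !cpartE; ring. Qed.

Lemma sqmod_lin c z w : sqmod (c * z + w) <= 2 * sqmod c * sqmod z + 2 * sqmod w.
Proof.
rewrite -mulrA -sqmodM; move: (c * z) => y; rewrite /sqmod !cpartE.
have := sqr_ge0 (complex.Re y - complex.Re w); have := sqr_ge0 (complex.Im y - complex.Im w).
by rewrite !expr2; lra.
Qed.

Lemma sqmod0 : sqmod (0 : R[i]) = 0.
Proof. by rewrite /sqmod /= expr0n /= addr0. Qed.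

Lemma sqmod_eq0 z : sqmod z = 0 -> z = 0.
Proof.
rewrite /sqmod => /eqP; rewrite paddr_eq0 ?sqr_ge0// !sqrf_eq0 => /andP[/eqP a /eqP b].
exact: c_ext.
Qed.

End complex_parts.

Section square_integrals.
Context {R : realType} d (T : measurableType d).
Variable m : {measure set T -> \bar R}.
Implicit Types (D : set T) (f g : T -> R[i]).

Definition cmeas D f :=
  measurable_fun D (fun x => complex.Re (f x)) /\ measurable_fun D (fun x => complex.Im (f x)).

Definition csq D f : \bar R := (\int[m]_(x in D) (sqmod (f x))%:E)%E.

Lemma cmeas_sub D D' f : measurable D -> D' `<=` D -> cmeas D f -> cmeas D' f.
Proof. by move=> mD DD [a b]; split; apply: (measurable_funS mD DD). Qed.

Lemma cmeas_cst D c : cmeas D (fun=> c).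
Proof. by split; exact: measurable_cst. Qed.

Lemma cmeasD D f g : cmeas D f -> cmeas D g -> cmeas D (fun x => f x + g x).
Proof.
move=> [a b] [a' b']; split.
  by under eq_fun do rewrite cReD; exact: (measurable_funD a a').
by under eq_fun do rewrite cImD; exact: (measurable_funD b b').
Qed.

Lemma cmeasM D f g : cmeas D f -> cmeas D g -> cmeas D (fun x => f x * g x).
Proof.
move=> [a b] [a' b']; split.
  by under eq_fun do rewrite cReM; exact: (measurable_funB (measurable_funM a a') (measurable_funM b b')).
by under eq_fun do rewrite cImM; exact: (measurable_funD (measurable_funM a b') (measurable_funM b a')).
Qed.

Lemma cmeas_lin D c f g : cmeas D f -> cmeas D g -> cmeas D (fun x => c * f x + g x).
Proof. by move=> mf mg; apply: cmeasD => //; apply: cmeasM => //; exact: cmeas_cst. Qed.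

Lemma cmeasB D f g : cmeas D f -> cmeas D g -> cmeas D (fun x => f x - g x).
Proof.
move=> mf mg; have := cmeas_lin (-1) mg mf.
by under [X in cmeas _ X -> _]eq_fun do rewrite mulN1r addrC.
Qed.

Lemma cmeasJ D f : cmeas D f -> cmeas D (fun x => conjc (f x)).
Proof.
move=> [a b]; split; first by under eq_fun do rewrite cReJ.
by under eq_fun do rewrite cImJ; exact: (measurableT_comp (@oppr_measurable R setT) b).
Qed.

Lemma measurable_sqmod D f : cmeas D f -> measurable_fun D (fun x => (sqmod (f x))%:E).
Proof.
move=> [a b]; apply/measurable_EFinP.
exact: (measurable_funD (measurable_funM a a) (measurable_funM b b)).
Qed.

Lemma csq_ge0 D f : (0 <= csq D f)%E.
Proof. by apply: integral_ge0 => x _; rewrite lee_fin sqmod_ge0. Qed.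

Lemma csq_lin D c f g : measurable D -> cmeas D f -> cmeas D g ->
  (csq D (fun x => c * f x + g x)%R <= (2 * sqmod c)%:E * csq D f + 2%:E * csq D g)%E.
Proof.
move=> mD mf mg; have c0 := sqmod_ge0 c.
have msf := measurable_sqmod mf; have msg := measurable_sqmod mg.
have s0 h (x : T) : (0 <= (sqmod (h x : R[i]))%:E)%E by rewrite lee_fin sqmod_ge0.
rewrite /csq -ge0_integralZl_EFin//; last by rewrite mulr_ge0.
rewrite -ge0_integralZl_EFin// -ge0_integralD//; last 4 first.
- by move=> x _; rewrite mule_ge0// lee_fin mulr_ge0.
- by apply: emeasurable_funM => //; exact: measurable_cst.
- by move=> x _; rewrite mule_ge0.
- by apply: emeasurable_funM => //; exact: measurable_cst.
apply: ge0_le_integral => //.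
- by move=> x _; rewrite lee_fin sqmod_ge0.
- by apply: measurable_sqmod; exact: cmeas_lin.
- by apply: emeasurable_funD; (apply: emeasurable_funM => //; exact: measurable_cst).
- by move=> x _; rewrite -!EFinM -EFinD lee_fin; exact: sqmod_lin.
Qed.

Lemma csq_lin_fin D c f g : measurable D -> cmeas D f -> cmeas D g ->
  (csq D f < +oo)%E -> (csq D g < +oo)%E -> (csq D (fun x => c * f x + g x)%R < +oo)%E.
Proof.
move=> mD mf mg ff gg; apply: le_lt_trans (csq_lin c mD mf mg) _.
rewrite lte_add_pinfty//; apply: lte_mul_pinfty => //.
by rewrite lee_fin mulr_ge0// sqmod_ge0.
Qed.

Lemma csq0 D : csq D (fun=> 0) = 0%E.
Proof. by rewrite /csq integral0_eq// => x _; rewrite sqmod0. Qed.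

Lemma csq_eq D f g : (forall x, D x -> f x = g x) -> csq D f = csq D g.
Proof. by move=> fg; apply: eq_integral => x; rewrite inE => /fg ->. Qed.

End square_integrals.

Section ereal_limits.
Context {R : realType}.
Implicit Types (u v w : nat -> \bar R).
Local Open Scope ereal_scope.

Lemma cvge0_lin u v w (a b : R) : (forall n, 0 <= w n) ->
  (forall n, w n <= a%:E * u n + b%:E * v n) ->
  u @ \oo --> 0 -> v @ \oo --> 0 -> w @ \oo --> 0.
Proof.
move=> w0 wuv u0 v0.
have cu : (fun n => a%:E * u n) @ \oo --> 0 by rewrite -[X in _ --> X](mule0 a%:E); exact: cvgeZl.
have cv : (fun n => b%:E * v n) @ \oo --> 0 by rewrite -[X in _ --> X](mule0 b%:E); exact: cvgeZl.
have cuv : (fun n => a%:E * u n + b%:E * v n) @ \oo --> 0.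
  by rewrite -[X in _ --> X](adde0 0); exact: cvgeD.
apply: (squeeze_cvge _ (@cvg_cst _ 0 _ \oo _) cuv).
by apply: nearW => n; rewrite w0 wuv.
Qed.

Lemma cvge0_sum (I : Type) (r : seq I) (F : I -> nat -> \bar R) :
  (forall i n, 0 <= F i n) -> (forall i, F i @ \oo --> 0) ->
  (fun n => \sum_(i <- r) F i n) @ \oo --> 0.
Proof.
move=> F0 cF; elim: r => [|i r IH].
  by under eq_fun do rewrite big_nil; exact: cvg_cst.
under eq_fun do rewrite big_cons.
apply: (@cvge0_lin (F i) (fun n => \sum_(i <- r) F i n) _ 1 1) => // n.
  by apply: adde_ge0 => //; exact: sume_ge0.
by rewrite !mul1e.
Qed.

Lemma lee_cvg0 (x y : \bar R) u : 0 <= y -> (forall n, x <= u n + y) -> u @ \oo --> 0 -> x <= y.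
Proof.
move=> y0 xu u0.
have cy : (fun n => u n + y) @ \oo --> 0 + y by apply: cvgeD => //; exact: cvg_cst.
rewrite add0e in cy; apply: (cvge_ge _ cy); exact: nearW.
Qed.

End ereal_limits.

(** * The complex integral and the L^2 pairing *)

Section complex_integral.
Context {R : realType}.
Variable D : set (T3 R).
Hypothesis mD : measurable D.
Implicit Types (f g F G : R * R * R -> R[i]).
Local Open Scope complex_scope.

Lemma inL2P f : inL2 D f <-> cmeas (D : set (T3 R)) (f : T3 R -> R[i]) /\ (csq (@leb3 R) D f < +oo)%E.
Proof. by split => [[? ? ?]|[[? ?] ?]]. Qed.

Lemma inL2_cmeas f : inL2 D f -> cmeas (D : set (T3 R)) (f : T3 R -> R[i]).
Proof. by move=> /inL2P[]. Qed.

Lemma inL2_lin c f g : inL2 D f -> inL2 D g -> inL2 D (fun x => c * f x + g x).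
Proof.
move=> /inL2P[mf ff] /inL2P[mg gg]; apply/inL2P; split; first exact: cmeas_lin.
exact: csq_lin_fin.
Qed.

Lemma inL2_0 : inL2 D (fun=> 0).
Proof. by apply/inL2P; split; [exact: cmeas_cst|rewrite csq0 ltry]. Qed.

Lemma inL2Z c f : inL2 D f -> inL2 D (fun x => c * f x).
Proof.
by move=> Hf; have := inL2_lin c Hf inL2_0; under [X in inL2 _ X -> _]eq_fun do rewrite addr0.
Qed.

Lemma inL2_conj f : inL2 D f -> inL2 D (fun x => conjc (f x)).
Proof.
move=> /inL2P[mf ff]; apply/inL2P; split; first exact: cmeasJ.
rewrite (_ : csq _ _ _ = csq (@leb3 R) D f)//; apply: eq_integral => x _.
by rewrite /sqmod cReJ cImJ sqrrN.
Qed.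

Definition cintable F := (@leb3 R).-integrable D (EFin \o (fun x => complex.Re (F x))) /\
  (@leb3 R).-integrable D (EFin \o (fun x => complex.Im (F x))).

Lemma cintable_dom F (k : T3 R -> \bar R) : cmeas (D : set (T3 R)) (F : T3 R -> R[i]) ->
  measurable_fun D k -> (forall x, 0 <= k x)%E -> (\int[leb3]_(x in D) k x < +oo)%E ->
  (forall x, D x -> ((`|complex.Re (F x)|)%:E <= k x)%E /\ ((`|complex.Im (F x)|)%:E <= k x)%E) ->
  cintable F.
Proof.
move=> [mR mI] mk k0 ki H.
have ik : (@leb3 R).-integrable D k.
  by apply/integrableP; split => //; under eq_integral do rewrite gee0_abs//.
split; apply: (le_integrable mD _ _ ik).
- exact/measurable_EFinP.
- by move=> x /H[h _]; rewrite (gee0_abs (k0 x)).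
- exact/measurable_EFinP.
- by move=> x /H[_ h]; rewrite (gee0_abs (k0 x)).
Qed.

Lemma cintable_mul f g : inL2 D f -> inL2 D g -> cintable (fun x => f x * g x).
Proof.
move=> /inL2P[mf ff] /inL2P[mg gg].
have mk : measurable_fun D (fun x => (sqmod (f x))%:E + (sqmod (g x))%:E)%E.
  by apply: emeasurable_funD; exact: measurable_sqmod.
apply: (cintable_dom (cmeasM mf mg) mk).
- by move=> x; rewrite -EFinD lee_fin addr_ge0 ?sqmod_ge0.
- rewrite ge0_integralD//; [exact: lte_add_pinfty| | | |].
  + by move=> x _; rewrite lee_fin sqmod_ge0.
  + exact: measurable_sqmod.
  + by move=> x _; rewrite lee_fin sqmod_ge0.
  + exact: measurable_sqmod.
move=> x _; rewrite -EFinD !lee_fin !cpartE /sqmod.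
move: (f x) (g x) => [a b] [p q] /=; rewrite !ler_norml.
(* All sign patterns of [2 |s t| <= s^2 + t^2] needed to dominate both parts of the product by the
   two squared moduli. *)
have := sqr_ge0 (a + p); have := sqr_ge0 (b + q); have := sqr_ge0 (a + q); have := sqr_ge0 (b + p).
have := sqr_ge0 (a - p); have := sqr_ge0 (b - q); have := sqr_ge0 (a - q); have := sqr_ge0 (b - p).
by move=> *; split; apply/andP; split; nra.
Qed.

Lemma cintable_inner f g : inL2 D f -> inL2 D g -> cintable (fun x => f x * conjc (g x)).
Proof. by move=> Hf Hg; apply: cintable_mul => //; exact: inL2_conj. Qed.

Lemma cint_lin c F G : cintable F -> cintable G ->
  cint D (fun x => c * F x + G x) = c * cint D F + cint D G.
Proof.
move=> [FR FI] [GR GI].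
have lin (a b : R) (f1 f2 f3 : R * R * R -> R) : (@leb3 R).-integrable D (EFin \o f1) ->
    (@leb3 R).-integrable D (EFin \o f2) -> (@leb3 R).-integrable D (EFin \o f3) ->
    Rintegral leb3 D (fun x => a * f1 x + b * f2 x + f3 x) =
    a * Rintegral leb3 D f1 + b * Rintegral leb3 D f2 + Rintegral leb3 D f3.
  move=> i1 i2 i3.
  have j1 : (@leb3 R).-integrable D (EFin \o (fun x => a * f1 x)).
    by have := integrableZl mD a i1; apply: eq_integrable => // x _; rewrite /= EFinM.
  have j2 : (@leb3 R).-integrable D (EFin \o (fun x => b * f2 x)).
    by have := integrableZl mD b i2; apply: eq_integrable => // x _; rewrite /= EFinM.
  have j12 : (@leb3 R).-integrable D (EFin \o (fun x => a * f1 x + b * f2 x)).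
    by have := integrableD mD j1 j2; apply: eq_integrable => // x _; rewrite /= EFinD.
  rewrite RintegralD// RintegralD// RintegralZl// RintegralZl//.
apply: c_ext; rewrite !cpartE /cint /=.
  under eq_Rintegral do rewrite !cpartE -mulNr.
  by rewrite lin// mulNr.
under eq_Rintegral do rewrite !cpartE.
by rewrite lin.
Qed.

Lemma cint0 : cint D (fun=> 0) = 0.
Proof. by apply: c_ext; rewrite /cint /= Rintegral_cst// mul0r. Qed.

Lemma cintZ c F : cintable F -> cint D (fun x => c * F x) = c * cint D F.
Proof.
move=> iF; have i0 : cintable (fun=> 0).
  by split; apply: (@eq_integrable _ _ _ _ _ mD (cst 0%E)) => //; exact: integrable0.
by rewrite -[RHS]addr0 -cint0 -cint_lin//; congr cint; apply/funext => x; rewrite addr0.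
Qed.

Lemma cint_eq F G : (forall x, D x -> F x = G x) -> cint D F = cint D G.
Proof.
by move=> FG; congr (_ +i* _); apply: eq_Rintegral => x; rewrite inE => /FG ->.
Qed.

Lemma inner_linl c f f' g : inL2 D f -> inL2 D f' -> inL2 D g ->
  inner D (fun x => c * f x + f' x) g = c * inner D f g + inner D f' g.
Proof.
move=> Hf Hf' Hg; rewrite /inner -cint_lin; [|exact: cintable_inner..].
by apply: cint_eq => x _; ring.
Qed.

Lemma innerZl c f g : inL2 D f -> inL2 D g ->
  inner D (fun x => c * f x) g = c * inner D f g.
Proof.
move=> Hf Hg; rewrite /inner -cintZ; last exact: cintable_inner.
by apply: cint_eq => x _; rewrite mulrA.
Qed.

Lemma inner_conj f g : inL2 D f -> inL2 D g -> inner D g f = conjc (inner D f g).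
Proof.
move=> Hf Hg; have [iR iI] := cintable_inner Hf Hg.
apply: c_ext; rewrite ?cReJ ?cImJ /inner /cint /=.
  by apply: eq_Rintegral => x _; rewrite !cpartE; ring.
rewrite -mulN1r -RintegralZl//; apply: eq_Rintegral => x _.
by rewrite !cpartE; ring.
Qed.

Lemma inLoo_mul (a : R * R * R -> R) f : inLoo D a -> inL2 D f -> inL2 D (fun x => (a x)%:C * f x).
Proof.
move=> [ma [M HM]] /inL2P[mf ff]; have mac : cmeas (D : set (T3 R)) (fun x : T3 R => (a x)%:C).
  by split => //; exact: measurable_cst.
apply/inL2P; split; first exact: cmeasM.
apply: (@le_lt_trans _ _ ((M ^+ 2)%:E * csq (@leb3 R) D f)%E); last first.
  by apply: lte_mul_pinfty => //; rewrite lee_fin sqr_ge0.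
have s0 (h : T3 R -> R[i]) (x : T3 R) : (0 <= (sqmod (h x))%:E)%E by rewrite lee_fin sqmod_ge0.
rewrite /csq -ge0_integralZl_EFin//; [|exact: measurable_sqmod|exact: sqr_ge0].
apply: ae_ge0_le_integral => //.
- by move=> x _; rewrite lee_fin sqmod_ge0.
- by apply: measurable_sqmod; exact: cmeasM.
- by move=> x _; rewrite mule_ge0// lee_fin sqr_ge0.
- by apply: emeasurable_funM; [exact: measurable_cst|exact: measurable_sqmod].
apply: ae_imp HM => x h /h aM; rewrite -EFinM lee_fin sqmodM.
apply: ler_wpM2r; first exact: sqmod_ge0.
rewrite /sqmod /= expr0n addr0 -real_normK ?num_real//.
by rewrite lerXn2r// ?nnegrE//; apply: le_trans aM.
Qed.

End complex_integral.

(** * Smooth functions, compact supports and integration by parts *)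

Section smooth_functions.
Context {R : realType}.
Implicit Types (E : set (R * R * R)) (f g : R * R * R -> R).

Lemma pds_lin E n (a b : R) f g : open E -> classC n E f -> classC n E g ->
  forall s, (size s <= n)%N -> forall x, E x ->
  pds s (fun y => a * f y + b * g y) x = a * pds s f x + b * pds s g x.
Proof.
move=> oE Cf Cg; elim=> [//|i s IH] /= sn x Ex.
have [_ df] := Cf s (ltnW sn) x Ex; have [_ dg] := Cg s (ltnW sn) x Ex.
have Df := DeriveDef (df sn i) erefl; have Dg := DeriveDef (dg sn i) erefl.
rewrite {1}/pd (@near_eq_derive _ _ _ _ (fun y => a * pds s f y + b * pds s g y)).
  have H := is_deriveD (is_deriveZ a Df) (is_deriveZ b Dg).
  exact: (@derive_val _ _ _ _ _ _ _ H).
have nE : nbhs x E by apply: open_nbhs_nbhs.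
by apply: filterS nE => y Ey; apply: IH => //; exact: ltnW.
Qed.

Lemma classC_lin E n (a b : R) f g : open E -> classC n E f -> classC n E g ->
  classC n E (fun y => a * f y + b * g y).
Proof.
move=> oE Cf Cg s sn x Ex.
have nE : nbhs x E by apply: open_nbhs_nbhs.
have ne : \forall y \near x, (fun y => a * pds s f y + b * pds s g y) y =
    pds s (fun y => a * f y + b * g y) y.
  by apply: filterS nE => y Ey; rewrite (pds_lin a b oE Cf Cg).
have [cf df] := Cf s sn x Ex; have [cg dg] := Cg s sn x Ex.
split.
  rewrite /prop_for /continuous_at (pds_lin a b oE Cf Cg sn Ex).
  apply: cvg_trans; first exact: (near_eq_cvg ne).
  by apply: cvgD; apply: cvgM => //; exact: cvg_cst.
move=> sn' i; apply: (near_eq_derivable ne).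
have Df := DeriveDef (df sn' i) erefl; have Dg := DeriveDef (dg sn' i) erefl.
have H := is_deriveD (is_deriveZ a Df) (is_deriveZ b Dg).
exact: (@ex_derive _ _ _ _ _ _ _ H).
Qed.

Lemma test_fun_C1 E f : test_fun E f -> C1 f.
Proof. by move=> [H _ _]; exact: H. Qed.

Lemma test_fun_lin E (a b : R) f g : test_fun E f -> test_fun E g ->
  test_fun E (fun y => a * f y + b * g y).
Proof.
move=> [Cf cf sf] [Cg cg sg].
have sub : closure [set x | a * f x + b * g x != 0] `<=`
    closure [set x | f x != 0] `|` closure [set x | g x != 0].
  rewrite -closureU; apply: closure_subset => x /=.
  have [->|fx] := eqVneq (f x) 0; last by left.
  by have [->|gx] := eqVneq (g x) 0; [rewrite !mulr0 addr0 eqxx|right].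
split.
- by move=> n; apply: classC_lin => //; exact: openT.
- by apply: (subclosed_compact _ (compactU cf cg) sub); exact: closed_closure.
- by move=> x /sub[/sf|/sg].
Qed.

Lemma pd_eq0 f i x : ~ closure [set x | f x != 0] x -> pd i f x = 0.
Proof.
move=> nx; rewrite /pd (@near_eq_derive _ _ _ _ (cst 0)) ?derive_cst//.
have : nbhs x (~` closure [set x | f x != 0]).
  by apply: open_nbhs_nbhs; split => //; apply: closed_openC; exact: closed_closure.
apply: filterS => y ny /=; apply: contrapT => /eqP fy; apply: ny.
exact: subset_closure.
Qed.

Definition box (M : R) : set (R * R * R) :=
  ([set` `[(- M), M]] `*` [set` `[(- M), M]]) `*` [set` `[(- M), M]].

Lemma boxP M x : box M x <-> [/\ `|x.1.1| <= M, `|x.1.2| <= M & `|x.2| <= M].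
Proof.
rewrite /box /= !in_itv /= !ler_norml; split => [[[-> ->] ->]//|[-> -> ->]//].
Qed.

Lemma box_compact M : compact (box M).
Proof.
by apply: compact_setX; [apply: compact_setX|]; exact: segment_compact.
Qed.

Lemma compact_box (K : set (R * R * R)) : compact K -> exists2 M, 0 < M & K `<=` box M.
Proof.
move=> /compact_bounded bK; have [M [M0 HM]] := bounded_coords bK.
by exists M => // x /HM ?; apply/boxP.
Qed.

Lemma measurable_box M : measurable (box M : set (T3 R)).
Proof.
by apply: measurableX; [apply: measurableX|]; exact: measurable_itv.
Qed.

Lemma compact_support_integrable (f : R * R * R -> R) M (D : set (T3 R)) : measurable D ->
  continuous f -> 0 < M -> (forall x, ~ box M x -> f x = 0) ->
  (@leb3 R).-integrable D (EFin \o f).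
Proof.
move=> mD cf M0 f0.
have cfK : compact (f @` box M).
  by apply: continuous_compact; [exact: continuous_subspaceT|exact: box_compact].
have [B [_ HB]] := compact_bounded cfK.
pose b := `|B| + 1.
have fb x : box M x -> `|f x| <= b.
  by move=> bx; apply: HB; [rewrite /b; have := ler_norm B; lra|exists x].
have b0 : 0 <= b by rewrite /b addr_ge0.
have bk : (@leb3 R (box M) < +oo)%E.
  by rewrite /box (@leb3_box _ (- M) M) ?ltry//; [lra|by right].
have ik : (@leb3 R).-integrable D (fun x => (b%:E * (\1_(box M) x)%:E)%E).
  apply/integrableP; split.
    apply: emeasurable_funM; first exact: measurable_cst.
    by apply/measurable_EFinP; apply: measurable_indic; exact: measurable_box.
  under eq_integral do rewrite gee0_abs ?mule_ge0 ?lee_fin//.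
  rewrite ge0_integralZl//; last first.
    by apply/measurable_EFinP; apply: measurable_indic; exact: measurable_box.
  apply: lte_mul_pinfty => //; rewrite integral_indic//; last exact: measurable_box.
  apply: le_lt_trans bk; apply: le_measure; rewrite ?inE; [|exact: measurable_box|by move=> x []].
  by apply: measurableI => //; exact: measurable_box.
apply: (le_integrable mD _ _ ik).
  by apply/measurable_EFinP; apply: measurable_funTS; exact: continuous_measurable3.
move=> x _; rewrite -EFinM /= lee_fin [leRHS]ger0_norm ?mulr_ge0// indicE.
have [bx|nbx] := pselect (box M x); first by rewrite mem_set// mulr1 fb.
by rewrite f0// normr0 mulr_ge0.
Qed.

Definition pospart (f : R * R * R -> R) x := (f x + `|f x|) / 2.

Lemma pospartE f x : Num.max (f x) 0 = pospart f x.
Proof.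
rewrite /pospart; have [f0|f0] := leP (f x) 0; first by rewrite ler0_norm//; lra.
by rewrite gtr0_norm//; lra.
Qed.

Section integration_by_parts.
Local Notation mu := (@lebesgue_measure R).
Variables (F F' : R * R * R -> R) (i : 'I_3) (M : R).
Hypothesis dF : forall x, is_derive x (basis3 R i) F (F' x).
Hypotheses (cF : continuous F) (cF' : continuous F').
Hypothesis M0 : 0 < M.
Hypothesis F0 : forall x, ~ box M x -> F x = 0 /\ F' x = 0.
Let e : T3 R := basis3 R i.
Local Open Scope ereal_scope.

Let pos := pospart.

Let pos_continuous f : continuous f -> continuous (pos f).
Proof.
move=> cf x; apply: cvgM; last exact: cvg_cst.
by apply: cvgD; [exact: cf|apply: cvg_norm; exact: cf].
Qed.

Let pos_ge0 f x : (0 <= pos f x)%R. Proof. by rewrite /pos -pospartE le_max lexx orbT. Qed.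

Let mE (f : R * R * R -> R) (B : set (T3 R)) : continuous f -> measurable_fun B (fun x => (f x)%:E).
Proof.
by move=> cf; apply/measurable_EFinP; apply: measurable_funTS; exact: continuous_measurable3.
Qed.

Let pos_fin f : continuous f -> (forall x, ~ box M x -> f x = 0%R) ->
  \int[leb3]_x (pos f x)%:E \is a fin_num.
Proof.
move=> cf f0; rewrite ge0_fin_numE; last by apply: integral_ge0 => x _; rewrite lee_fin.
have /integrableP[_] : (@leb3 R).-integrable setT (EFin \o pos f).
  apply: (@compact_support_integrable (pos f) M) => //; first exact: pos_continuous.
  by move=> x /f0 fx; rewrite /pos -pospartE fx maxxx.
by under eq_integral do rewrite gee0_abs ?lee_fin//.
Qed.

Let cN f : continuous f -> continuous (fun x => - f x)%R.
Proof. by move=> cf x; apply: cvgN; exact: cf. Qed.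

Let line_continuous (x : T3 R) : continuous (fun s : R => x + s *: e : R * R * R)%R.
Proof. by move=> s; apply: cvgD; [exact: cvg_cst|exact: cvgZl]. Qed.

Let sweep f : continuous f -> (forall x, 0 <= f x)%R ->
  measurable_fun setT (fun x : T3 R => \int[mu]_(s in `[0%R, 1%R]) (f (x + s *: e)%R)%:E) /\
  \int[leb3]_x \int[mu]_(s in `[0%R, 1%R]) (f (x + s *: e)%R)%:E = \int[leb3]_x (f x)%:E.
Proof.
move=> cf f0.
have mI : measurable (`[0%R, 1%R] : set (measurableTypeR R)) by exact: measurable_itv.
have mF2 : measurable_fun [set: (T3 R * measurableTypeR R)%type]
    (fun p => (f (p.1 + (p.2 : R) *: e)%R)%:E).
  exact: (measurableT_comp (@mE _ setT cf) (measurable_shift_line e)).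
have f0' (p : T3 R * measurableTypeR R) : 0 <= (f (p.1 + (p.2 : R) *: e)%R)%:E by rewrite lee_fin.
have [m1 ->] := tonelli_set (@leb3 R) mu measurableT mI mF2 f0'.
split => //.
have E s : \int[leb3]_x (f (x + (s : R) *: e)%R)%:E = \int[leb3]_x (f x)%:E.
  apply: (@ge0_integral_shift3 _ (s *: e)%R (fun x => (f x)%:E)); first exact: mE.
  by move=> x; rewrite lee_fin.
transitivity (\int[mu]_(s in `[0%R, 1%R]) (\int[leb3]_x (f x)%:E)).
  by apply: eq_integral => s _; exact: E.
have l1 : mu (`[0%R, 1%R] : set (measurableTypeR R)) = 1%:E.
  by rewrite lebesgue_measure_itv/= lte_fin ltr01 sube0.
by rewrite -[RHS]mule1 -l1; exact: integral_cst.
Qed.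

(** The fundamental theorem on a unit segment, with every negative term moved across, so that both
    sides can be integrated over the whole space by Tonelli alone. *)
Let slice x : \int[mu]_(s in `[0%R, 1%R]) (pos F' (x + s *: e)%R)%:E + ((pos F x)%:E + (pos (fun y => - F y)%R (x + e)%R)%:E) <=
  \int[mu]_(s in `[0%R, 1%R]) (pos (fun y => - F' y)%R (x + s *: e)%R)%:E + ((pos (fun y => - F y)%R x)%:E + (pos F (x + e)%R)%:E).
Proof.
have dl (s : R) : is_derive s 1%R (fun t : R => F (x + t *: e))%R (F' (x + s *: e))%R.
  have dx y : derivable F y e by exact: (@ex_derive _ _ _ _ _ _ _ (dF y)).
  have := is_derive_line x s dx; rewrite (@derive_val _ _ _ _ _ _ _ (dF _)).
  by under eq_fun do rewrite addrC; rewrite [(s *: e + x)%R]addrC.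
have cc f : continuous f -> continuous (fun s : R => f (x + s *: e))%R.
  move=> cf s; apply: (@continuous_comp _ _ _ (fun s : R => x + s *: e : R * R * R)%R f).
    exact: line_continuous.
  exact: cf.
have posd f y : (pos f y - pos (fun y => - f y) y = f y)%R.
  by rewrite /pos /pospart normrN; lra.
have := FTC_le ler01 dl (cc _ cF') (cc _ (pos_continuous cF')) (cc _ (pos_continuous (cN cF'))).
rewrite scale0r addr0 scale1r.
have hyp : {in `[0%R, 1%R], forall s : R, (pos F' (x + s *: e) <=
    F' (x + s *: e) + pos (fun y => - F' y) (x + s *: e))%R}.
  by move=> s _ /=; have := posd F' (x + s *: e)%R; lra.
move=> /(_ hyp) H.
apply: le_trans (leeD2r _ H) _.
rewrite (addeC (F (x + e) - F x)%:E) -addeA; apply: leeD2l.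
rewrite -!EFinD lee_fin; have := posd F x; have := posd F (x + e)%R; lra.
Qed.

(** After integration in [x] translation invariance removes the shift by [e]; the integrals of the
    parts of [F] are then equal on both sides and, being finite by compact support, cancel. *)
Lemma pos_part_le : \int[leb3]_x (pos F' x)%:E <= \int[leb3]_x (pos (fun y => - F' y)%R x)%:E.
Proof.
have [m1 E1] := sweep (pos_continuous cF') (pos_ge0 F').
have [m2 E2] := sweep (pos_continuous (cN cF')) (pos_ge0 (fun y => - F' y)%R).
pose Fp := pos F; pose Fm := pos (fun y => - F y)%R.
have cFp : continuous Fp by exact: pos_continuous.
have cFm : continuous Fm by apply: pos_continuous; exact: cN.
have fp : \int[leb3]_x (Fp x)%:E \is a fin_num by apply: pos_fin => // x /F0[].
have fm : \int[leb3]_x (Fm x)%:E \is a fin_num.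
  by apply: pos_fin; [exact: cN|move=> x /F0[-> _]; rewrite oppr0].
have sh f : continuous f -> (forall x, 0 <= f x)%R -> \int[leb3]_x (f (x + e)%R)%:E = \int[leb3]_x (f x)%:E.
  move=> cf f0; apply: (@ge0_integral_shift3 _ e (fun x => (f x)%:E)); first exact: mE.
  by move=> x; rewrite lee_fin.
have msh f : continuous f -> measurable_fun setT (fun x : T3 R => (f (x + e)%R)%:E).
  by move=> cf; exact: (measurableT_comp (@mE _ setT cf) (measurable_shift3 e)).
have Fp0 x : 0 <= (Fp x)%:E by rewrite lee_fin; exact: pos_ge0.
have Fm0 x : 0 <= (Fm x)%:E by rewrite lee_fin; exact: pos_ge0.
have i0 f x : (forall y, 0 <= f y)%R -> 0 <= \int[mu]_(s in `[0%R, 1%R]) (f (x + s *: e)%R)%:E.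
  by move=> f0; apply: integral_ge0 => s _; rewrite lee_fin.
have mA : measurable_fun setT (fun x : T3 R => (Fp x)%:E + (Fm (x + e)%R)%:E).
  by apply: emeasurable_funD; [exact: mE|exact: msh].
have mB : measurable_fun setT (fun x : T3 R => (Fm x)%:E + (Fp (x + e)%R)%:E).
  by apply: emeasurable_funD; [exact: mE|exact: msh].
have A0 x : 0 <= (Fp x)%:E + (Fm (x + e)%R)%:E by rewrite adde_ge0.
have B0 x : 0 <= (Fm x)%:E + (Fp (x + e)%R)%:E by rewrite adde_ge0.
have main : \int[leb3]_x (\int[mu]_(s in `[0%R, 1%R]) (pos F' (x + s *: e)%R)%:E +
      ((Fp x)%:E + (Fm (x + e)%R)%:E)) <=
    \int[leb3]_x (\int[mu]_(s in `[0%R, 1%R]) (pos (fun y => - F' y)%R (x + s *: e)%R)%:E +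
      ((Fm x)%:E + (Fp (x + e)%R)%:E)).
  apply: ge0_le_integral => //.
  - by move=> x _; apply: adde_ge0 => //; apply: i0; exact: pos_ge0.
  - exact: emeasurable_funD.
  - exact: emeasurable_funD.
have j1 (x : T3 R) : [set: T3 R] x ->
    0 <= \int[mu]_(s in `[0%R, 1%R]) (pos F' (x + s *: e)%R)%:E.
  by move=> _; apply: i0; exact: pos_ge0.
have j2 (x : T3 R) : [set: T3 R] x ->
    0 <= \int[mu]_(s in `[0%R, 1%R]) (pos (fun y => - F' y)%R (x + s *: e)%R)%:E.
  by move=> _; apply: i0; exact: pos_ge0.
have k1 (x : T3 R) : [set: T3 R] x -> 0 <= (Fp x)%:E by [].
have k2 (x : T3 R) : [set: T3 R] x -> 0 <= (Fm x)%:E by [].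
have k3 (x : T3 R) : [set: T3 R] x -> 0 <= (Fp (x + e)%R)%:E by [].
have k4 (x : T3 R) : [set: T3 R] x -> 0 <= (Fm (x + e)%R)%:E by [].
have l1 (x : T3 R) : [set: T3 R] x -> 0 <= (Fp x)%:E + (Fm (x + e)%R)%:E by [].
have l2 (x : T3 R) : [set: T3 R] x -> 0 <= (Fm x)%:E + (Fp (x + e)%R)%:E by [].
move: main; rewrite (ge0_integralD _ measurableT j1 m1 l1 mA) (ge0_integralD _ measurableT j2 m2 l2 mB).
rewrite (ge0_integralD _ measurableT k1 (@mE _ setT cFp) k4 (msh _ cFm)).
rewrite (ge0_integralD _ measurableT k2 (@mE _ setT cFm) k3 (msh _ cFp)).
rewrite E1 E2 (sh _ cFp (pos_ge0 F)) (sh _ cFm (pos_ge0 _)).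
rewrite (addeC (\int[leb3]_x (Fm x)%:E)) leeD2rE//.
by rewrite fin_numD fp fm.
Qed.

End integration_by_parts.

Local Open Scope ereal_scope.

(** [pos_part_le] for [F] and for [- F] makes the integrals of the positive and negative parts of
    [F'] equal. *)
Lemma integral_derivative0 (F F' : R * R * R -> R) (i : 'I_3) (M : R) :
  (forall x, is_derive x (basis3 R i) F (F' x)) -> continuous F -> continuous F' ->
  (0 < M)%R -> (forall x, ~ box M x -> F x = 0%R /\ F' x = 0%R) ->
  Rintegral leb3 setT F' = 0%R.
Proof.
move=> dF cF cF' M0 F0.
have P1 := pos_part_le dF cF cF' M0 F0.
have P2 : \int[leb3]_x (pospart (fun y => - F' y)%R x)%:E <= \int[leb3]_x (pospart F' x)%:E.
  have dN x := is_deriveN (dF x).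
  have cN f : continuous f -> continuous (fun x : R * R * R => - f x : R)%R.
    by move=> cf x; apply: cvgN; exact: cf.
  have N0 (x : R * R * R) : ~ box M x -> (- F x)%R = 0%R /\ (- F' x)%R = 0%R.
    by move=> /F0[-> ->]; rewrite oppr0.
  have := pos_part_le dN (cN _ cF) (cN _ cF') M0 N0.
  by rewrite (_ : pospart (fun y => - - F' y)%R = pospart F')//; apply/funext => x; rewrite /pospart opprK.
rewrite /Rintegral integralE.
rewrite (_ : \int[leb3]_x _^\+ x = \int[leb3]_x (pospart F' x)%:E); last first.
  by apply: eq_integral => x _; rewrite funeposE /= -EFin_max pospartE.
rewrite (_ : \int[leb3]_x _^\- x = \int[leb3]_x (pospart (fun y => - F' y)%R x)%:E); last first.
  by apply: eq_integral => x _; rewrite funenegE /= -EFin_max -pospartE.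
have E : \int[leb3]_x (pospart (fun y => - F' y)%R x)%:E = \int[leb3]_x (pospart F' x)%:E.
  by apply/eqP; rewrite eq_le P1 P2.
rewrite E; set I := \int[leb3]_x _; have [If|] := boolP (I \is a fin_num); first by rewrite subee.
by rewrite fin_numE negb_and !negbK => /orP[/eqP ->|/eqP ->].
Qed.

End smooth_functions.

(** * Complex test functions and their weak derivatives *)

Section complex_smooth.
Context {R : realType}.
Implicit Types (E : set (R * R * R)) (phi psi : R * R * R -> R[i]).
Local Open Scope complex_scope.

Definition cC n E phi := classC n E (fun x => complex.Re (phi x)) /\
  classC n E (fun x => complex.Im (phi x)).

Let ReE (c : R[i]) phi psi : (fun y => complex.Re (c * phi y + psi y)) =
  (fun y => 1 * (complex.Re c * complex.Re (phi y) + - complex.Im c * complex.Im (phi y))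
    + 1 * complex.Re (psi y)).
Proof. by apply/funext => y; rewrite !cpartE; ring. Qed.

Let ImE (c : R[i]) phi psi : (fun y => complex.Im (c * phi y + psi y)) =
  (fun y => 1 * (complex.Re c * complex.Im (phi y) + complex.Im c * complex.Re (phi y))
    + 1 * complex.Im (psi y)).
Proof. by apply/funext => y; rewrite !cpartE; ring. Qed.

Lemma cC_lin n E c phi psi : open E -> cC n E phi -> cC n E psi ->
  cC n E (fun x => c * phi x + psi x).
Proof.
move=> oE [a b] [a' b']; split; [rewrite ReE|rewrite ImE];
  apply: (classC_lin 1 1 oE) => //; exact: (classC_lin _ _ oE).
Qed.

Lemma cpd_lin n E c phi psi i x : open E -> (0 < n)%N -> cC n E phi -> cC n E psi -> E x ->
  cpd i (fun x => c * phi x + psi x) x = c * cpd i phi x + cpd i psi x.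
Proof.
move=> oE n0 [a b] [a' b'] Ex.
have l (s t : R) f g : classC n E f -> classC n E g ->
    pd i (fun y => s * f y + t * g y) x = s * pd i f x + t * pd i g x.
  by move=> cf cg; exact: (pds_lin s t oE cf cg (s := [:: i])).
apply: c_ext; rewrite !cpartE /cpd /=; [rewrite ReE|rewrite ImE];
  rewrite (l 1 1 _ _ (classC_lin _ _ oE _ _))//; rewrite (l _ _ _ _ _ _)//; ring.
Qed.

Lemma ctest_lin E c phi psi : ctest_fun E phi -> ctest_fun E psi ->
  ctest_fun E (fun x => c * phi x + psi x).
Proof.
move=> [a b] [a' b']; split; rewrite ?ReE ?ImE;
  by apply: test_fun_lin => //; exact: test_fun_lin.
Qed.

Lemma ctest_cC n E phi : ctest_fun E phi -> cC n setT phi.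
Proof. by move=> [[H _ _] [H' _ _]]; split; [exact: H|exact: H']. Qed.

Lemma ctest_C1 E phi : ctest_fun E phi ->
  C1 (fun x => complex.Re (phi x)) /\ C1 (fun x => complex.Im (phi x)).
Proof. by move=> /(@ctest_cC 1)[]. Qed.

Lemma ctest0 E : ctest_fun E (fun=> 0 : R[i]).
Proof.
have H : test_fun E (fun=> 0 : R).
  have p0 s : pds s (fun=> 0 : R) = (fun=> 0).
    elim: s => //= i s ->; apply/funext => x; rewrite /pd.
    exact: derive_cst.
  have s0 : [set x : R * R * R | (0 : R) != 0] = set0.
    by apply/seteqP; split => // x /=; rewrite eqxx.
  split.
  - move=> n s _ x _; rewrite p0; split; first exact: cvg_cst.
    by move=> _ i; exact: derivable_cst.
  - by rewrite s0 closure0; exact: compact0.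
  - by rewrite s0 closure0.
by split.
Qed.

Lemma test_support (f : R * R * R -> R) E : test_fun E f -> exists2 M, 0 < M &
  forall x, ~ box M x -> f x = 0 /\ forall i, pd i f x = 0.
Proof.
move=> [_ cf _]; have [M M0 HM] := compact_box cf; exists M => // x nb.
have nx : ~ closure [set x | f x != 0] x by move=> /HM.
split; last by move=> i; exact: pd_eq0.
by apply: contrapT => /eqP fx; apply: nx; exact: subset_closure.
Qed.

Lemma csq_continuous (D : set (T3 R)) (f : R * R * R -> R[i]) M : measurable D -> 0 < M ->
  continuous (fun x => complex.Re (f x)) -> continuous (fun x => complex.Im (f x)) ->
  (forall x, ~ box M x -> f x = 0) -> inL2 D f.
Proof.
move=> mD M0 cR cI f0; apply/inL2P; split.
  by split; apply: measurable_funTS; exact: continuous_measurable3.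
have cs : continuous (fun x => sqmod (f x)).
  by move=> x; apply: cvgD; apply: cvgM; (exact: cR || exact: cI).
have s0 (x : R * R * R) : ~ box M x -> sqmod (f x) = 0 by move=> /f0 ->; rewrite sqmod0.
have /integrableP[_] := compact_support_integrable mD cs M0 s0.
by under eq_integral do rewrite gee0_abs ?lee_fin ?sqmod_ge0//.
Qed.

Lemma ctest_inL2 (D : set (T3 R)) E phi : measurable D -> ctest_fun E phi ->
  inL2 D phi /\ forall i, inL2 D (cpd i phi).
Proof.
move=> mD cphi; have [C1r C1i] := ctest_C1 cphi.
have [[M1 M10 H1] [M2 M20 H2]] := (test_support cphi.1, test_support cphi.2).
pose M := Num.max M1 M2.
have bM x : ~ box M x -> ~ box M1 x /\ ~ box M2 x.
  move=> nb; split => /boxP[a b c]; apply: nb; apply/boxP;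
    by split; rewrite le_max ?a ?b ?c// orbT.
have M0 : 0 < M by rewrite lt_max M10.
split.
  apply: (csq_continuous mD M0); [exact: C1_continuous|exact: C1_continuous|].
  by move=> x /bM[/H1[a _] /H2[b _]]; apply: c_ext.
move=> i; apply: (csq_continuous mD M0).
- exact: (@C1_pd_continuous R _ C1r i).
- exact: (@C1_pd_continuous R _ C1i i).
- by move=> x /bM[/H1[_ a] /H2[_ b]]; apply: c_ext; [exact: a|exact: b].
Qed.

(** The derivative of the product vanishes off [Omega], because the closed support of [eta] lies
    inside; the integral over [Omega] is therefore one over the whole space. *)
Lemma rint_by_parts (Omega : set (R * R * R)) (phi eta : R * R * R -> R) i : open Omega ->
  C1 phi -> test_fun Omega eta ->
  Rintegral leb3 Omega (fun x => phi x * pd i eta x) =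
  - Rintegral leb3 Omega (fun x => pd i phi x * eta x).
Proof.
move=> oO Cp te; have mO : measurable (Omega : set (T3 R)) by exact: open_measurable3.
have Ce := test_fun_C1 te; have [M M0 HM] := test_support te.
pose F' x := phi x * pd i eta x + pd i phi x * eta x.
have cp := C1_continuous Cp; have ce := C1_continuous Ce.
have cpp := @C1_pd_continuous R phi Cp i; have cpe := @C1_pd_continuous R eta Ce i.
have c1 : continuous (fun x => phi x * pd i eta x) by move=> x; apply: cvgM; [exact: cp|exact: cpe].
have c2 : continuous (fun x => pd i phi x * eta x) by move=> x; apply: cvgM; [exact: cpp|exact: ce].
have E0 : Rintegral leb3 setT F' = 0.
  apply: (@integral_derivative0 R (fun x => phi x * eta x) F' i M) => //.
  - move=> x; have D1 := DeriveDef (@C1_derivable R phi Cp i x) erefl.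
    have D2 := DeriveDef (@C1_derivable R eta Ce i x) erefl.
    have hd := is_deriveM D1 D2; apply: (is_derive_eq hd).
    by rewrite /GRing.scale/= /F' /pd; ring.
  - by move=> x; apply: cvgM; [exact: cp|exact: ce].
  - by move=> x; apply: cvgD; [exact: c1|exact: c2].
  - by move=> x /HM[e0 p0]; rewrite /F' e0 p0 !mulr0 addr0.
have EO : Rintegral leb3 Omega F' = 0.
  rewrite -[RHS]E0 Rintegral_mkcond; congr (Rintegral leb3 setT _); apply/funext => x.
  rewrite patchE; case: ifPn => // nx; apply/esym.
  have [_ _ sub] := te; have nc : ~ closure [set x | eta x != 0] x.
    by move=> /sub; move/negP: nx; rewrite inE.
  rewrite /F' (pd_eq0 i nc) (_ : eta x = 0) ?mulr0 ?addr0//.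
  by apply: contrapT => /eqP ex; apply: nc; exact: subset_closure.
apply/eqP; rewrite -addr_eq0 -RintegralD//; first by apply/eqP.
- by apply: (compact_support_integrable mO c1 M0) => x /HM[_ p0]; rewrite p0 mulr0.
- by apply: (compact_support_integrable mO c2 M0) => x /HM[e0 _]; rewrite e0 mulr0.
Qed.

Lemma ctest_weak (Omega : set (R * R * R)) phi i : open Omega ->
  ctest_fun setT phi -> weak_pd Omega i phi (cpd i phi).
Proof.
move=> oO cphi eta te; have [Cr Ci] := ctest_C1 cphi.
apply: c_ext; rewrite !cpartE /cint /=.
  under eq_Rintegral do rewrite cReM /= mulr0 subr0.
  by rewrite rint_by_parts//; congr (- _); apply: eq_Rintegral => x _; rewrite /= mulr0 subr0.
under eq_Rintegral do rewrite cImM /= mulr0 add0r.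
by rewrite rint_by_parts//; congr (- _); apply: eq_Rintegral => x _; rewrite /= mulr0 add0r.
Qed.

End complex_smooth.

(** * H^1 as a vector space containing the test functions *)

Section sobolev.
Context {R : realType}.
Variable Omega : set (R * R * R).
Hypothesis oO : open Omega.
Local Open Scope complex_scope.

Let mO : measurable (Omega : set (T3 R)). Proof. exact: open_measurable3. Qed.

Definition test_H1 phi (H : ctest_fun setT phi) : H1 Omega :=
  MkH1 (ctest_inL2 mO H).1 (ctest_inL2 mO H).2 (fun i => ctest_weak i oO H).

Lemma weak_pd_lin c i (u u' w w' : R * R * R -> R[i]) :
  inL2 Omega u -> inL2 Omega u' -> inL2 Omega w -> inL2 Omega w' ->
  weak_pd Omega i u w -> weak_pd Omega i u' w' ->
  weak_pd Omega i (fun x => c * u x + u' x) (fun x => c * w x + w' x).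
Proof.
move=> Lu Lu' Lw Lw' H H' f tf; have Cf := test_fun_C1 tf.
have [M M0 HM] := test_support tf.
have Lf : inL2 Omega (fun x => (f x)%:C).
  apply: (csq_continuous mO M0); [exact: C1_continuous|by move=> x; exact: cvg_cst|].
  by move=> x /HM[-> _].
have Lpf : inL2 Omega (fun x => (pd i f x)%:C).
  apply: (csq_continuous mO M0); [exact: C1_pd_continuous|by move=> x; exact: cvg_cst|].
  by move=> x /HM[_ ->].
have dist (z : R * R * R -> R[i]) (a b : R * R * R -> R[i]) :
    cint Omega (fun x => (c * a x + b x) * z x) = cint Omega (fun x => c * (a x * z x) + b x * z x).
  by apply: cint_eq => x _; ring.
rewrite !dist !cint_lin//; try exact: cintable_mul.
by rewrite H// H'//; ring.
Qed.

Definition H1_lin c (u v : H1 Omega) : H1 Omega :=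
  MkH1 (inL2_lin mO c (h1_L2 u) (h1_L2 v))
    (fun i => inL2_lin mO c (h1grad_L2 u i) (h1grad_L2 v i))
    (fun i => weak_pd_lin c (h1_L2 u) (h1_L2 v) (h1grad_L2 u i) (h1grad_L2 v i)
      (h1_weak u i) (h1_weak v i)).

End sobolev.

(** * Linearity of traces, from inside and from outside *)

Section traces.
Context {R : realType}.
Implicit Types (D : set (R * R * R)) (u g : R * R * R -> R[i]).
Implicit Types (G : 'I_3 -> R * R * R -> R[i]).
Local Open Scope complex_scope.

Let s0 (T : Type) (h : T -> R[i]) (x : T) : (0 <= (sqmod (h x))%:E)%E.
Proof. by rewrite lee_fin sqmod_ge0. Qed.

Lemma sqH1_ge0 D u G : (0 <= sqH1 D u G)%E.
Proof.
by apply: adde_ge0; [exact: (csq_ge0 (@leb3 R))|apply: sume_ge0 => i _; exact: (csq_ge0 (@leb3 R))].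
Qed.

Lemma sqH1_eq D u u' G G' : (forall x, D x -> u x = u' x) ->
  (forall i x, D x -> G i x = G' i x) -> sqH1 D u G = sqH1 D u' G'.
Proof.
move=> uu GG; rewrite /sqH1; congr (_ + _)%E; first exact: (@csq_eq _ _ _ (@leb3 R) D _ _ uu).
by apply: eq_bigr => i _; exact: (@csq_eq _ _ _ (@leb3 R) D _ _ (GG i)).
Qed.

Lemma sqH1_lin (D : set (T3 R)) c u u' G G' : measurable D -> cmeas D u -> cmeas D u' ->
  (forall i, cmeas D (G i)) -> (forall i, cmeas D (G' i)) ->
  (sqH1 D (fun x => c * u x + u' x)%R (fun i x => c * G i x + G' i x)%R <=
   (2 * sqmod c)%:E * sqH1 D u G + 2%:E * sqH1 D u' G')%E.
Proof.
move=> mD mu mu' mG mG'; have c0 : 0 <= 2 * sqmod c by rewrite mulr_ge0 ?sqmod_ge0.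
have S0 (H : 'I_3 -> R * R * R -> R[i]) : (0 <= \sum_(i < 3) sqL2 D (H i))%E.
  by apply: sume_ge0 => i _; exact: (csq_ge0 (@leb3 R)).
have q0 f : (0 <= sqL2 D f)%E by exact: (csq_ge0 (@leb3 R)).
rewrite /sqH1 (@ge0_muleDr _ (2 * sqmod c)%:E _ _ (q0 u) (S0 G)) (@ge0_muleDr _ 2%:E _ _ (q0 u') (S0 G')).
rewrite addeACA; apply: leeD; first exact: (csq_lin (@leb3 R) c mD mu mu').
rewrite !ge0_sume_distrr; [|by move=> i _; exact: q0..].
rewrite -big_split /=; apply: lee_sum => i _; exact: (csq_lin (@leb3 R) c mD (mG i) (mG' i)).
Qed.

Definition loc_cmeas D u := forall r : R, cmeas (D `&` eball r : set (T3 R)) (u : T3 R -> R[i]).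

Lemma trace_lin Omega D c u u' G G' g g' : open D ->
  loc_cmeas D u -> loc_cmeas D u' -> (forall i, loc_cmeas D (G i)) ->
  (forall i, loc_cmeas D (G' i)) ->
  trace_from Omega D u G g -> trace_from Omega D u' G' g' ->
  trace_from Omega D (fun x => c * u x + u' x) (fun i x => c * G i x + G' i x)
    (fun x => c * g x + g' x).
Proof.
move=> oD mu mu' mG mG' [Lg [phi [tp cp bp]]] [Lg' [phi' [tp' cp' bp']]].
have md (ch : lip_chart Omega) := @measurable_disk R Omega ch.
have mch (ch : lip_chart Omega) h : inL2_bdry Omega h ->
    cmeas (disk (ch_rad ch) : set (T2 R)) (fun y : T2 R => h (ch_map ch y)).
  by move=> Lh; have [a b _] := Lh ch.
have mtest (ch : lip_chart Omega) f : ctest_fun setT f ->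
    cmeas (disk (ch_rad ch) : set (T2 R)) (fun y : T2 R => f (ch_map ch y)).
  move=> /ctest_C1[a b]; split; apply: measurable_funTS.
    exact: (measurable_ch_map ch (C1_continuous a)).
  exact: (measurable_ch_map ch (C1_continuous b)).
split.
  move=> ch; have [a b] := cmeas_lin c (mch ch _ Lg) (mch ch _ Lg').
  have [[_ _ q] [_ _ q']] := (Lg ch, Lg' ch).
  split; [exact: a|exact: b|].
  exact (csq_lin_fin c (md ch) (mch ch _ Lg) (mch ch _ Lg') q q').
exists (fun n x => c * phi n x + phi' n x); split.
- by move=> n; exact: ctest_lin.
- move=> r; have mDr : measurable (D `&` eball r : set (T3 R)).
    by apply: open_measurable3; apply: openI => //; exact: eball_open.
  have mt f : ctest_fun setT f -> cmeas (D `&` eball r : set (T3 R)) f /\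
      forall i, cmeas (D `&` eball r : set (T3 R)) (cpd i f).
    move=> tf; have [a b] := ctest_inL2 mDr tf.
    by split; [exact: inL2_cmeas a|move=> i; exact: inL2_cmeas (b i)].
  apply: (cvge0_lin (a := 2 * sqmod c) (b := 2) _ _ (cp r) (cp' r)).
    by move=> n; exact: sqH1_ge0.
  move=> n; have [a1 b1] := mt _ (tp n); have [a2 b2] := mt _ (tp' n).
  rewrite (@sqH1_eq _ _ (fun x => c * (phi n x - u x) + (phi' n x - u' x)) _
     (fun i x => c * (cpd i (phi n) x - G i x) + (cpd i (phi' n) x - G' i x))).
  + apply: sqH1_lin => //; [exact: cmeasB (mu r)|exact: cmeasB (mu' r)|move=> i|move=> i].
      exact: cmeasB (b1 i) (mG i r).
    exact: cmeasB (b2 i) (mG' i r).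
  + by move=> x _; ring.
  + move=> i x _; rewrite (@cpd_lin _ 1 setT)//; [ring|exact: openT| |].
      exact: ctest_cC (tp n).
    exact: ctest_cC (tp' n).
- move=> ch; apply: (cvge0_lin (a := 2 * sqmod c) (b := 2) _ _ (bp ch) (bp' ch)).
    by move=> n; exact: (csq_ge0 (@leb2 R)).
  move=> n; rewrite /sqL2_chart.
  rewrite (_ : (\int[leb2]_(y in disk (ch_rad ch)) _)%E =
    csq (@leb2 R) (disk (ch_rad ch)) (fun y : T2 R => c * (phi n (ch_map ch y) - g (ch_map ch y)) +
      (phi' n (ch_map ch y) - g' (ch_map ch y)))); last first.
    by apply: eq_integral => y _; congr (sqmod _)%:E; ring.
  apply: (csq_lin (@leb2 R) c (md ch)); apply: cmeasB.
  + exact: mtest.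
  + exact: mch.
  + exact: mtest.
  + exact: mch.
Qed.

End traces.

(** * The chart inequalities for complex test functions *)

Section real_parts.
Context {R : realType}.
Local Open Scope complex_scope.
Local Open Scope ereal_scope.

Lemma csq_parts d (T : measurableType d) (m : {measure set T -> \bar R}) (D : set T)
    (f : T -> R[i]) : measurable D -> cmeas D f ->
  csq m D f = \int[m]_(x in D) (complex.Re (f x) ^+ 2)%:E + \int[m]_(x in D) (complex.Im (f x) ^+ 2)%:E.
Proof.
move=> mD [mR mI].
have msq (h : T -> R) : measurable_fun D h -> measurable_fun D (fun x => (h x ^+ 2)%:E).
  by move=> mh; apply/measurable_EFinP; exact: measurable_funX.
rewrite -ge0_integralD//; try exact: msq; by move=> x _; rewrite lee_fin sqr_ge0.
Qed.

Lemma csq_le_sub d (T : measurableType d) (m : {measure set T -> \bar R}) (D : set T)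
    (f g : T -> R[i]) : measurable D -> cmeas D f -> cmeas D g ->
  csq m D f <= 2%:E * csq m D (fun x => f x - g x)%R + 2%:E * csq m D g.
Proof.
move=> mD mf mg; have := csq_lin m 1%R mD (cmeasB mf mg) mg.
rewrite (_ : sqmod (1 : R[i])%R = 1%R) ?mulr1; last by rewrite /sqmod /= expr0n expr1n addr0.
apply: le_trans.
by rewrite le_eqVlt; apply/orP; left; apply/eqP; apply: csq_eq => x _; rewrite mul1r subrK.
Qed.

Variable Omega : set (R * R * R).
Hypothesis oO : open Omega.
Let mO : measurable (Omega : set (T3 R)). Proof. exact: open_measurable3. Qed.

Definition energy (f : R * R * R -> R) :=
  \int[leb3]_(x in (Omega : set (T3 R))) (sqgrad f x)%:E.

Lemma energyE f : C1 f -> energy f =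
  \sum_(i < 3) \int[leb3]_(x in (Omega : set (T3 R))) (pd i f x ^+ 2)%:E.
Proof.
move=> Cf; rewrite -ge0_integral_sum//.
- by apply: eq_integral => x _; rewrite sumEFin.
- move=> i; apply/measurable_EFinP; apply: measurable_funTS; apply: continuous_measurable3.
  by move=> x; apply: cvgM; exact: (@C1_pd_continuous R f Cf i).
- by move=> i x _; rewrite lee_fin sqr_ge0.
Qed.

Lemma cenergyE E phi : ctest_fun E phi -> \sum_(i < 3) sqL2 Omega (cpd i phi) =
  energy (fun x => complex.Re (phi x)) + energy (fun x => complex.Im (phi x)).
Proof.
move=> tp; have [Cr Ci] := ctest_C1 tp; rewrite !energyE// -big_split.
apply: eq_bigr => i _; have [_ /(_ i) /inL2_cmeas mc] := ctest_inL2 mO tp.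
exact: csq_parts.
Qed.

Lemma energy_ge0 f : 0 <= energy f.
Proof.
by apply: integral_ge0 => x _; rewrite lee_fin sumr_ge0// => i _; exact: sqr_ge0.
Qed.

Lemma measurable_ctest_chart E (c : lip_chart Omega) phi : ctest_fun E phi ->
  cmeas (disk (ch_rad c) : set (T2 R)) (fun y : T2 R => phi (ch_map c y)).
Proof.
move=> /ctest_C1[Cr Ci]; split; apply: measurable_funTS.
  exact: (measurable_ch_map c (@C1_continuous R _ Cr)).
exact: (measurable_ch_map c (@C1_continuous R _ Ci)).
Qed.

Lemma ctest_poincare : bounded_set Omega -> lipschitz_boundary Omega ->
  exists (C : R) (cs : seq (lip_chart Omega)), (0 <= C)%R /\ forall phi, ctest_fun setT phi ->
  sqL2 Omega phi <= C%:E * (\sum_(c <- cs) sqL2_chart c phi + \sum_(i < 3) sqL2 Omega (cpd i phi)).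
Proof.
move=> bO lO; have [C [cs [C0 H]]] := smooth_poincare oO bO lO.
exists C, cs; split => // phi tp; have [Cr Ci] := ctest_C1 tp.
have [/inL2_cmeas mp _] := ctest_inL2 mO tp.
pose q f (c : lip_chart Omega) := \int[leb2]_(y in (disk (ch_rad c) : set (T2 R))) ((f (ch_map c y) : R) ^+ 2)%:E.
have q0 f c : 0 <= q f c by apply: integral_ge0 => y _; rewrite lee_fin sqr_ge0.
have S0 f : 0 <= \sum_(c <- cs) q f c by apply: sume_ge0.
have -> : \sum_(c <- cs) sqL2_chart c phi =
    \sum_(c <- cs) q (fun x => complex.Re (phi x)) c + \sum_(c <- cs) q (fun x => complex.Im (phi x)) c.
  rewrite -big_split; apply: eq_bigr => c _; apply: csq_parts; first exact: measurable_disk.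
  exact: measurable_ctest_chart tp.
rewrite (cenergyE tp) addeACA ge0_muleDr; [|exact: adde_ge0 (S0 _) (energy_ge0 _)..].
rewrite [leLHS](_ : _ = csq (@leb3 R) Omega phi)// csq_parts//.
by apply: leeD; exact: H.
Qed.

(** The square root puts the fibre-length weight of [chart_trace] inside the squared modulus, where
    the estimates for [csq] apply. *)
Lemma ctest_chart (c : lip_chart Omega) phi : ctest_fun setT phi ->
  csq (@leb2 R) (disk (ch_rad c)) (fun y => (Num.sqrt (ch_fun c y + ch_height c))%:C%C * phi (ch_map c y))%R <=
  (2 + (2 * ch_height c) ^+ 2)%:E * sqH1 Omega phi (fun i => cpd i phi).
Proof.
move=> tp; have [Cr Ci] := ctest_C1 tp; pose h := ch_height c; pose K := (2 + (2 * h) ^+ 2)%R.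
have mp := inL2_cmeas (ctest_inL2 mO tp).1.
have K0 : (0 <= K)%R by rewrite addr_ge0// sqr_ge0.
pose q f := \int[leb3]_(x in (Omega : set (T3 R))) ((f x : R) ^+ 2)%:E.
have q0 f : 0 <= q f by apply: integral_ge0 => y _; rewrite lee_fin sqr_ge0.
have real f : C1 f -> \int[leb2]_(y in (disk (ch_rad c) : set (T2 R)))
    ((ch_fun c y + h) * f (ch_map c y) ^+ 2)%:E <= K%:E * (q f + energy f).
  move=> Cf; apply: le_trans (chart_trace oO c Cf) _.
  have m1 : measurable_fun setT (fun x : T3 R => f x ^+ 2)%R.
    by apply: continuous_measurable3 => x; apply: cvgM; exact: C1_continuous.
  have m2 : measurable_fun setT (fun x : T3 R => sqgrad f x)%R.
    by apply: continuous_measurable3; exact: sqgrad_continuous.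
  have s0 x : (0 <= sqgrad f x)%R by apply: sumr_ge0 => i _; exact: sqr_ge0.
  have mm : measurable_fun setT (fun x : T3 R => (2 * f x ^+ 2 + (2 * h) ^+ 2 * sqgrad f x)%:E).
    apply/measurable_EFinP; exact: (measurable_funD (measurable_funM (measurable_cst _) m1)
      (measurable_funM (measurable_cst _) m2)).
  have t0 x : (0 <= 2 * f x ^+ 2 + (2 * h) ^+ 2 * sqgrad f x)%R.
    by apply: addr_ge0; apply: mulr_ge0 => //; exact: sqr_ge0.
  apply: (@le_trans _ _ (\int[leb3]_(x in (Omega : set (T3 R))) (2 * f x ^+ 2 + (2 * h) ^+ 2 * sqgrad f x)%:E)).
    apply: ge0_subset_integral => //.
    - by apply: measurableI => //; apply: open_measurable3; exact: cyl_open.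
    - by apply: measurable_funTS.
    - by move=> x _; rewrite lee_fin.
  rewrite -ge0_integralD//; try by [move=> x _; rewrite lee_fin ?sqr_ge0//|
    apply/measurable_EFinP; exact: measurable_funTS].
  rewrite -ge0_integralZl_EFin//; first last.
  - by apply: emeasurable_funD; apply/measurable_EFinP; exact: measurable_funTS.
  - by move=> x _; rewrite adde_ge0// lee_fin// sqr_ge0.
  apply: ge0_le_integral => //.
  - by move=> x _; rewrite lee_fin.
  - exact: measurable_funTS.
  - apply: emeasurable_funM; first exact: measurable_cst.
    by apply: emeasurable_funD; apply/measurable_EFinP; exact: measurable_funTS.
  - move=> x _; rewrite -EFinD -EFinM lee_fin /K; have := s0 x; have := sqr_ge0 (f x).
    by have := sqr_ge0 (2 * h)%R; nra.
have w0 y : disk (ch_rad c) y -> (0 <= ch_fun c y + h)%R.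
  by move=> /ch_bounded; rewrite ltr_norml => /andP[]; rewrite -/h; lra.
have mw : measurable_fun setT (fun y : T2 R => (Num.sqrt (ch_fun c y + h))%R).
  apply: continuous_measurable2 => y; apply: continuous_comp; last exact: sqrt_continuous.
  by apply: cvgD; [exact: ch_fun_continuous|exact: cvg_cst].
have mwp : cmeas (disk (ch_rad c) : set (T2 R))
    (fun y : T2 R => (Num.sqrt (ch_fun c y + ch_height c))%:C%C * phi (ch_map c y))%R.
  apply: cmeasM; last exact: measurable_ctest_chart tp.
  by split; [exact: (measurable_funTS mw)|exact: measurable_cst].
rewrite csq_parts//; last exact: measurable_disk.
rewrite /sqH1 (cenergyE tp) [sqL2 _ _](_ : _ = csq (@leb3 R) Omega phi)// csq_parts//.
have e0 f : 0 <= q f + energy f by apply: adde_ge0; [exact: q0|exact: energy_ge0].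
pose u x := complex.Re (phi x); pose v x := complex.Im (phi x).
apply: (@le_trans _ _ (K%:E * (q u + energy u) + K%:E * (q v + energy v))); last first.
  rewrite -(@ge0_muleDr _ _ _ _ (e0 u) (e0 v)) addeACA; exact: lexx.
apply: leeD; [apply: le_trans (real _ Cr)|apply: le_trans (real _ Ci)];
  rewrite le_eqVlt; apply/orP; left; apply/eqP; apply: eq_integral => y; rewrite inE => dy;
  rewrite !cpartE /= mul0r ?subr0 ?addr0 exprMn sqr_sqrtr//; exact: w0.
Qed.

Lemma ctest_bounded phi : ctest_fun setT phi -> exists B : R, forall x, (sqmod (phi x) <= B)%R.
Proof.
move=> tp; have [Cr Ci] := ctest_C1 tp.
have key (f : R * R * R -> R) : test_fun setT f -> exists B : R, forall x, (f x ^+ 2 <= B)%R.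
  move=> tf; have [M M0 HM] := test_support tf.
  have cf : continuous f by exact: C1_continuous (test_fun_C1 tf).
  have cfK : compact (f @` box M).
    by apply: continuous_compact; [exact: continuous_subspaceT|exact: box_compact].
  have [B [_ HB]] := compact_bounded cfK.
  exists ((`|B| + 1) ^+ 2)%R => x.
  have [bx|nb] := pselect (box M x); last by rewrite (HM _ nb).1 expr0n sqr_ge0.
  rewrite -real_normK ?num_real// lerXn2r// ?nnegrE ?addr_ge0//.
  by apply: HB; [have := ler_norm B; lra|exists x].
have [B1 H1] := key _ tp.1; have [B2 H2] := key _ tp.2.
by exists (B1 + B2)%R => x; exact: lerD.
Qed.

Lemma leb2_disk_fin (c : lip_chart Omega) : leb2 (disk (ch_rad c) : set (T2 R)) < +oo.
Proof.
set r := ch_rad c.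
pose I : set (measurableTypeR R) := [set x : R | `|x|%R <= `|r|%R]%R.
have EI : I = [set` `[- `|r|, `|r|]%R].
  by apply/seteqP; split => x; rewrite /I /= in_itv /= ler_norml.
have mI : measurable I by rewrite EI; exact: measurable_itv.
apply: (@le_lt_trans _ _ (leb2 (I `*` I : set (T2 R)))).
  apply: le_measure; rewrite ?inE.
  - exact: measurable_disk.
  - exact: measurableX.
  - move=> y; rewrite /disk /= => dy.
    have le1 (s t : R) : (s ^+ 2 + t ^+ 2 < r ^+ 2 -> `|s| <= `|r|)%R.
      move=> st; rewrite -(@ler_pXn2r _ 2) ?nnegrE// !real_normK ?num_real//.
      by have := sqr_ge0 t; lra.
    by split; rewrite /I /=; [exact: le1 dy|apply: (le1 y.2 y.1); rewrite addrC].
have fI : exists l : R, lebesgue_measure I = l%:E.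
  rewrite EI; have := lebesgue_measure_itv `[(- `|r|)%R, `|r|%R]; rewrite /= => ->.
  by case: ifP => _; [exists (`|r| - - `|r|)%R|exists 0%R].
have [l El] := fI; by rewrite /leb2 product_measure1E// [X in X * _]El [X in _ * X]El -EFinM ltry.
Qed.

Lemma ctest_inL2_bdry phi : ctest_fun setT phi -> inL2_bdry Omega phi.
Proof.
move=> tp c; have [B HB] := ctest_bounded tp; have [mr mi] := measurable_ctest_chart c tp.
split; [exact: mr|exact: mi|].
apply: (@le_lt_trans _ _ (\int[leb2]_(y in (disk (ch_rad c) : set (T2 R))) (cst B%:E y))).
  apply: ge0_le_integral => //.
  - exact: measurable_disk.
  - by move=> y _; rewrite lee_fin sqmod_ge0.
  - exact: (measurable_sqmod (measurable_ctest_chart c tp)).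
  - by move=> y _; rewrite lee_fin.
rewrite integral_cst; last exact: measurable_disk.
by apply: lte_mul_pinfty; [rewrite lee_fin (le_trans (sqmod_ge0 (phi 0%R)))|by []|exact: leb2_disk_fin].
Qed.

End real_parts.

Section null_functions.
Context {R : realType} d (T : measurableType d).
Variable m : {measure set T -> \bar R}.

Lemma csq_eq0 (D : set T) (f : T -> R[i]) : measurable D -> cmeas D f ->
  csq m D f = 0%E <-> {ae m, forall x, D x -> f x = 0}.
Proof.
move=> mD mf; have := ae_eq_integral_abs m mD (measurable_sqmod mf).
rewrite (_ : (\int[m]_(x in D) _)%E = csq m D f); last first.
  by apply: eq_integral => x _; rewrite gee0_abs// lee_fin sqmod_ge0.
move=> ->; split; apply: ae_imp => x h Dx; have := h Dx.
  by move=> [] /sqmod_eq0.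
by move=> ->; rewrite sqmod0.
Qed.

End null_functions.

(** * Uniqueness of traces, Poincare's inequality for zero trace, pairings determined by test
    functions *)

Section traces_and_pairings.
Context {R : realType}.
Variable Omega : set (R * R * R).
Hypothesis oO : open Omega.
Hypothesis bO : bounded_set Omega.
Local Open Scope complex_scope.
Implicit Types (u v g : R * R * R -> R[i]).

Let mO : measurable (Omega : set (T3 R)). Proof. exact: open_measurable3. Qed.

Lemma bounded_eball (D : set (R * R * R)) : bounded_set D -> exists r, D `<=` eball r.
Proof.
move=> /bounded_coords[M [M0 HM]]; exists (M + M + M + 1) => x /HM[a b c].
rewrite /eball /= /enorm.
have s (t : R) : `|t| <= M -> t * t <= M * M.
  by rewrite ler_norml => /andP[? ?]; nra.
rewrite -[ltRHS]ger0_norm; last lra.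
rewrite -sqrtr_sqr ltr_sqrt; last by rewrite exprn_gt0//; lra.
rewrite dotE; have := s _ a; have := s _ b; have := s _ c.
by rewrite expr2; nra.
Qed.

Lemma loc_cmeas_inL2 u : inL2 Omega u -> loc_cmeas Omega u.
Proof. by move=> /inL2_cmeas mu r; apply: (cmeas_sub _ _ mu) => // x []. Qed.

Lemma is_trace_lin c (u u' : H1 Omega) g g' : is_trace u g -> is_trace u' g' ->
  is_trace (H1_lin oO c u u') (fun x => c * g x + g' x).
Proof.
move=> tu tu'; apply: (@trace_lin _ _ _ c _ _ _ _ _ _ oO _ _ _ _ tu tu').
- exact: loc_cmeas_inL2 (h1_L2 u).
- exact: loc_cmeas_inL2 (h1_L2 u').
- by move=> i; exact: loc_cmeas_inL2 (h1grad_L2 u i).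
- by move=> i; exact: loc_cmeas_inL2 (h1grad_L2 u' i).
Qed.

Lemma is_trace_test phi (tp : ctest_fun setT phi) : is_trace (test_H1 oO tp) phi.
Proof.
split; first exact: ctest_inL2_bdry.
exists (fun=> phi); split => //.
  move=> r; rewrite (_ : (fun=> _) = cst 0%E); first exact: cvg_cst.
  apply/funext => n; rewrite /sqH1 /= (_ : sqL2 _ _ = 0%E).
    rewrite add0e big1// => i _; rewrite -(csq0 (@leb3 R) (Omega `&` eball r)).
    by apply: csq_eq => x _; rewrite subrr.
  by rewrite -(csq0 (@leb3 R) (Omega `&` eball r)); apply: csq_eq => x _; rewrite subrr.
move=> c; rewrite (_ : (fun=> _) = cst 0%E); first exact: cvg_cst.
apply/funext => n; rewrite -(csq0 (@leb2 R) (disk (ch_rad c))).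
by apply: csq_eq => y _; rewrite subrr.
Qed.

(** The local convergence built into [trace_from] is global here, since one ball contains
    [Omega]. *)
Lemma trace_approx u G g : trace_from Omega Omega u G g -> exists phi : nat -> R * R * R -> R[i],
  [/\ forall n, ctest_fun setT (phi n),
      (fun n => sqH1 Omega (fun x => phi n x - u x) (fun i x => cpd i (phi n) x - G i x))
        @ \oo --> 0%E & cvgL2_bdry Omega phi g].
Proof.
move=> [_ [phi [tp cp bp]]]; exists phi; split => //.
by have [r /setIidl Or] := bounded_eball bO; have := cp r; rewrite Or.
Qed.

Lemma cmeas_bdry g (c : lip_chart Omega) : inL2_bdry Omega g ->
  cmeas (disk (ch_rad c) : set (T2 R)) (fun y : T2 R => g (ch_map c y)).
Proof. by move=> /(_ c)[]. Qed.

(** Closability of the restriction to the boundary: approximants tending to 0 in H^1 have weighted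
    boundary values tending to 0 by [ctest_chart], and their limit is [g]. So the weight times [g]
    is null, and the weight is positive. *)
Lemma trace_zero u G g : (forall x, u x = 0) -> (forall i x, G i x = 0) ->
  trace_from Omega Omega u G g -> forall c : lip_chart Omega, sqL2_chart c g = 0%E.
Proof.
move=> u0 G0 tr c; have [phi [tp cp bp]] := trace_approx tr.
have mg := cmeas_bdry c tr.1; have md := @measurable_disk R Omega c.
pose w y : R[i] := (Num.sqrt (ch_fun c y + ch_height c))%:C.
have w0 y : disk (ch_rad c) y -> 0 < ch_fun c y + ch_height c < 2 * ch_height c.
  by move=> /ch_bounded; rewrite ltr_norml => /andP[a b]; apply/andP; split; lra.
have mw : cmeas (disk (ch_rad c) : set (T2 R)) w.
  split; last exact: measurable_cst.
  apply: measurable_funTS; apply: continuous_measurable2 => y.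
  apply: continuous_comp; last exact: sqrt_continuous.
  by apply: cvgD; [exact: ch_fun_continuous|exact: cvg_cst].
have sw y : disk (ch_rad c) y -> sqmod (w y) = ch_fun c y + ch_height c.
  by move=> /w0/andP[a _]; rewrite /sqmod /= expr0n addr0 sqr_sqrtr// ltW.
have mwg := cmeasM mw mg.
have mt n := measurable_ctest_chart c (tp n).
pose s n := sqH1 Omega (phi n) (fun i => cpd i (phi n)).
have cs : s @ \oo --> 0%E.
  rewrite (_ : s = (fun n => sqH1 Omega (fun x => phi n x - u x) (fun i x => cpd i (phi n) x - G i x)))//.
  by apply/funext => n; apply: sqH1_eq => [x _|i x _]; rewrite ?u0 ?G0 subr0.
pose p n := sqL2_chart c (fun x => phi n x - g x).
have wg0 : csq (@leb2 R) (disk (ch_rad c)) (fun y : T2 R => w y * g (ch_map c y)) = 0%E.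
  apply/eqP; rewrite eq_le csq_ge0 andbT.
  pose K := 2 + (2 * ch_height c) ^+ 2.
  (* The squared weight stays below [2 * ch_height c], which handles the distance from [phi n] to
     [g]; [K] is the constant of [ctest_chart] and handles [phi n] itself. *)
  apply: (@lee_cvg0 _ _ _ (fun n => 2%:E * ((2 * ch_height c)%:E * p n) + 2%:E * (K%:E * s n))%E) => //.
    move=> n; rewrite adde0.
    apply: le_trans (csq_le_sub (@leb2 R) md mwg (cmeasM mw (mt n))) _.
    apply: leeD; apply: lee_wpmul2l => //; last exact: (ctest_chart oO c (tp n)).
    have mpg := cmeasB (mt n) mg.
    have h0 : 0 <= 2 * ch_height c.
      have d0 : disk (ch_rad c) (0, 0).
        by rewrite /disk /= expr0n addr0 exprn_gt0// ch_rad_gt0.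
      by have := ch_height_gt0 d0; lra.
    rewrite [p n](_ : _ = csq (@leb2 R) (disk (ch_rad c)) (fun y : T2 R => phi n (ch_map c y) - g (ch_map c y)))//.
    have t0 (f : T2 R -> R[i]) (y : T2 R) : (0 <= (sqmod (f y))%:E)%E by rewrite lee_fin sqmod_ge0.
    rewrite /csq -ge0_integralZl_EFin//; [|by move=> y _; rewrite lee_fin sqmod_ge0|exact: measurable_sqmod mpg].
    apply: ge0_le_integral => //.
    - by move=> y _; rewrite lee_fin sqmod_ge0.
    - by apply: measurable_sqmod; exact: cmeasB mwg (cmeasM mw (mt n)).
    - by apply: emeasurable_funM; [exact: measurable_cst|exact: measurable_sqmod mpg].
    move=> y dy; rewrite -mulrBr sqmodM sw// -EFinM lee_fin.
    rewrite (_ : sqmod (g _ - _) = sqmod (phi n (ch_map c y) - g (ch_map c y))); last first.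
      by rewrite -opprB /sqmod cReN cImN !sqrrN.
    by apply: ler_wpM2r; [exact: sqmod_ge0|have /andP[_ /ltW] := w0 _ dy].
  apply: (@cvge0_lin _ p s _ (2 * (2 * ch_height c)) (2 * K)) => //.
  - move=> n; apply: adde_ge0; apply: mule_ge0 => //; apply: mule_ge0.
    + have d0 : disk (ch_rad c) (0, 0).
        by rewrite /disk /= expr0n addr0 exprn_gt0// ch_rad_gt0.
      by have := ch_height_gt0 d0; rewrite lee_fin; lra.
    + exact: (csq_ge0 (@leb2 R)).
    + by rewrite lee_fin addr_ge0// sqr_ge0.
    + exact: sqH1_ge0.
  - by move=> n; rewrite !muleA -!EFinM.
  - exact: bp.
have /csq_eq0 h := wg0; apply/csq_eq0; [exact: md|exact: mg|].
apply: ae_imp (h md mwg) => y H dy; have /eqP := H dy; rewrite mulf_eq0 => /orP[/eqP wy|/eqP//].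
by exfalso; have := sw _ dy; rewrite wy sqmod0; have /andP[+ _] := w0 _ dy; lra.
Qed.

Lemma is_trace_unique (u : H1 Omega) g g' : is_trace u g -> is_trace u g' ->
  forall c : lip_chart Omega, sqL2_chart c (fun x => -1 * g x + g' x) = 0%E.
Proof.
move=> tg tg'; apply: trace_zero (is_trace_lin (-1) tg tg').
- by move=> x /=; ring.
- by move=> i x /=; ring.
Qed.

Lemma trace_from_data0 D u G g : (forall c : lip_chart Omega, sqL2_chart c g = 0%E) ->
  trace_from Omega D u G g -> trace_from Omega D u G (fun=> 0).
Proof.
move=> g0 [Lg [phi [tp cp bp]]]; split.
  move=> c; split; [exact: measurable_cst|exact: measurable_cst|].
  by rewrite [sqL2_chart _ _](_ : _ = 0%E) ?ltry//; exact: (csq0 (@leb2 R)).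
exists phi; split => // c; have md := @measurable_disk R Omega c.
apply: (@cvge0_lin _ (fun n => sqL2_chart c (fun x => phi n x - g x)) (cst 0%E) _ 2 1) => //.
- by move=> n; exact: (csq_ge0 (@leb2 R)).
- move=> n; rewrite mule0 adde0.
  have := csq_le_sub (@leb2 R) md (measurable_ctest_chart c (tp n)) (cmeas_bdry c Lg).
  rewrite [X in (_ + _ * X)%E](_ : _ = 0%E); last exact: (g0 c).
  rewrite mule0 adde0; apply: le_trans.
  by rewrite le_eqVlt; apply/orP; left; apply/eqP; apply: csq_eq => y _; rewrite subr0.
- exact: cvg_cst.
Qed.

Lemma trace0_poincare : lipschitz_boundary Omega -> exists C : R, 0 <= C /\
  forall W : H1 Omega, is_trace W (fun=> 0) ->
  (sqL2 Omega W <= C%:E * \sum_(i < 3) sqL2 Omega (h1grad W i))%E.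
Proof.
move=> lO; have [C [cs [C0 H]]] := ctest_poincare oO bO lO.
(* One factor 2 is lost in passing from [W] to its approximant, the other in passing back from the
   approximant's gradient to that of [W]. *)
exists (2 * (C * 2)); split; first by apply: mulr_ge0 => //; exact: mulr_ge0.
move=> W /trace_approx[phi [tp cp bp]].
pose s n := sqH1 Omega (fun x => phi n x - W x) (fun i x => cpd i (phi n) x - h1grad W i x).
pose P n := (\sum_(c <- cs) sqL2_chart c (phi n))%E.
pose Gm := (\sum_(i < 3) sqL2 Omega (h1grad W i))%E.
have mW := inL2_cmeas (h1_L2 W); have mG i := inL2_cmeas (h1grad_L2 W i).
have q0 f : (0 <= sqL2 Omega f)%E by exact: (csq_ge0 (@leb3 R)).
have Gm0 : (0 <= Gm)%E by apply: sume_ge0.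
have P0 n : (0 <= P n)%E by apply: sume_ge0 => c _; exact: (csq_ge0 (@leb2 R)).
have s0 n : (0 <= s n)%E by exact: sqH1_ge0.
have cP : P @ \oo --> 0%E.
  apply: cvge0_sum => [c n|c]; first exact: (csq_ge0 (@leb2 R)).
  rewrite (_ : (fun n => sqL2_chart c (phi n)) = (fun n => sqL2_chart c (fun x => phi n x - 0))).
    exact: bp.
  by apply/funext => n; apply: (csq_eq (@leb2 R)) => y _; rewrite subr0.
have cPs : (fun n => P n + 2%:E * s n)%E @ \oo --> 0%E.
  apply: (@cvge0_lin _ P s _ 1 2) => //; last by move=> n; rewrite mul1e.
  by move=> n; apply: adde_ge0 => //; exact: mule_ge0.
rewrite !EFinM -!muleA.
apply: (@lee_cvg0 _ _ _ (fun n => 2%:E * s n + 2%:E * (C%:E * (P n + 2%:E * s n)))%E).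
- by do 3! (apply: mule_ge0; first by rewrite lee_fin).
- move=> n; have [mp mpd] := ctest_inL2 mO (tp n).
  have {}mp := inL2_cmeas mp; have {}mpd i := inL2_cmeas (mpd i).
  apply: le_trans (csq_le_sub (@leb3 R) mO mW mp) _.
  rewrite -addeA; apply: leeD.
    apply: lee_wpmul2l => //.
    rewrite (_ : csq _ _ _ = sqL2 Omega (fun x => phi n x - W x)); last first.
      by apply: eq_integral => x _; rewrite -opprB /sqmod cReN cImN !sqrrN.
    by rewrite /s /sqH1 leeDl// sume_ge0.
  have CP : (0 <= C%:E * (P n + 2%:E * s n))%E.
    by apply: mule_ge0; [rewrite lee_fin|apply: adde_ge0 => //; apply: mule_ge0].
  have CG : (0 <= C%:E * (2%:E * Gm))%E.
    by apply: mule_ge0; [rewrite lee_fin|apply: mule_ge0].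
  rewrite -(@ge0_muleDr _ 2%:E _ _ CP CG); apply: lee_wpmul2l => //.
  rewrite -(@ge0_muleDr _ C%:E (P n + 2%:E * s n)%E (2%:E * Gm)%E); last 2 first.
    by apply: adde_ge0 => //; apply: mule_ge0.
    by apply: mule_ge0.
  apply: le_trans (H _ (tp n)) _; apply: lee_wpmul2l; first by rewrite lee_fin.
  rewrite -addeA; apply: leeD => //.
  rewrite -(@ge0_muleDr _ 2%:E _ _ (s0 n) Gm0).
  apply: (@le_trans _ _ (2%:E * (\sum_(i < 3) sqL2 Omega (fun x => cpd i (phi n) x - h1grad W i x)%R + Gm))%E).
    rewrite (@ge0_muleDr _ 2%:E _ _ _ Gm0); last exact: sume_ge0.
    rewrite !ge0_sume_distrr; [|by move=> i _; exact: q0..].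
    rewrite -big_split /=; apply: lee_sum => i _.
    exact: (csq_le_sub (@leb3 R) mO (mpd i) (mG i)).
  by apply: lee_wpmul2l => //; apply: leeD => //; rewrite /s /sqH1 leeDr.
- apply: (@cvge0_lin _ s (fun n => P n + 2%:E * s n)%E _ 2 (2 * C)) => //.
  + move=> n; apply: adde_ge0; first exact: mule_ge0.
    apply: mule_ge0 => //; apply: mule_ge0; first by rewrite lee_fin.
    by apply: adde_ge0 => //; apply: mule_ge0.
  + by move=> n; rewrite EFinM muleA.
Qed.

(** Density of test functions in H^{1/2}: both functionals are small on [phi n - psi], the trace of
    an H^1 function of small norm, and they agree on [phi n]. *)
Lemma pairing_eq T T' (v : H1 Omega) psi : inHmhalf Omega T -> inHmhalf Omega T' ->
  (forall w, ctest_fun setT w -> T w = T' w) -> is_trace v psi -> T psi = T' psi.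
Proof.
move=> [lT [C HC]] [lT' [C' HC']] TT tv; have [phi [tp cp _]] := trace_approx tv.
pose s n := sqH1 Omega (fun x => phi n x - v x) (fun i x => cpd i (phi n) x - h1grad v i x).
apply/eqP; rewrite -subr_eq0; apply/eqP; apply: sqmod_eq0; apply/eqP.
rewrite eq_le sqmod_ge0 andbT -lee_fin.
apply: (@lee_cvg0 _ _ _ (fun n => (2 * `|C'|)%:E * s n + (2 * `|C|)%:E * s n)%E) => //.
  move=> n; rewrite adde0; pose w := H1_lin oO (-1) v (test_H1 oO (tp n)).
  have tw : is_trace w (fun x => -1 * psi x + phi n x) by exact: is_trace_lin tv (is_trace_test (tp n)).
  have hv : inHhalf Omega psi by exists v.
  have hp : inHhalf Omega (phi n) by exists (test_H1 oO (tp n)); exact: is_trace_test.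
  have sw : sqH1 Omega w (h1grad w) = s n.
    by apply: sqH1_eq => [x _|i x _] /=; ring.
  have c1 : conjc (-1 : R[i]) = -1 by apply: c_ext; rewrite /= ?oppr0.
  have -> : T psi - T' psi = 1 * T' (fun x => -1 * psi x + phi n x) - T (fun x => -1 * psi x + phi n x).
    by rewrite lT// lT'// c1 (TT _ (tp n)); ring.
  rewrite mul1r.
  have := sqmod_lin (-1) (T (fun x => -1 * psi x + phi n x)) (T' (fun x => -1 * psi x + phi n x)).
  rewrite mulN1r (addrC (- _)) -lee_fin => h; apply: le_trans h _.
  rewrite (_ : sqmod (-1 : R[i]) = 1); last by rewrite /sqmod /= oppr0 expr0n addr0 sqrrN expr1n.
  rewrite mulr1 addrC EFinD !EFinM -!muleA -sw.
  have sw0 : (0 <= sqH1 Omega w (h1grad w))%E by exact: sqH1_ge0.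
  have bnd (D z : R) : (z%:E <= D%:E * sqH1 Omega w (h1grad w))%E ->
      (z%:E <= `|D|%:E * sqH1 Omega w (h1grad w))%E.
    by move=> h1; apply: le_trans h1 _; apply: lee_wpmul2r => //; rewrite lee_fin ler_norm.
  apply: leeD; apply: lee_wpmul2l => //; apply: bnd; [exact: HC'|exact: HC].
apply: (@cvge0_lin _ s s _ (2 * `|C'|) (2 * `|C|)) => // n.
have s0 : (0 <= s n)%E by exact: sqH1_ge0.
by apply: adde_ge0; apply: mule_ge0 => //; rewrite lee_fin mulr_ge0.
Qed.

End traces_and_pairings.

(** * The exterior problem: dependence on the boundary data only up to null sets *)

Section exterior_problem.
Context {R : realType}.
Variable Omega : set (R * R * R).
Hypothesis oO : open Omega.
Hypothesis bO : bounded_set Omega.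
Local Open Scope complex_scope.
Implicit Types (u v g : R * R * R -> R[i]).

Lemma exterior_open : open (exterior Omega).
Proof. by apply: closed_openC; exact: closed_closure. Qed.

Let mE : measurable (exterior Omega : set (T3 R)).
Proof. by apply: open_measurable3; exact: exterior_open. Qed.

Lemma cpd_ext (E : set (R * R * R)) u v i x : open E -> (forall x, E x -> u x = v x) -> E x ->
  cpd i u x = cpd i v x.
Proof.
move=> oE uv Ex; have nE : \near x, E x by exact: open_nbhs_nbhs.
by apply: c_ext; apply: near_eq_derive; apply: filterS nE => y /uv ->.
Qed.

Lemma classC_pd n (E : set (R * R * R)) (f : R * R * R -> R) i : classC n.+1 E f -> classC n E (pd i f).
Proof.
move=> Cf s sn x Ex; have := Cf (rcons s i); rewrite size_rcons /pds foldr_rcons.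
by apply.
Qed.

Lemma inL2_ext (D : set (T3 R)) u v : measurable D -> (forall x, D x -> u x = v x) -> inL2 D u -> inL2 D v.
Proof.
move=> mD uv /inL2P[[mr mi] fi]; have uvD : {in D, u =1 v} by move=> x; rewrite inE => /uv.
apply/inL2P; split; last by rewrite -(csq_eq (@leb3 R) uv).
by split; [apply: eq_measurable_fun mr|apply: eq_measurable_fun mi] => x /uvD ->.
Qed.

Lemma trace_from_ext D u G G' g : (forall i x, D x -> G i x = G' i x) ->
  trace_from Omega D u G g -> trace_from Omega D u G' g.
Proof.
move=> GG [Lg [phi [tp cp bp]]]; split => //; exists phi; split => // r.
rewrite (_ : (fun n => _) = (fun n => sqH1 (D `&` eball r)
   (fun x => phi n x - u x) (fun i x => cpd i (phi n) x - G i x))); first exact: cp.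
by apply/funext => n; apply: sqH1_eq => // i x [Dx _]; rewrite GG.
Qed.

(** The radiation condition differentiates at all far points of space, while derivatives of a
    difference split only where both fields are smooth; beyond this radius they do. *)
Lemma exterior_far : exists r0 : R, forall x, r0 < enorm x -> exterior Omega x.
Proof.
have /compact_bounded/bounded_eball[r hr] := compact_closure_bounded bO.
by exists r => x rx /hr; rewrite /eball /=; lra.
Qed.

Let lin_sum (A A' B : 'I_3 -> R[i]) (c z z' : R[i]) :
  \sum_(i < 3) A i + c * z = 0 -> \sum_(i < 3) A' i + c * z' = 0 ->
  (forall i, B i = -1 * A i + A' i) -> \sum_(i < 3) B i + c * (-1 * z + z') = 0.
Proof.
move=> h h' BE; rewrite (eq_bigr _ (fun i _ => BE i)) big_split -mulr_sumr /=.
transitivity (-1 * (\sum_(i < 3) A i + c * z) + (\sum_(i < 3) A' i + c * z')); first by ring.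
by rewrite h h'; ring.
Qed.

Let lin_radiation (n q : R[i]) (e : 'I_3 -> R) (A A' B : 'I_3 -> R[i]) (z z' : R[i]) :
  (forall i, B i = -1 * A i + A' i) ->
  sqmod (n * (\sum_(i < 3) (e i)%:C * B i - q * (-1 * z + z'))) <=
  2 * sqmod (n * (\sum_(i < 3) (e i)%:C * A i - q * z)) +
  2 * sqmod (n * (\sum_(i < 3) (e i)%:C * A' i - q * z')).
Proof.
move=> BE; rewrite (eq_bigr (fun i => -1 * ((e i)%:C * A i) + (e i)%:C * A' i)); last first.
  by move=> i _; rewrite BE; ring.
rewrite big_split -mulr_sumr /=; set S := \sum_i _; set S' := \sum_i _.
rewrite (_ : n * _ = -1 * (n * (S - q * z)) + n * (S' - q * z')); last by ring.
apply: le_trans (sqmod_lin _ _ _) _.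
by rewrite (_ : sqmod (-1 : R[i]) = 1) ?mulr1// /sqmod /= oppr0 expr0n addr0 sqrrN expr1n.
Qed.

(** Well-posedness is stated for one and the same function as data, while traces are fixed only up
    to null sets. Taking differences brings everything back to the data 0. *)
Lemma exterior_solution_sub k g g' v v' :
  exterior_solution Omega k g v -> exterior_solution Omega k g' v' ->
  (forall c : lip_chart Omega, sqL2_chart c (fun x => -1 * g x + g' x) = 0%E) ->
  exterior_solution Omega k (fun=> 0) (fun x => -1 * v x + v' x).
Proof.
move=> [Cv Pv Lv tv Sv] [Cv' Pv' Lv' tv' Sv'] g0.
have oE := exterior_open; set E := exterior Omega in oE Cv Pv Lv tv Cv' Pv' Lv' tv' *.
have cv : cC 2 E v := Cv; have cv' : cC 2 E v' := Cv'.
have cpv w i : cC 2 E w -> cC 1 E (cpd i w) by move=> [a b]; split; exact: classC_pd.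
have dv i x : E x -> cpd i (fun x => -1 * v x + v' x) x = -1 * cpd i v x + cpd i v' x.
  by move=> Ex; apply: (cpd_lin (n := 2) _ _ oE).
have mr r : measurable (E `&` eball r : set (T3 R)).
  by apply: open_measurable3; apply: openI => //; exact: eball_open.
split.
- exact: cC_lin.
- move=> x Ex; apply: (@lin_sum (fun i => cpd i (cpd i v) x) (fun i => cpd i (cpd i v') x)
    (fun i => cpd i (cpd i (fun x => -1 * v x + v' x)) x) _ (v x) (v' x) (Pv x Ex) (Pv' x Ex)) => i.
  rewrite (cpd_ext _ oE (dv i) Ex).
  by apply: (@cpd_lin R 1 E (-1) (cpd i v) (cpd i v') i x oE) => //; exact: cpv.
- move=> r; have [[a b] [a' b']] := (Lv r, Lv' r); split; first exact: inL2_lin.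
  move=> i; apply: (inL2_ext (mr r) _ (inL2_lin (mr r) (-1) (b i) (b' i))).
  by move=> x [Ex _]; rewrite dv.
- apply: (trace_from_data0 g0).
  apply: (@trace_from_ext _ _ (fun i x => -1 * cpd i v x + cpd i v' x)).
    by move=> i x Ex; rewrite dv.
  apply: (@trace_lin R Omega E (-1) v v' (fun i => cpd i v) (fun i => cpd i v') g g' oE _ _ _ _ tv tv') => [r|r|i r|i r].
  + by have [a _] := Lv r; exact: inL2_cmeas a.
  + by have [a _] := Lv' r; exact: inL2_cmeas a.
  + by have [_ b] := Lv r; exact: inL2_cmeas (b i).
  + by have [_ b] := Lv' r; exact: inL2_cmeas (b i).
- move=> eps e0; have e2 : 0 < eps / 2 by lra.
  have [[r [r0 H]] [r' [r0' H']]] := (Sv _ e2, Sv' _ e2).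
  have [rE HE] := exterior_far.
  exists (Num.max rE (Num.max r r')); split; first by rewrite !lt_max r0 orbT.
  move=> x; rewrite !gt_max => /and3P[/HE Ex /H Hx /H' Hx'].
  apply: le_lt_trans (@lin_radiation (enorm x)%:C (0 +i* k) (fun i => Defs.coord i x / enorm x)
    (fun i => cpd i v x) (fun i => cpd i v' x) (fun i => cpd i (fun x => -1 * v x + v' x) x)
    (v x) (v' x) (fun i => dv i x Ex)) _.
  have : (eps / 2) ^+ 2 = eps ^+ 2 / 4 by field.
  by move: Hx Hx'; set z := sqmod _; set z' := sqmod _; lra.
Qed.

Lemma inHhalf0 : inHhalf Omega (fun=> 0).
Proof. by exists (test_H1 oO (ctest0 setT)); exact: is_trace_test. Qed.

Variable k : R.
Hypothesis wp : exterior_wellposed Omega k.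

Let chart0 (c : lip_chart Omega) g : sqL2_chart c (fun x => -1 * g x + g x) = 0%E.
Proof.
rewrite -[RHS](csq0 (@leb2 R) (disk (ch_rad c))).
by apply: (csq_eq (@leb2 R)) => y _; ring.
Qed.

(** Obtained as [v - v] from the solution that well-posedness provides for zero data, instead of
    checking each clause. *)
Lemma exterior_solution0 : exterior_solution Omega k (fun=> 0) (fun=> 0).
Proof.
have [[v sv] _] := wp inHhalf0.
have := exterior_solution_sub sv sv (fun c => chart0 c _).
by rewrite (_ : (fun x => -1 * v x + v x) = (fun=> 0))//; apply/funext => x; ring.
Qed.

Lemma exterior_solution_eq g g' v v' :
  exterior_solution Omega k g v -> exterior_solution Omega k g' v' ->
  (forall c : lip_chart Omega, sqL2_chart c (fun x => -1 * g x + g' x) = 0%E) ->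
  forall x, exterior Omega x -> v x = v' x.
Proof.
move=> sv sv' gg x Ex; have s0 := exterior_solution_sub sv sv' gg.
have [_ /(_ _ _ s0 exterior_solution0 x Ex) h] := wp inHhalf0.
by apply/eqP; rewrite -subr_eq0 -oppr_eq0 -h; apply/eqP; ring.
Qed.

Let green (A A' : 'I_3 -> R[i]) (B B' c : R[i]) : (forall i, A i = A' i) -> B = B' ->
  - (\sum_(i < 3) A i - c * B) = - (\sum_(i < 3) A' i - c * B').
Proof. by move=> /funext -> ->. Qed.

(** Green's identity sees the exterior field only through its values and derivatives on the open
    exterior, where the two fields coincide. *)
Lemma DtN_eq g g' T T' : is_DtN Omega k g T -> is_DtN Omega k g' T' ->
  (forall c : lip_chart Omega, sqL2_chart c (fun x => -1 * g x + g' x) = 0%E) ->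
  forall w, ctest_fun setT w -> T w = T' w.
Proof.
move=> [_ [v [sv Tv]]] [_ [v' [sv' Tv']]] gg w tw; rewrite Tv// Tv'//.
have vv := exterior_solution_eq sv sv' gg.
have e1 : inner (exterior Omega) v w = inner (exterior Omega) v' w.
  by apply: cint_eq => x Ex; rewrite (vv x Ex).
have e2 i : inner (exterior Omega) (cpd i v) (cpd i w) = inner (exterior Omega) (cpd i v') (cpd i w).
  by apply: cint_eq => x Ex; rewrite (cpd_ext i exterior_open vv Ex).
exact: (@green (fun i => inner (exterior Omega) (cpd i v) (cpd i w))
  (fun i => inner (exterior Omega) (cpd i v') (cpd i w)) _ _ (k ^+ 2)%:C e2 e1).
Qed.

Lemma DtN0 : is_DtN Omega k (fun=> 0) (fun=> 0).
Proof.
split.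
  split; first by move=> c g1 g2 _ _; ring.
  exists 0 => u g _; rewrite sqmod0 mul0e//.
exists (fun=> 0); split; first exact: exterior_solution0.
have i0 f g : (forall x, f x = 0) -> inner (exterior Omega) f g = 0.
  by move=> f0; rewrite -[RHS](cint0 mE); apply: cint_eq => x _; rewrite f0 mul0r.
move=> w _; rewrite (i0 _ w)// big1 ?mulr0 ?subr0 ?oppr0// => i _; apply: i0 => x.
by apply: c_ext; exact: derive_cst.
Qed.

End exterior_problem.

(** * Smooth bump functions from [exp (-1/s)] *)

Section smooth_bumps.
Context {R : realType}.

Lemma is_derive_of_line (V : normedModType R) (f : V -> R) (v x : V) (a : R) :
  is_derive (0 : R) (1 : R) (fun t : R => f (t *: v + x)) a -> is_derive x v f a.
Proof.
have E : (fun h : R => h^-1 *: (((fun t : R => f (t *: v + x)) \o shift 0) (h *: 1) - f (0 *: v + x)))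
  = (fun h : R => h^-1 *: ((f \o shift x) (h *: v) - f x)).
  apply/funext => h /=; rewrite scale0r add0r addr0; congr (_ *: (f _ - _)).
  by congr (_ *: _ + _); rewrite /GRing.scale/= mulr1.
move=> [dg vg]; apply: DeriveDef; first by move: dg; rewrite /derivable E.
by move: vg; rewrite /derive E.
Qed.

(* The functions [P(1/s) exp(-1/s)], extended by 0 to [s <= 0], are stable under
   differentiation, hence smooth. *)
Definition flat (P : {poly R}) (s : R) := if 0 < s then P.[s^-1] * expR (- s^-1) else 0.

(** With [t = 1/s], the bound [t^(n+1) / (n+1)! <= exp t] gives [t^n exp (-t) <= (n+1)! s], monomial
    by monomial. *)
Lemma flat_bound P : exists C : R, forall s, `|flat P s| <= C * `|s|.
Proof.
(* The extra power of ['X] is there because Horner's induction [p * 'X + c] raises the degree of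
   what remains. *)
have key : forall Q n, exists C : R, 0 <= C /\ forall s, 0 < s ->
    `|(Q * 'X^n).[s^-1] * expR (- s^-1)| <= C * s.
  elim/poly_ind => [n|p c IH n].
    by exists 0; split => // s s0; rewrite mul0r horner0 !mul0r normr0.
  have [C [C0 H]] := IH n.+1; exists (C + `|c| * (n.+1)`!%:R); split.
    by rewrite addr_ge0// mulr_ge0.
  move=> s s0; have t0 : 0 < s^-1 by rewrite invr_gt0.
  rewrite (_ : (p * 'X + c%:P) * 'X^n = p * 'X^(n.+1) + c%:P * 'X^n); last first.
    by rewrite mulrDl exprS mulrA.
  rewrite hornerD (mulrDl _.[_]) mulrDl; apply: le_trans (ler_normD _ _) _.
  apply: lerD; first exact: H.
  rewrite hornerM hornerC hornerXn -!mulrA normrM; apply: ler_wpM2l => //.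
  rewrite ger0_norm; last by rewrite mulr_ge0 ?expR_ge0// exprn_ge0// ltW.
  have F0 : 0 < (n.+1)`!%:R :> R by rewrite ltr0n fact_gt0.
  have := expR_ge1Dxn n (ltW t0); set e := expR s^-1; set T := _ / _ => le.
  have ET : s^-1 ^+ n = (n.+1)`!%:R * s * T.
    by rewrite /T exprS; field; rewrite ?gt_eqF.
  have ee : e * expR (- s^-1) = 1 by rewrite -expRD subrr expR0.
  rewrite ET -[leRHS]mulr1 -[leLHS]mulrA; apply: ler_wpM2l; first by rewrite mulr_ge0// ltW.
  by rewrite -ee; apply: ler_wpM2r; [exact: expR_ge0|lra].
have [C [C0 H]] := key P 0%N; exists C => s; rewrite /flat; case: ifPn => s0.
  by have := H s s0; rewrite expr0 mulr1 (gtr0_norm s0).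
by rewrite normr0 mulr_ge0.
Qed.

(** At the origin the difference quotient of [flat P] is [flat (P * 'X)], which tends to 0 by
    [flat_bound]. *)
Lemma flat_derive (P : {poly R}) (s : R) : is_derive s (1 : R) (flat P) (flat ('X^2 * (P - P^`())) s).
Proof.
have [s0|s0|<-] := ltgtP 0 s.
- have sn0 : s != 0 by rewrite gt_eqF.
  pose g t : R := P.[t^-1] * expR (- t^-1).
  have dV : is_derive s (1 : R) (fun t : R => t^-1) (- s ^- 2).
    have h := is_deriveV (f := id) sn0 (is_derive_id s (1 : R)).
    by apply: (is_derive_eq h); rewrite /GRing.scale/= mulr1.
  have dP := is_derive1_comp (is_derive_poly P s^-1) dV.
  have dN : is_derive s (1 : R) (fun t : R => - t^-1) (s ^- 2).
    by have h := is_deriveN dV; apply: (is_derive_eq h); rewrite opprK.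
  have dE := @is_derive1_comp R expR (fun t : R => - t^-1) s _ _ (is_derive_expR (- s^-1)) dN.
  have dg : is_derive s (1 : R) g (flat ('X^2 * (P - P^`())) s).
    have h := is_deriveM dP dE; apply: (is_derive_eq h).
    rewrite /GRing.scale/= /flat s0 hornerM hornerXn hornerD hornerN -exprVn.
    by ring.
  apply: near_eq_is_derive dg; near=> t.
  by rewrite /flat ifT//; near: t; exact: lt_nbhsr.
- have dc : is_derive s (1 : R) (cst 0 : R -> R) (flat ('X^2 * (P - P^`())) s).
    by rewrite /flat ltNge (ltW s0) /=; exact: is_derive_cst.
  apply: near_eq_is_derive dc; near=> t.
  have t0 : t < 0 by near: t; exact: lt_nbhsl.
  by rewrite /flat ltNge ltW.
- rewrite [X in is_derive _ _ _ X]/flat ltxx.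
  have [C HC] := flat_bound (P * 'X).
  have L : (fun h : R => h^-1 *: ((flat P \o shift 0) (h *: 1) - flat P 0)) @ 0^' --> (0 : R).
    apply/cvgrPdist_le => e e0; near=> h.
    have -> : h^-1 *: ((flat P \o shift 0) (h *: 1) - flat P 0) = flat (P * 'X) h.
      rewrite /= addr0 /GRing.scale/= mulr1 {2}/flat ltxx subr0 /flat.
      by case: ifP => _; rewrite ?mulr0// hornerM hornerX; ring.
    rewrite sub0r normrN; apply: le_trans (HC h) _.
    have hd : `|h| <= e / (`|C| + 1).
      near: h; apply: dnbhs0_le; by rewrite divr_gt0// ltr_wpDl.
    apply: (@le_trans _ _ ((`|C| + 1) * `|h|)).
      by apply: ler_wpM2r => //; have := ler_norm C; lra.
    have C1 : 0 < `|C| + 1 by rewrite ltr_wpDl.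
    by rewrite mulrC -ler_pdivlMr.
  by apply: DeriveDef; [exact: cvgP L|exact: cvg_lim L].
Unshelve. all: by end_near. Qed.

(** A class closed under partial derivatives and made of continuous functions; every member is
    therefore smooth of all orders. *)
Inductive elementary : (R * R * R -> R) -> Prop :=
| elementary_cst c : elementary (fun=> c)
| elementary_flat P i c d : elementary (fun x => flat P (c * Defs.coord i x + d))
| elementary_add f g : elementary f -> elementary g -> elementary (fun x => f x + g x)
| elementary_mul f g : elementary f -> elementary g -> elementary (fun x => f x * g x).

Lemma coord_line (i j : 'I_3) (t : R) x :
  Defs.coord i (t *: basis3 R j + x) = t * (i == j)%:R + Defs.coord i x.
Proof.
by case: i j => [[|[|[|?]]] ?] [[|[|[|?]]] ?] //; rewrite /Defs.coord /= /GRing.scale/=.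
Qed.

Lemma elementary_derive f i : elementary f ->
  exists2 g, elementary g & forall x, is_derive x (basis3 R i) f (g x).
Proof.
elim=> [c|P j c d|g h _ [g' eg dg] _ [h' eh dh]|g h Eg [g' eg dg] Eh [h' eh dh]].
- by exists (fun=> 0); [exact: elementary_cst|move=> x; exact: is_derive_cst].
- pose Q := (c * (j == i)%:R) *: ('X^2 * (P - P^`())).
  exists (fun x => flat Q (c * Defs.coord j x + d)); first exact: elementary_flat.
  move=> x; apply: is_derive_of_line.
  pose A := c * (j == i)%:R; pose B := c * Defs.coord j x + d.
  rewrite (_ : (fun t : R => _) = flat P \o (fun t : R => t * A + B)); last first.
    by apply/funext => t /=; rewrite coord_line /A /B; congr flat; ring.
  have dl : is_derive (0 : R) 1 (fun t : R => t * A + B) A.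
    have h := is_deriveD (is_deriveM (is_derive_id (0 : R) 1) (is_derive_cst A (0 : R) 1)) (is_derive_cst B (0 : R) 1).
    by apply: (is_derive_eq h); rewrite /GRing.scale/=; ring.
  have h := @is_derive1_comp R (flat P) (fun t : R => t * A + B) 0 _ _ (flat_derive P (0 * A + B)) dl; apply: (is_derive_eq h).
  by rewrite mul0r add0r /Q /flat; case: ifP => _; rewrite ?mul0r// hornerZ -/A; ring.
- exists (fun x => g' x + h' x); first exact: elementary_add.
  by move=> x; exact: is_deriveD (dg x) (dh x).
- exists (fun x => g x * h' x + h x * g' x).
    by apply: elementary_add; exact: elementary_mul.
  by move=> x; exact: is_deriveM (dg x) (dh x).
Qed.

Lemma elementary_continuous f : elementary f -> continuous f.
Proof.
elim=> [c|P j c d|g h _ cg _ ch|g h _ cg _ ch] x.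
- exact: cvg_cst.
- have cl : {for x, continuous (fun x : R * R * R => c * Defs.coord j x + d)}.
    apply: cvgD; last exact: cvg_cst.
    by apply: cvgM; [exact: cvg_cst|exact: coord3_continuous].
  have cf y : {for y, continuous (flat P)}.
    apply: differentiable_continuous; apply/derivable1_diffP.
    exact: (@ex_derive _ _ _ _ _ _ _ (flat_derive P _)).
  exact: (continuous_comp cl (cf _)).
- by apply: cvgD; [exact: cg|exact: ch].
- by apply: cvgM; [exact: cg|exact: ch].
Qed.

Lemma elementary_classC f n : elementary f -> classC n setT f.
Proof.
move=> ef s _ x _.
have [g [eg ->]] : exists g, elementary g /\ pds s f = g.
  elim: s => [|i s [g [eg E]]]; first by exists f.
  have [h eh dh] := elementary_derive i eg; exists h; split => //.
  by rewrite /= E; apply/funext => y; rewrite /pd; have [_ ->] := dh y.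
split; first exact: elementary_continuous.
by move=> _ i; have [h _ dh] := elementary_derive i eg; have [] := dh x.
Qed.

End smooth_bumps.

(** * A function orthogonal to all test functions vanishes almost everywhere *)

Section density.
Context {R : realType}.
Local Open Scope complex_scope.

Definition open_box (p q : 'I_3 -> R) : set (R * R * R) :=
  [set x | forall i, p i < Defs.coord i x < q i].

Lemma open_box_open p q : open (open_box p q).
Proof.
have side (i : 'I_3) : open [set x : R * R * R | p i < Defs.coord i x < q i].
  have -> : [set x : R * R * R | p i < Defs.coord i x < q i] =
      [set x | Defs.coord i x < q i] `&` [set x | - Defs.coord i x < - p i].
    by apply/seteqP; split => x /=; rewrite ltrN2; [move=> /andP[]|case=> -> ->].
  apply: openI; apply: open_lt3 => x; first exact: coord3_continuous.
  by apply: cvgN; exact: coord3_continuous.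
pose s i := [set x : R * R * R | p i < Defs.coord i x < q i].
have -> : open_box p q = (s ord0 `&` s (lift ord0 ord0)) `&` s (lift ord0 (lift ord0 ord0)).
  apply/seteqP; split => x; first by move=> H; split; [split|]; exact: H.
  move=> [[h0 h1] h2] [[|[|[|?]]] li] //.
  - by rewrite (_ : Ordinal li = ord0)//; exact: val_inj.
  - by rewrite (_ : Ordinal li = lift ord0 ord0)//; exact: val_inj.
  - by rewrite (_ : Ordinal li = lift ord0 (lift ord0 ord0))//; exact: val_inj.
by do 2 (apply: openI; last exact: side); exact: side.
Qed.

Definition boxes : set (set (T3 R)) := [set A | exists p q, A = open_box p q].

Lemma boxes_setI : setI_closed boxes.
Proof.
move=> _ _ [p [q ->]] [p' [q' ->]].
exists (fun i => Num.max (p i) (p' i)), (fun i => Num.min (q i) (q' i)).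
apply/seteqP; split => x.
  move=> [h h'] i; have /andP[a b] := h i; have /andP[a' b'] := h' i.
  by rewrite gt_max lt_min a a' b b'.
by move=> h; split => i; have := h i; rewrite gt_max lt_min => /andP[/andP[a b] /andP[c d]]; rewrite ?a ?b ?c ?d.
Qed.

Lemma measurable_boxesE : @measurable _ (T3 R) = <<s boxes >>.
Proof.
apply/seteqP; split; last first.
  apply: smallest_sub; first exact: sigma_algebra_measurable.
  by move=> _ [p [q ->]]; apply: open_measurable3; exact: open_box_open.
pose X := g_sigma_algebraType boxes.
have mc (i : 'I_3) : measurable_fun [set: X] (fun x : X => Defs.coord i (x : R * R * R) : measurableTypeR R).
  apply: (measurability _ (RGenOInfty.measurableE R)) => _ [_ [a ->] <-].
  rewrite setTI (_ : _ @^-1` _ = \bigcup_n (open_box (fun j => if j == i then a else - n%:R) (fun=> n%:R))).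
    apply: bigcupT_measurable => n; apply: sub_sigma_algebra.
    by exists (fun j => if j == i then a else - n%:R), (fun=> n%:R).
  apply/seteqP; split => x /=; rewrite in_itv /= andbT.
    move=> ax; pose S := \sum_(j < 3) `|Defs.coord j (x : R * R * R)|.
    exists (Num.truncn S).+1 => // j; have lS := truncnS_gt S.
    have jS : `|Defs.coord j (x : R * R * R)| < (Num.truncn S).+1%:R.
      by apply: le_lt_trans lS; rewrite /S (bigD1 j)//= lerDl sumr_ge0.
    have /andP[c d] : - (Num.truncn S).+1%:R < Defs.coord j (x : R * R * R) < (Num.truncn S).+1%:R.
      by rewrite -ltr_norml.
    by rewrite d andbT; case: eqP => [->|].
  by move=> [n _ /(_ i)]; rewrite eqxx => /andP[].
have mid : measurable_fun [set: X] (fun x : X => (x : T3 R)).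
  have := measurable_fun_pair (measurable_fun_pair (mc ord0) (mc (lift ord0 ord0)))
    (mc (lift ord0 (lift ord0 ord0))).
  by rewrite (_ : (fun x : X => _) = (fun x : X => (x : T3 R)))//; apply/funext => -[[x y] z].
by move=> A mA; have := mid measurableT A mA; rewrite setTI.
Qed.

(** For [t > 0] the values [flat 1 ((n+1) t) = exp (-1 / ((n+1) t))] tend to 1, and for [t <= 0]
    they are 0; the product tends pointwise to the indicator of the open interval. The shift [n.+1]
    keeps the scale positive. *)
Definition bump1 (p q : 'I_3 -> R) n i (x : R * R * R) : R :=
  flat 1 (n.+1%:R * Defs.coord i x + - (n.+1%:R * p i)) *
  flat 1 (- n.+1%:R * Defs.coord i x + n.+1%:R * q i).

Definition bump p q n x :=
  bump1 p q n ord0 x * bump1 p q n (lift ord0 ord0) x * bump1 p q n (lift ord0 (lift ord0 ord0)) x.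

Lemma flat1_itv (s : R) : 0 <= flat 1 s <= 1.
Proof.
rewrite /flat; case: ifP => s0; last by rewrite lexx ler01.
rewrite hornerC mul1r expR_ge0 -[leRHS]expR0 ler_expR oppr_le0 invr_ge0.
exact: ltW.
Qed.

Lemma flat1_cvg (t : R) : (fun n : nat => flat 1 (n.+1%:R * t)) @ \oo --> ((0 < t)%R%:R : R).
Proof.
have [t0|t0] := ltP 0 t; last first.
  rewrite (_ : (fun n : nat => _) = cst (0 : R)); first exact: cvg_cst.
  by apply/funext => n; rewrite /flat ltNge pmulr_rle0 ?t0.
rewrite (_ : (fun n : nat => _) = (fun n => expR (- (harmonic n * t^-1)))); last first.
  by apply/funext => n; rewrite /flat pmulr_rgt0// t0 hornerC mul1r invfM.
rewrite -[X in _ --> X]expR0 -[X in expR X]oppr0 -[X in - X](mul0r t^-1).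
apply: continuous_cvg; first exact: continuous_expR.
by apply: cvgN; apply: cvgM; [exact: cvg_harmonic|exact: cvg_cst].
Qed.

Lemma bump1_itv p q n i x : 0 <= bump1 p q n i x <= 1.
Proof.
rewrite /bump1; set s := n.+1%:R * _ + _; set t := _ + _.
have /andP[a b] := flat1_itv s; have /andP[c d] := flat1_itv t.
by rewrite mulr_ge0// mulr_ile1.
Qed.

Lemma bump_itv p q n x : 0 <= bump p q n x <= 1.
Proof.
rewrite /bump; have /andP[a b] := bump1_itv p q n ord0 x.
have /andP[a' b'] := bump1_itv p q n (lift ord0 ord0) x.
have /andP[a2 b2] := bump1_itv p q n (lift ord0 (lift ord0 ord0)) x.
have ab := mulr_ge0 a a'; have ab1 := mulr_ile1 a a' b b'.
by rewrite (mulr_ge0 ab a2) (mulr_ile1 ab a2 ab1 b2).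
Qed.

Lemma bump1_cvg p q i x : (fun n => bump1 p q n i x) @ \oo --> ((p i < Defs.coord i x < q i)%R%:R : R).
Proof.
rewrite (_ : (_ && _)%:R = (0 < Defs.coord i x - p i)%R%:R * (0 < q i - Defs.coord i x)%R%:R :> R); last first.
  by rewrite !subr_gt0; case: (_ < _); case: (_ < _); rewrite ?mulr1 ?mulr0 ?mul0r.
rewrite (_ : (fun n => _) = (fun n => flat 1 (n.+1%:R * (Defs.coord i x - p i)) *
   flat 1 (n.+1%:R * (q i - Defs.coord i x)))); last first.
  by apply/funext => n; rewrite /bump1; congr (flat _ _ * flat _ _); ring.
by apply: cvgM; exact: flat1_cvg.
Qed.

Lemma bump_out p q n x : ~ open_box p q x -> bump p q n x = 0.
Proof.
move=> nQ; have [i ni] : exists i, ~~ (p i < Defs.coord i x < q i).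
  by apply: contrapT => H; apply: nQ => i; apply/negP => /negP ?; apply: H; exists i.
have b0 : bump1 p q n i x = 0.
  move: ni; rewrite negb_and -!leNgt /bump1 => /orP[h|h].
    rewrite [flat _ (_ * _ + - _)](_ : _ = 0) ?mul0r// /flat ltNge -mulrN -mulrDr.
    by rewrite pmulr_rle0// subr_le0 h.
  rewrite mulrC [flat _ _](_ : _ = 0) ?mul0r// /flat ltNge mulNr addrC -mulrN -mulrDr.
  by rewrite pmulr_rle0// subr_le0 h.
rewrite /bump; case: i ni b0 => [[|[|[|?]]] li] // _ b0.
- by rewrite (_ : ord0 = Ordinal li) ?b0 ?mul0r//; exact: val_inj.
- by rewrite (_ : lift ord0 ord0 = Ordinal li) ?b0 ?mulr0 ?mul0r//; exact: val_inj.
- by rewrite (_ : lift ord0 (lift ord0 ord0) = Ordinal li) ?b0 ?mulr0//; exact: val_inj.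
Qed.

Lemma bump_cvg p q x : (fun n => bump p q n x) @ \oo --> (\1_(open_box p q) x : R).
Proof.
rewrite indicE; have [Qx|nQ] := pselect (open_box p q x); last first.
  rewrite memNset// (_ : (fun n => _) = cst 0); first exact: cvg_cst.
  by apply/funext => n; rewrite bump_out.
have c i : (fun n => bump1 p q n i x) @ \oo --> (1 : R).
  by have := @bump1_cvg p q i x; rewrite Qx.
rewrite mem_set// (_ : true%:R = 1 * 1 * 1 :> R); last by rewrite !mulr1.
by apply: cvgM; [apply: cvgM|]; exact: c.
Qed.

Lemma bump_test p q n : test_fun setT (bump p q n).
Proof.
have e1 i : elementary (bump1 p q n i).
  by apply: elementary_mul; apply: elementary_flat.
split => //.
  by move=> k; apply: elementary_classC; do 2 (apply: elementary_mul => //).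
pose S := \sum_(j < 3) (`|p j| + `|q j|).
have bc : closed (box S).
  apply: compact_closed; [exact: norm_hausdorff|exact: box_compact].
apply: (@subclosed_compact _ _ (box S)); [exact: closed_closure|exact: box_compact|].
rewrite [X in _ `<=` X](_ : _ = closure (box S)); last exact/closure_id.
apply: closure_subset => x /= /eqP bx.
have Qx : open_box p q x by apply: contrapT => nQ; apply: bx; exact: bump_out.
have cS i : `|Defs.coord i x| <= S.
  have /andP[a b] := Qx i; apply: (@le_trans _ _ (`|p i| + `|q i|)).
    rewrite ler_norml; have := ler_norm (q i); have := ler_norm (- p i); rewrite normrN.
    have := normr_ge0 (q i); have := normr_ge0 (p i).
    by move=> *; apply/andP; split; lra.
  rewrite /S (bigD1 i)//= lerDl; apply: sumr_ge0 => j _; exact: addr_ge0.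
by apply/boxP; split; [exact: (cS ord0)|exact: (cS (lift ord0 ord0))|exact: (cS (lift ord0 (lift ord0 ord0)))].
Qed.

Variable Omega : set (R * R * R).
Hypothesis oO : open Omega.
Hypothesis bO : bounded_set Omega.

Let mO : measurable (Omega : set (T3 R)). Proof. exact: open_measurable3. Qed.

Section real_density.
Variable g : R * R * R -> R.
Hypothesis ig : (@leb3 R).-integrable Omega (EFin \o g).
Hypothesis Hg : forall eta, test_fun setT eta ->
  (\int[leb3]_(x in (Omega : set (T3 R))) (g x * eta x)%:E = 0)%E.

Let mbox p q : measurable (open_box p q : set (T3 R)).
Proof. by apply: open_measurable3; exact: open_box_open. Qed.

Lemma integral_open_box p q :
  (\int[leb3]_(x in (Omega `&` open_box p q : set (T3 R))) (g x)%:E = 0)%E.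
Proof.
have mg : measurable_fun (Omega : set (T3 R)) g by apply/measurable_EFinP; case/integrableP: ig.
have mb n : measurable_fun (Omega : set (T3 R)) (bump p q n).
  apply: measurable_funTS; apply: continuous_measurable3.
  exact: C1_continuous (test_fun_C1 (bump_test p q n)).
have mi : measurable_fun (Omega : set (T3 R)) (\1_(open_box p q) : T3 R -> R).
  by apply: measurable_funTS; apply: measurable_indic; exact: mbox.
have := @dominated_convergence _ _ _ (@leb3 R) Omega mO (fun n x => (g x * bump p q n x)%:E)
  (fun x => (g x * \1_(open_box p q) x)%:E) (fun x => (`|g x|)%:E).
case.
- by move=> n; apply/measurable_EFinP; exact: (measurable_funM mg (mb n)).
- by apply/measurable_EFinP; exact: (measurable_funM mg mi).
- apply: aeW => x _; apply: cvg_EFin; first exact: nearW.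
  by apply: cvgM; [exact: cvg_cst|exact: bump_cvg].
- by have := integrable_abse ig; apply: eq_integrable => // x _ /=.
- apply: aeW => x n _; rewrite lee_fin normrM.
  have /andP[b0 b1] := bump_itv p q n x.
  by rewrite (ger0_norm b0) ler_piMr.
move=> _ _; rewrite (_ : [sequence _]_n = cst 0%E); last first.
  by apply/funext => n; exact: Hg (bump_test p q n).
move=> cv; rewrite integral_mkcondr.
transitivity (\int[leb3]_(x in (Omega : set (T3 R))) (g x * \1_(open_box p q) x)%:E)%E; last first.
  by apply: (cvg_unique (@ereal_hausdorff R) cv); exact: cvg_cst.
apply: eq_integral => x _.
by rewrite patchE indicE; case: ifP => _ /=; rewrite ?mulr1 ?mulr0.
Qed.

(** Open boxes form a pi-system generating the Borel sets, so vanishing integrals over boxes extend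
    to all measurable sets by Dynkin's argument. The test functions live on the whole space and may
    reach the boundary, so the boxes need not lie in [Omega]. *)
Lemma real_density : {ae @leb3 R, forall x, Omega x -> g x = 0}.
Proof.
have mg : measurable_fun (Omega : set (T3 R)) (EFin \o g) by case/integrableP: ig.
have IO : (\int[leb3]_(x in (Omega : set (T3 R))) (g x)%:E = 0)%E.
  have [M [M0 HM]] := bounded_coords bO.
  rewrite (_ : Omega = Omega `&` open_box (fun=> - (M + 1)) (fun=> M + 1)).
    exact: integral_open_box.
  by apply/esym/setIidl => x /HM[a b c] [[|[|[|?]]] li] //; rewrite -ltr_norml /Defs.coord /=; lra.
pose P (A : set (T3 R)) := (\int[leb3]_(x in (Omega `&` A : set (T3 R))) (g x)%:E = 0)%E.
have I0 (A : set (T3 R)) : measurable A -> P A.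
  rewrite measurable_boxesE.
  apply: (@dynkin_induction _ _ boxes P measurable_boxesE boxes_setI).
  - by rewrite /P setIT.
  - by move=> _ [p [q ->]]; exact: integral_open_box.
  - move=> S mS IS.
    have EO : (Omega `&` S) `|` (Omega `&` ~` S) = Omega by rewrite -setIUr setUv setIT.
    have mOS : measurable (Omega `&` S : set (T3 R)) by exact: measurableI.
    have mOC : measurable (Omega `&` ~` S : set (T3 R)).
      by apply: measurableI => //; exact: measurableC.
    have := @integral_setU _ _ _ (@leb3 R) _ _ (EFin \o g) mOS mOC.
    rewrite EO => /(_ mg); rewrite IO IS add0e => h; apply/esym; apply: h.
    by apply/eqP; rewrite setIACA setICr setI0.
  - move=> F mF tF IF; rewrite /P setI_bigcupr integral_bigcup.
    + by apply: eseries0 => n _ _; exact: IF.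
    + exact: trivIset_setIl.
    + by move=> n; exact: measurableI.
    + apply: (integrableS mO) => //; last by move=> x [n _ []].
      by apply: bigcupT_measurable => n; exact: measurableI.
have /= := @integral_ae_eq _ _ _ (@leb3 R) _ mO (cst 0%E) (EFin \o g) ig (measurable_cst _).
move=> h; apply: ae_imp (h _) => [x H /H[]//|E EO mE].
by rewrite integral0 -(I0 _ mE) (setIidr EO).
Qed.

End real_density.

Lemma bounded_leb3_fin : (@leb3 R Omega < +oo)%E.
Proof.
have [M [M0 HM]] := bounded_coords bO.
apply: (@le_lt_trans _ _ (@leb3 R (box M))).
  apply: le_measure; rewrite ?inE; [exact: mO|exact: measurable_box|].
  by move=> x /HM ?; apply/boxP.
by rewrite /box (@leb3_box _ (- M) M) ?ltry//; [lra|by right].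
Qed.

Lemma test_density f : inL2 Omega f ->
  (forall phi, ctest_fun setT phi -> inner Omega f phi = 0) ->
  {ae @leb3 R, forall x, Omega x -> f x = 0}.
Proof.
move=> Lf Hf.
(* [Omega] has finite measure; pairing with 1 turns square integrability of [f] into
   integrability. *)
have L1 : inL2 Omega (fun=> 1).
  apply/inL2P; split; first exact: cmeas_cst.
  rewrite /csq integral_cst//; apply: lte_mul_pinfty; [by rewrite lee_fin sqmod_ge0|by []|exact: bounded_leb3_fin].
have [iR iI] := cintable_mul mO Lf L1.
have test (eta : R * R * R -> R) : test_fun setT eta -> ctest_fun setT (fun x => (eta x)%:C).
  by move=> te; split; [exact: te|exact: (ctest0 setT).2].
have Leta (eta : R * R * R -> R) : test_fun setT eta -> inL2 Omega (fun x => (eta x)%:C).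
  by move=> te; have [a _] := ctest_inL2 mO (test _ te); exact: a.
have fin0 (h : R * R * R -> R) : (@leb3 R).-integrable Omega (EFin \o h) ->
    Rintegral leb3 Omega h = 0 -> (\int[leb3]_(x in (Omega : set (T3 R))) (h x)%:E = 0)%E.
  by move=> ih; rewrite /Rintegral => h0; rewrite -[LHS]fineK ?h0//; exact: integrable_fin_num ih.
apply: ae_imp2 (@real_density (fun x => complex.Re (f x)) _ _) (@real_density (fun x => complex.Im (f x)) _ _).
- by move=> x hr hi Ox; apply: c_ext; [exact: hr|exact: hi].
- by apply: eq_integrable iR => // x _ /=; rewrite mulr1.
- move=> eta te; have [jR _] := cintable_inner mO Lf (Leta _ te).
  have /(congr1 (@complex.Re R)) := Hf _ (test _ te).
  rewrite /inner /cint /= => h0; rewrite -[RHS](fin0 _ jR h0).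
  by apply: eq_integral => x _; rewrite /= !cpartE /= oppr0 mulr0 subr0.
- by apply: eq_integrable iI => // x _ /=; rewrite mulr1.
- move=> eta te; have [_ jI] := cintable_inner mO Lf (Leta _ te).
  have /(congr1 (@complex.Im R)) := Hf _ (test _ te).
  rewrite /inner /cint /= => h0; rewrite -[RHS](fin0 _ jI h0).
  by apply: eq_integral => x _; rewrite /= !cpartE /= oppr0 mulr0 add0r.
Qed.

End density.

(** * Weighted L^2 forms and their bounds *)

Section weighted_forms.
Context {R : realType}.
Variable Omega : set (T3 R).
Hypothesis mO : measurable Omega.
Local Open Scope complex_scope.
Implicit Types (f g : R * R * R -> R[i]) (w : R * R * R -> R).

Lemma inner_ae_eq f f' g : inL2 Omega f -> inL2 Omega f' -> inL2 Omega g ->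
  {ae @leb3 R, forall x, Omega x -> f x = f' x} -> inner Omega f g = inner Omega f' g.
Proof.
move=> Lf Lf' Lg H; have [jR jI] := cintable_inner mO Lf Lg.
have [jR' jI'] := cintable_inner mO Lf' Lg.
have key (h h' : R * R * R -> R) : (@leb3 R).-integrable Omega (EFin \o h) ->
    (@leb3 R).-integrable Omega (EFin \o h') -> {ae @leb3 R, forall x, Omega x -> h x = h' x} ->
    Rintegral leb3 Omega h = Rintegral leb3 Omega h'.
  move=> /integrableP[mh _] /integrableP[mh' _] hh; congr fine.
  by apply: ae_eq_integral => //; apply: ae_imp hh => x E /E ->.
by congr (_ +i* _); apply: key => //; apply: ae_imp H => x E /E ->.
Qed.

Lemma inner_ae0 f g : inL2 Omega f -> inL2 Omega g ->
  {ae @leb3 R, forall x, Omega x -> f x = 0} -> inner Omega f g = 0.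
Proof.
move=> Lf Lg H; rewrite (inner_ae_eq Lf (@inL2_0 R Omega) Lg H) -[RHS](cint0 mO).
by apply: cint_eq => x _; rewrite mul0r.
Qed.

Lemma inner_wlinl w c f f' g : inLoo Omega w -> inL2 Omega f -> inL2 Omega f' -> inL2 Omega g ->
  inner Omega (fun x => (w x)%:C * (c * f x + f' x)) g =
  c * inner Omega (fun x => (w x)%:C * f x) g + inner Omega (fun x => (w x)%:C * f' x) g.
Proof.
move=> Lw Lf Lf' Lg; rewrite -(inner_linl mO) //; try exact: inLoo_mul.
by apply: cint_eq => x _; ring.
Qed.

Lemma inner_wsym w f g : inLoo Omega w -> inL2 Omega f -> inL2 Omega g ->
  inner Omega (fun x => (w x)%:C * g x) f = conjc (inner Omega (fun x => (w x)%:C * f x) g).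
Proof.
move=> Lw Lf Lg; rewrite -(inner_conj mO) //; last exact: inLoo_mul.
apply: cint_eq => x _; apply: c_ext; rewrite !cpartE /=; ring.
Qed.

Lemma inner_wle w w' f : inLoo Omega w -> inLoo Omega w' -> inL2 Omega f ->
  {ae @leb3 R, forall x, Omega x -> w x <= w' x} ->
  complex.Re (inner Omega (fun x => (w x)%:C * f x) f) <=
  complex.Re (inner Omega (fun x => (w' x)%:C * f x) f).
Proof.
move=> Lw Lw' Lf H; rewrite -subr_ge0.
have [j _] := cintable_inner mO (inLoo_mul mO Lw Lf) Lf.
have [j' _] := cintable_inner mO (inLoo_mul mO Lw' Lf) Lf.
rewrite /inner /cint /= -RintegralB//.
pose h x := complex.Re ((w' x)%:C * f x * conjc (f x)) - complex.Re ((w x)%:C * f x * conjc (f x)).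
have ih : (@leb3 R).-integrable Omega (EFin \o h).
  by have := integrableB mO j' j; apply: eq_integrable => // x _; rewrite /= EFinB.
have mh : measurable_fun Omega (EFin \o h) by case/integrableP: ih.
(* [h] is nonnegative only almost everywhere; replacing it by its modulus does not change the
   integral. *)
rewrite [leRHS](_ : _ = Rintegral leb3 Omega (fun x => `|h x|)); first exact: Rintegral_ge0.
congr fine; apply: ae_eq_integral => //.
  by apply/measurable_EFinP; apply: measurableT_comp => //; exact/measurable_EFinP.
apply: ae_imp H => x E /E ww.
have h0 : 0 <= h x.
  rewrite /h !cpartE /= (_ : _ - _ = (w' x - w x) * sqmod (f x)); last by rewrite /sqmod; ring.
  by rewrite mulr_ge0 ?sqmod_ge0// subr_ge0.
by congr EFin; rewrite ger0_norm.
Qed.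

Definition sqn f := complex.Re (inner Omega f f).

Lemma sqnE f : inL2 Omega f -> sqL2 Omega f = (sqn f)%:E.
Proof.
move=> /inL2P[mf ff]; rewrite /sqn /inner /cint /= /Rintegral.
rewrite (_ : (\int[leb3]_(x in Omega) _)%E = csq (@leb3 R) Omega f); last first.
  by apply: eq_integral => x _; rewrite /sqmod !cpartE; congr EFin; ring.
by rewrite fineK// ge0_fin_numE// csq_ge0.
Qed.

Lemma sqn_ge0 f : inL2 Omega f -> 0 <= sqn f.
Proof. by move=> Lf; rewrite -lee_fin -sqnE//; exact: (csq_ge0 (@leb3 R)). Qed.

Lemma sqn_eq0 f : inL2 Omega f -> sqn f = 0 -> {ae @leb3 R, forall x, Omega x -> f x = 0}.
Proof.
move=> Lf f0; apply/(csq_eq0 (@leb3 R) mO (inL2_cmeas Lf)).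
by have := sqnE Lf; rewrite f0.
Qed.

Lemma sqnZ c f : inL2 Omega f -> sqn (fun x => c * f x) = sqmod c * sqn f.
Proof.
move=> Lf; rewrite /sqn (innerZl mO)//; last exact: inL2Z.
rewrite (inner_conj mO (inL2Z mO c Lf) Lf) (innerZl mO)//.
have : complex.Im (inner Omega f f) = 0.
  have := inner_conj mO Lf Lf => /(congr1 (@complex.Im R)); rewrite cImJ; lra.
by rewrite !cpartE /sqmod => ->; ring.
Qed.

Lemma inLoo_cst (M : R) : inLoo Omega (fun=> M).
Proof.
split; first exact: measurable_cst.
by exists `|M|; apply: aeW.
Qed.

Lemma inLoo_sqr w : inLoo Omega w -> inLoo Omega (fun x => w x * w x).
Proof.
move=> [mw [M HM]]; split; first exact: (measurable_funM mw mw).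
exists (M * M); apply: ae_imp HM => x H /H wM; rewrite normrM.
by apply: ler_pM.
Qed.

Lemma inLooZ (c : R) w : inLoo Omega w -> inLoo Omega (fun x => c * w x).
Proof.
move=> [mw [M HM]]; split; first exact: (measurable_funM (measurable_cst c) mw).
exists (`|c| * M); apply: ae_imp HM => x H /H wM; rewrite normrM.
by apply: ler_wpM2l.
Qed.

Lemma sqn_wle w M f : inLoo Omega w -> inL2 Omega f ->
  {ae @leb3 R, forall x, Omega x -> w x <= M} ->
  complex.Re (inner Omega (fun x => (w x)%:C * f x) f) <= M * sqn f.
Proof.
move=> Lw Lf H; apply: le_trans (inner_wle Lw (inLoo_cst M) Lf H) _.
by rewrite (innerZl mO)// !cpartE /= mul0r subr0.
Qed.

Lemma sqn_wge w m f : inLoo Omega w -> inL2 Omega f ->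
  {ae @leb3 R, forall x, Omega x -> m <= w x} ->
  m * sqn f <= complex.Re (inner Omega (fun x => (w x)%:C * f x) f).
Proof.
move=> Lw Lf H; apply: le_trans _ (inner_wle (inLoo_cst m) Lw Lf H).
by rewrite (innerZl mO)// !cpartE /= mul0r subr0.
Qed.

Lemma sqn_mul_le w M f : inLoo Omega w -> inL2 Omega f ->
  {ae @leb3 R, forall x, Omega x -> 0 < w x <= M} ->
  sqn (fun x => (w x)%:C * f x) <= M * complex.Re (inner Omega (fun x => (w x)%:C * f x) f).
Proof.
move=> Lw Lf H.
rewrite (_ : sqn _ = complex.Re (inner Omega (fun x => (w x * w x)%:C * f x) f)); last first.
  by congr complex.Re; apply: cint_eq => x _; apply: c_ext; rewrite !cpartE /=; ring.
apply: le_trans (inner_wle (inLoo_sqr Lw) (inLooZ M Lw) Lf _) _.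
  by apply: ae_imp H => x h /h /andP[w0 wM]; apply: ler_wpM2r => //; exact: ltW.
rewrite [X in complex.Re X <= _](_ : _ = M%:C * inner Omega (fun x => (w x)%:C * f x) f).
  by rewrite !cpartE /= mul0r subr0.
rewrite -(innerZl mO)//; last exact: inLoo_mul.
by apply: cint_eq => x _; apply: c_ext; rewrite !cpartE /=; ring.
Qed.

End weighted_forms.

(** The accumulation point may be 0 but not negative, and squaring is injective on the nonnegative
    numbers, so distinct frequencies stay distinct. *)
Lemma limit_point_sqr (R : realType) (K : set R) (k0 : R) : K `<=` [set k | 0 < k] ->
  limit_point K k0 -> limit_point [set k ^+ 2 | k in K] (k0 ^+ 2).
Proof.
move=> K0 HK.
have k00 : 0 <= k0.
  rewrite leNgt; apply/negP => kn.
  have [y [_ /K0 /= y0]] := HK _ (@lt_nbhsl _ _ _ kn); lra.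
move=> U HU; have c : {for k0, continuous (fun k : R => k ^+ 2)} by exact: exprn_continuous.
have [y [yk Ky Uy]] := HK _ (c _ HU); exists (y ^+ 2); split => //; last by exists y.
by rewrite eqrXn2// ltW//; exact: K0.
Qed.

(** * The operator of the interior equation with zero exterior field *)

Section interior_operator.
Context {R : realType}.
Variables (Omega : set (R * R * R)) (a b : R * R * R -> R).
Hypothesis oO : open Omega.
Hypothesis bO : bounded_set Omega.
Hypothesis lO : lipschitz_boundary Omega.
Hypothesis La : inLoo Omega a.
Hypothesis Lb : inLoo Omega b.
Variable a0 : R.
Hypothesis a00 : 0 < a0.
Hypothesis Ha : {ae @leb3 R, forall x, Omega x -> a0 <= a x}.
Hypothesis Hb : {ae @leb3 R, forall x, Omega x -> 0 < b x}.
Local Open Scope complex_scope.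
Implicit Types (X Y F : R * R * R -> R[i]) (W v : H1 Omega).

Let mO : measurable (Omega : set (T3 R)). Proof. exact: open_measurable3. Qed.

Definition aform W v : R[i] :=
  \sum_(i < 3) inner Omega (fun x => (a x)%:C * h1grad W i x) (h1grad v i).

Definition bmul X : R * R * R -> R[i] := fun x => (b x)%:C * X x.

(** The real part gives a symmetric real form, as the abstract argument expects: only real scalars
    are ever used there. *)
Definition bip X Y : R := complex.Re (inner Omega (bmul X) Y).

Lemma aform_lin c W W' v : aform (H1_lin oO c W W') v = c * aform W v + aform W' v.
Proof.
rewrite /aform mulr_sumr -big_split; apply: eq_bigr => i _.
exact: (inner_wlinl mO c La (h1grad_L2 W i) (h1grad_L2 W' i) (h1grad_L2 v i)).
Qed.

Lemma aformC W v : aform v W = conjc (aform W v).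
Proof.
rewrite /aform raddf_sum; apply: eq_bigr => i _.
exact: (inner_wsym mO La (h1grad_L2 W i) (h1grad_L2 v i)).
Qed.

Lemma inL2_bmul X : inL2 Omega X -> inL2 Omega (bmul X).
Proof. exact: (inLoo_mul mO Lb). Qed.

Lemma inner_bmul_lin c X Y v : inL2 Omega X -> inL2 Omega Y ->
  inner Omega (bmul (fun x => c * X x + Y x)) v = c * inner Omega (bmul X) v + inner Omega (bmul Y) v.
Proof. by move=> LX LY; exact: (inner_wlinl mO c Lb LX LY (h1_L2 v)). Qed.

Lemma bip_lin (c : R) X Y Z : inL2 Omega X -> inL2 Omega Y -> inL2 Omega Z ->
  bip (fun x => c%:C * X x + Y x) Z = bip Y Z + c * bip X Z.
Proof.
by move=> LX LY LZ; rewrite /bip (inner_wlinl mO c%:C Lb LX LY LZ) !cpartE /=; ring.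
Qed.

Lemma bipC X Y : bip X Y = bip Y X.
Proof.
rewrite /bip /inner /cint /=; apply: eq_Rintegral => x _.
by rewrite /bmul !cpartE /=; ring.
Qed.

Lemma b_bound : exists2 M, 0 <= M & {ae @leb3 R, forall x, Omega x -> 0 < b x <= M}.
Proof.
have [_ [M HM]] := Lb; exists `|M| => //.
apply: ae_imp2 Hb HM => x b0 bM Ox; rewrite b0//=.
by apply: le_trans (le_trans (ler_norm _) (bM Ox)) _; exact: ler_norm.
Qed.

Lemma bip_ge0 X : inL2 Omega X -> 0 <= bip X X.
Proof.
move=> LX; have := sqn_wge mO (m := 0) Lb LX; rewrite mul0r; apply.
by apply: ae_imp Hb => x h /h; exact: ltW.
Qed.

Lemma bip_eq0 X : inL2 Omega X -> bip X X = 0 -> {ae @leb3 R, forall x, Omega x -> X x = 0}.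
Proof.
move=> LX X0; have [M M0 HM] := b_bound.
have := sqn_mul_le mO Lb LX HM; rewrite [complex.Re _]X0 mulr0 => le0.
have LbX := inL2_bmul LX.
have /(sqn_eq0 mO LbX) : sqn Omega (bmul X) = 0 by apply/eqP; rewrite eq_le le0 sqn_ge0.
apply: ae_imp2 Hb => x b0 bX Ox; have /eqP := bX Ox.
by rewrite mulf_eq0 => /orP[/eqP/(congr1 (@complex.Re R)) /= h|/eqP//]; have := b0 Ox; rewrite h ltxx.
Qed.

(* The test functions range over all of H^1, not only over those of zero trace:
   [X], extended by 0, solves the equation in the whole space. *)
Definition zgraph X F := exists W, [/\ h1val W = X, is_trace W (fun=> 0), inL2 Omega F &
  forall v psi, is_trace v psi -> aform W v = inner Omega (bmul F) v].

Lemma zgraph_L2 X F : zgraph X F -> inL2 Omega X /\ inL2 Omega F.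
Proof. by move=> [W [<- _ LF _]]; split => //; exact: h1_L2. Qed.

Lemma zgraph_lin (c : R) X Y F H : zgraph X F -> zgraph Y H ->
  zgraph (fun x => c%:C * Y x + X x) (fun x => c%:C * H x + F x).
Proof.
move=> [W [<- tW LF HW]] [V [<- tV LH HV]]; exists (H1_lin oO c%:C V W); split => //.
- have := is_trace_lin oO c%:C tV tW.
  by rewrite (_ : (fun x => _) = (fun=> 0))//; apply/funext => x; rewrite mulr0 addr0.
- exact: inL2_lin.
- move=> v psi tv; rewrite aform_lin (HW _ _ tv) (HV _ _ tv).
  by rewrite (inner_bmul_lin _ _ LH LF).
Qed.

(** Each field is an admissible test function in the equation of the other, and [a] is real. *)
Lemma zgraph_sym X F Y H : zgraph X F -> zgraph Y H -> bip F Y = bip X H.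
Proof.
move=> [W [<- tW LF HW]] [V [<- tV LH HV]].
by rewrite (bipC W) /bip -(HW _ _ tV) -(HV _ _ tW) aformC cReJ.
Qed.

Lemma zgraph_energy X F : zgraph X F -> exists2 W : H1 Omega, h1val W = X &
  is_trace W (fun=> 0) /\ a0 * (\sum_(i < 3) sqn Omega (h1grad W i)) <= bip F X.
Proof.
move=> [W [WX tW LF HW]]; exists W => //; split => //.
rewrite -WX /bip -(HW _ _ tW) /aform raddf_sum mulr_sumr; apply: ler_sum => i _.
exact: (sqn_wge mO La (h1grad_L2 W i) Ha).
Qed.

(** For [mu <= 0] the term [- mu * bip X X] only helps: the energy is bounded by [bip Z X] with
    [Z = F - mu X], and Poincare's inequality bounds [bip X X] by the energy. *)
Lemma zgraph_reg_le0 mu : mu <= 0 -> exists C : R, forall X F, zgraph X F ->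
  bip X X <= C * bip (fun x => (- mu)%:C * X x + F x) (fun x => (- mu)%:C * X x + F x).
Proof.
move=> mu0; have [P [P0 HP]] := trace0_poincare oO bO lO.
have [M M0 HM] := b_bound; pose Q := M * (P / a0); have Q0 : 0 <= Q by rewrite mulr_ge0// divr_ge0// ltW.
exists (Q ^+ 2) => X F G; have [LX LF] := zgraph_L2 G.
have [W WX [tW eW]] := zgraph_energy G.
pose Z : R * R * R -> R[i] := fun x => (- mu)%:C * X x + F x; rewrite -/Z.
have LZ : inL2 Omega Z by exact: inL2_lin.
have X0 := bip_ge0 LX.
have EZ : bip Z X = bip F X - mu * bip X X by rewrite /Z bip_lin//; ring.
have := HP _ tW; rewrite WX (sqnE LX).
rewrite (eq_bigr (fun i => (sqn Omega (h1grad W i))%:E)); last by move=> i _; rewrite sqnE//; exact: h1grad_L2.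
rewrite sumEFin -EFinM lee_fin; set S := \sum_i _ => leS.
have XS : bip X X <= M * sqn Omega X.
  by apply: (sqn_wle mO Lb LX); apply: ae_imp HM => x h /h /andP[].
have SZ : a0 * S <= bip Z X by rewrite EZ; apply: le_trans eW _; rewrite lerDl -mulNr mulr_ge0// oppr_ge0.
have QZ : bip X X <= Q * bip Z X.
  apply: le_trans XS _; rewrite /Q -mulrA; apply: ler_wpM2l => //.
  apply: le_trans leS _; rewrite -mulrA; apply: ler_wpM2l => //.
  by rewrite ler_pdivlMl.
(* Expanding [bip Y Y >= 0] with [bip X X <= Q * bip Z X] yields [bip X X <= Q^2 * bip Z Z], in
   place of Cauchy-Schwarz. *)
pose Y : R * R * R -> R[i] := fun x => (- Q)%:C * Z x + X x.
have LY : inL2 Omega Y by exact: inL2_lin.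
have := bip_ge0 LY; rewrite {1}/Y bip_lin// (bipC X) (bipC Z) {1 2}/Y !bip_lin//.
rewrite (bipC X Z) expr2; nra.
Qed.

(** A field of the graph solves the direct problem at frequency [k] with source [b Z / h(k)], and
    the continuity constant of that problem is the lower bound. The two factors [M] convert between
    the plain and the [b]-weighted norm. *)
Lemma zgraph_reg_gt0 h k : 0 < k -> h k != 0 -> exterior_wellposed Omega k ->
  direct_wellposed Omega a b h k -> exists C : R, forall X F, zgraph X F ->
  bip X X <= C * bip (fun x => (- k ^+ 2)%:C * X x + F x) (fun x => (- k ^+ 2)%:C * X x + F x).
Proof.
move=> k0 hk wp [_ _ [C HC]]; have [M M0 HM] := b_bound.
exists (M * (`|C| * (sqmod (h k)^-1 * M))) => X F G; have [LX LF] := zgraph_L2 G.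
pose Z : R * R * R -> R[i] := fun x => (- k ^+ 2)%:C * X x + F x; rewrite -/Z.
have LZ : inL2 Omega Z by exact: inL2_lin.
have LbZ := inL2_bmul LZ; have [W [WX tW _ HW]] := G.
pose f : R * R * R -> R[i] := fun x => (h k)^-1 * bmul Z x.
have Lf : inL2 Omega f by exact: inL2Z.
have sW : direct_solution a b h k f W.
  (* Zero trace, hence zero exterior field and zero normal derivative. *)
  exists (fun=> 0), (fun=> 0); split => //; split; first by apply: DtN0.
  move=> v psi tv; rewrite -/(aform W v) (HW _ _ tv) subr0 WX.
  rewrite (innerZl mO _ LbZ (h1_L2 v)) mulrA divff// mul1r (inner_bmul_lin _ _ LX LF).
  by rewrite addrC (_ : (- k ^+ 2)%:C = - (k ^+ 2)%:C) ?mulNr//; apply: c_ext; rewrite /= ?oppr0.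
have := HC _ _ Lf sW; rewrite (sqnE Lf).
have Xle : (sqL2 Omega X <= sqH1 Omega W (h1grad W))%E.
  by rewrite /sqH1 WX leeDl// sume_ge0// => i _; exact: (csq_ge0 (@leb3 R)).
move=> /(le_trans Xle); rewrite (sqnE LX) -EFinM lee_fin (sqnZ mO _ LbZ) => leX.
have XS : bip X X <= M * sqn Omega X.
  by apply: (sqn_wle mO Lb LX); apply: ae_imp HM => x g /g /andP[].
have ZS : sqn Omega (bmul Z) <= M * bip Z Z by exact: (sqn_mul_le mO Lb LZ HM).
have s0 := sqn_ge0 LbZ; have h0 := sqmod_ge0 (h k)^-1.
apply: le_trans XS _; rewrite -!mulrA; apply: ler_wpM2l => //; apply: le_trans leX _.
apply: (@le_trans _ _ (`|C| * (sqmod (h k)^-1 * sqn Omega (bmul Z)))).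
  by apply: ler_wpM2r; [exact: mulr_ge0|exact: ler_norm].
by apply: ler_wpM2l => //; apply: ler_wpM2l.
Qed.

(** Testing the equation with the field itself gives zero energy, so the weak gradient vanishes
    almost everywhere; then [b F] is orthogonal to every test function. *)
Lemma zgraph_null X F : zgraph X F -> bip X X = 0 ->
  {ae @leb3 R, forall x, Omega x -> bmul F x = 0}.
Proof.
move=> G X0; have [LX LF] := zgraph_L2 G; have LbF := inL2_bmul LF.
have aX := bip_eq0 LX X0; have [W [WX tW _ HW]] := G.
have bFX : bip F X = 0.
  by rewrite bipC /bip (inner_ae0 mO (inL2_bmul LX) LF)//; apply: ae_imp aX => x h /h; rewrite /bmul => ->; rewrite mulr0.
have [V VX [tV eV]] := zgraph_energy G.
have gW i : {ae @leb3 R, forall x, Omega x -> h1grad W i x = 0}.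
  apply: (sqn_eq0 mO (h1grad_L2 W i)).
  have := sqn_wge mO La (h1grad_L2 W i) Ha.
  pose t j : R := complex.Re (inner Omega (fun x => (a x)%:C * h1grad W j x) (h1grad W j)).
  have t0 j : 0 <= t j.
    apply: le_trans (sqn_wge mO La (h1grad_L2 W j) Ha).
    by apply: mulr_ge0; [exact: ltW|exact: (sqn_ge0 (h1grad_L2 W j))].
  have St : \sum_(j < 3) t j = 0.
    transitivity (complex.Re (aform W W)); first by rewrite /aform raddf_sum.
    by rewrite (HW _ _ tW) WX; exact: bFX.
  rewrite -/(t i) => ai; have ti : t i <= 0.
    by rewrite -St (bigD1 i)//= lerDl; exact: sumr_ge0.
  apply/eqP; rewrite eq_le (sqn_ge0 (h1grad_L2 W i)) andbT -(pmulr_rle0 _ a00).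
  exact: le_trans ai ti.
apply: test_density => // phi tp.
rewrite -(HW _ _ (is_trace_test oO tp)) /aform big1// => i _.
apply: (inner_ae0 mO) => //; [exact: (inLoo_mul mO La (h1grad_L2 W i))|exact: h1grad_L2|].
by apply: ae_imp (gW i) => x g /g ->; rewrite mulr0.
Qed.

Lemma direct_difference h k f1 f2 (u1 u2 : H1 Omega) g : h k != 0 -> exterior_wellposed Omega k ->
  inL2 Omega f1 -> inL2 Omega f2 ->
  direct_solution a b h k f1 u1 -> direct_solution a b h k f2 u2 ->
  is_trace u1 g -> is_trace u2 g ->
  exists2 W : H1 Omega, is_trace W (fun=> 0) & forall v psi, is_trace v psi ->
    aform W v = inner Omega (fun x => -1 * f2 x + f1 x) v + (k ^+ 2)%:C * inner Omega (bmul W) v.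
Proof.
move=> hk wp L1 L2 [g1 [T1 [t1 [D1 E1]]]] [g2 [T2 [t2 [D2 E2]]]] tg1 tg2.
(* Each solution carries its own representative of its trace; both are compared with the common
   [g]. *)
have g12 (c : lip_chart Omega) : sqL2_chart c (fun x => -1 * g1 x + g2 x) = 0%E.
  have md := @measurable_disk R Omega c.
  have m1 := cmeas_lin (-1) (cmeas_bdry c t1.1) (cmeas_bdry c tg1.1).
  have m2 := cmeas_lin (-1) (cmeas_bdry c tg2.1) (cmeas_bdry c t2.1).
  have := csq_lin (@leb2 R) 1 md m1 m2.
  rewrite [X in (_ * X + _)%E](is_trace_unique oO bO t1 tg1 c).
  rewrite [X in (_ + _ * X)%E](is_trace_unique oO bO tg2 t2 c) !mule0 adde0 => le0.
  apply/eqP; rewrite eq_le; apply/andP; split; last exact: (csq_ge0 (@leb2 R)).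
  apply: le_trans le0; rewrite le_eqVlt; apply/orP; left; apply/eqP.
  by apply: (csq_eq (@leb2 R)) => y _; ring.
have TT v psi : is_trace v psi -> T1 psi = T2 psi.
  move=> tv; apply: (pairing_eq oO bO D1.1 D2.1 _ tv).
  exact: (DtN_eq oO bO wp D1 D2 g12).
(* [H1_lin] forms [c * u + u'], so the quotient of the difference by [h k] is written
   [(1/h - 1) D + D]. *)
pose D := H1_lin oO (-1) u2 u1; pose W := H1_lin oO ((h k)^-1 - 1) D D.
have tD : is_trace D (fun x => -1 * g x + g x) by exact: is_trace_lin.
exists W.
  have := is_trace_lin oO ((h k)^-1 - 1) tD tD.
  by rewrite (_ : (fun x => _) = (fun=> 0))//; apply/funext => x; ring.
move=> v psi tv.
have e1 : aform u1 v = h k * inner Omega f1 v + (k ^+ 2)%:C * inner Omega (bmul u1) v + T1 psi.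
  by rewrite -(E1 _ _ tv) /aform /bmul; ring.
have e2 : aform u2 v = h k * inner Omega f2 v + (k ^+ 2)%:C * inner Omega (bmul u2) v + T1 psi.
  by rewrite (TT _ _ tv) -(E2 _ _ tv) /aform /bmul; ring.
have bW : inner Omega (bmul W) v = ((h k)^-1 - 1) * inner Omega (bmul D) v + inner Omega (bmul D) v.
  by rewrite -inner_bmul_lin//; exact: (h1_L2 D).
have bD : inner Omega (bmul D) v = -1 * inner Omega (bmul u2) v + inner Omega (bmul u1) v.
  by rewrite -inner_bmul_lin//; [exact: (h1_L2 u2)|exact: (h1_L2 u1)].
rewrite aform_lin aform_lin bW bD e1 e2 (inner_linl mO _ L2 L1 (h1_L2 v)).
by field.
Qed.

End interior_operator.

Theorem theorem5p2 (R : realType) (Omega : set (R * R * R))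
    (a b : R * R * R -> R) (h : R -> R[i])
    (hOmega : bounded_lipschitz_domain Omega)
    (hab : admissible_coeffs Omega a b)
    (h_neq0 : forall k : R, 0 < k -> h k != 0)
    (h_ext : forall k : R, 0 < k -> exterior_wellposed Omega k)
    (h_direct : forall k : R, 0 < k -> direct_wellposed Omega a b h k)
    (K : set R) (K_pos : K `<=` [set k | 0 < k])
    (K_acc : exists k0 : R, limit_point K k0)
    (h_analytic : analytic_on_pos h)
    (f1 f2 : R * R * R -> R[i])
    (hf1 : inL2 Omega f1) (hf2 : inL2 Omega f2)
    (u1 u2 : R -> H1 Omega)
    (hu1 : forall k : R, 0 < k -> direct_solution a b h k f1 (u1 k))
    (hu2 : forall k : R, 0 < k -> direct_solution a b h k f2 (u2 k))
    (h_coincide : forall k : R, K k ->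
       exists g, is_trace (u1 k) g /\ is_trace (u2 k) g) :
  ae_eq_on Omega f1 f2.
Proof.
have [oO _ bO lO] := hOmega; have [[La Lb] [a0 [a00 Ha]] [Hb Lb1] _] := hab.
have mO : measurable (Omega : set (T3 R)) by exact: open_measurable3.
pose f : R * R * R -> R[i] := fun x => -1 * f2 x + f1 x.
have Lf : inL2 Omega f by exact: inL2_lin.
(* Sources enter the graph through [b F]; division by [b] stays in L^2 because its inverse is
   bounded. *)
pose f' : R * R * R -> R[i] := fun x => ((b x)^-1)%:C%C * f x.
have Lf' : inL2 Omega f' by exact: (inLoo_mul mO Lb1 Lf).
have bf' : {ae @leb3 R, forall x, Omega x -> bmul b f' x = f x}.
  apply: ae_imp Hb => x b0 /b0 bx; rewrite /bmul /f'.
  by apply: c_ext; rewrite !cpartE /=; field; rewrite gt_eqF.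
have f0 : {ae @leb3 R, forall x, Omega x -> f x = 0} -> ae_eq_on Omega f1 f2.
  by apply: ae_imp => x fx /fx /eqP; rewrite /f mulN1r addrC subr_eq0 => /eqP.
have [k0 /(limit_point_sqr K_pos) HK] := K_acc.
pose E := (R * R * R -> R[i]^o)%type.
pose iota : {rmorphism R -> R[i]} := real_complex R.
(* Bridges the module notation of the abstract part and the pointwise form, in which the summands
   come in the other order. *)
have addE (c : R) (X Y : E) : X + iota c *: Y = (fun x => c%:C%C * Y x + X x).
  by apply/funext => x; rewrite addrC.
have : bip Omega b f' f' = 0 \/ exists (mu : R) (X : E),
    zgraph Omega a b X ((f' : E) + iota mu *: X) /\ bip Omega b X X = 0.
  apply: (@regular_symmetric_range R R[i] E iota (inL2 Omega) (bip Omega b)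
    (zgraph Omega a b) _ _ _ _ _ _ _ _ _ _ f' HK Lf').
  - by move=> c X Y LX LY; rewrite addE; exact: inL2_lin.
  - by move=> X Y; exact: bipC.
  - by move=> c X Y Z LX LY LZ; rewrite addE; exact: (bip_lin oO Lb).
  - by move=> X LX; exact: (bip_ge0 oO Lb Hb LX).
  - by move=> X F; exact: zgraph_L2.
  - by move=> c X Y F H GX GY; rewrite !addE; exact: (zgraph_lin oO La Lb c GX GY).
  - by move=> X F Y H GX GY; exact: (zgraph_sym oO La GX GY).
  (* Every positive [mu] is the square of a frequency at which the direct problem is well posed,
     whether or not that frequency lies in [K]. *)
  - move=> mu; have [mu0|mu0] := leP mu 0.
      have [C HC] := zgraph_reg_le0 oO bO lO La Lb a00 Ha Hb mu0.
      by exists C => X F G; rewrite addE; exact: HC.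
    have k0' : 0 < Num.sqrt mu by rewrite sqrtr_gt0.
    have [C HC] := zgraph_reg_gt0 oO bO Lb Hb k0' (h_neq0 _ k0') (h_ext _ k0') (h_direct _ k0').
    exists C => X F G; rewrite addE; have := HC _ _ G.
    by rewrite sqr_sqrtr// ltW.
  - move=> _ [k Kk <-]; have kp := K_pos _ Kk; have [g [t1 t2]] := h_coincide _ Kk.
    have [W tW HW] := direct_difference oO bO La Lb (h_neq0 _ kp) (h_ext _ kp)
      hf1 hf2 (hu1 _ kp) (hu2 _ kp) t1 t2.
    exists (W : E); exists W; split => //.
      by rewrite addE; apply: inL2_lin => //; exact: h1_L2.
    move=> v psi tv; rewrite addE (HW _ _ tv).
    rewrite (inner_bmul_lin oO Lb _ _ (h1_L2 W) Lf') addrC; congr (_ + _).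
    by apply/esym; apply: (inner_ae_eq mO _ Lf (h1_L2 v) bf'); exact: (inL2_bmul oO Lb).
(* A null [f'] gives [f = b f' = 0] at once. In the other case [b (f' + mu X)] vanishes almost
   everywhere, and so does [X], which leaves [b f' = 0]. *)
move=> [|[mu [X [G X0]]]].
  move=> /(bip_eq0 oO Lb Hb Lf') f'0; apply: f0.
  by apply: ae_imp2 f'0 bf' => x e e' Ox; rewrite -(e' Ox) /bmul (e Ox) mulr0.
apply: f0; have [LX _] := zgraph_L2 G.
have := zgraph_null oO bO La Lb a00 Ha Hb G X0; rewrite addE => H.
have aX := bip_eq0 oO Lb Hb LX X0.
have H' : {ae @leb3 R, forall x, Omega x -> bmul b f' x = 0}.
  apply: ae_imp2 H aX => x e e' Ox; have := e Ox.
  by rewrite /bmul (e' Ox) mulr0 add0r.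
by apply: ae_imp2 H' bf' => x e e' Ox; rewrite -(e' Ox) (e Ox).
Qed.
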